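(* Let $\varepsilon>0$ be sufficiently small and $\phi$ an even Hecke–Maass cusp form. There are $\gg t_\phi^{\frac1{12}-\varepsilon}$ integers $l$ with $1\ll l\ll t_\phi^{\frac16-\varepsilon}$ such that $\phi$ has $2l$ zeros on the closed horocycle $\mathcal{C}_{Y_l}=\{x+iY_l:-\frac12<x\le\frac12\}$, where $Y_l=\frac{t_\phi}{2\pi l}$. Thus there are a growing number of closed horocycles $\mathcal{C}_Y$ each carrying $\frac1\pi\frac{t_\phi}{Y}$ zeros of $\phi$.
   Context: An even Hecke–Maass cusp form is a real-valued $\phi$ on $\mathbb{H}$ with $y^2(\partial_x^2+\partial_y^2)\phi+(\frac14+t_\phi^2)\phi=0$, $t_\phi>0$, $\mathrm{SL}_2(\mathbb{Z})$-invariant, $\phi(-\bar z)=\phi(z)$, $L^2$-normalized on $\mathrm{SL}_2(\mathbb{Z})\backslash\mathbb{H}$, eigenfunction of all Hecke operators. Asymptotics as $t_\phi\to\infty$. *)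

(* Defs.v *)
From HB Require Import structures.
From mathcomp Require Import all_boot all_order all_algebra.
From mathcomp Require Import finmap complex.
From mathcomp Require Import all_classical all_reals all_analysis.

Set Implicit Arguments.
Unset Strict Implicit.
Unset Printing Implicit Defensive.

Import Order.TTheory GRing.Theory Num.Theory.
Import numFieldNormedType.Exports.

Local Open Scope classical_set_scope.
Local Open Scope ring_scope.
Local Open Scope complex_scope.
Local Open Scope card_scope.

Section MaassForms.
Context {R : realType}.
Implicit Types (z : R[i]) (f : R * R -> R) (phi : R[i] -> R).

(* Functions on the upper half-plane are total functions on R[i]; their values
   outside [upper_half_plane] are never used. *)
Definition upper_half_plane : set R[i] := [set z | 0 < complex.Im z].

Definition moebius (g : 'M[int]_2) z : R[i] :=
  ((g 0 0)%:~R * z + (g 0 1)%:~R) / ((g 1 0)%:~R * z + (g 1 1)%:~R).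

Definition in_coordinates phi : R * R -> R := fun p => phi (p.1 +i* p.2).

Definition partial_x f : R * R -> R := fun p => 'D_((1, 0) : R * R) f p.
Definition partial_y f : R * R -> R := fun p => 'D_((0, 1) : R * R) f p.

Definition C1_on (U : set (R * R)) f : Prop :=
  forall p, U p ->
    [/\ derivable f p ((1, 0) : R * R), derivable f p ((0, 1) : R * R),
        {for p, continuous (partial_x f)} & {for p, continuous (partial_y f)}].

Definition C2_on (U : set (R * R)) f : Prop :=
  [/\ C1_on U f, C1_on U (partial_x f) & C1_on U (partial_y f)].

Definition euclidean_laplacian f : R * R -> R :=
  fun p => partial_x (partial_x f) p + partial_y (partial_y f) p.

(* T_n phi (z) = n^(-1/2) * sum_(a d = n) sum_(b mod d) phi ((a z + b) / d) *)
Definition hecke_operator (n : nat) phi : R[i] -> R := fun z =>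
  (Num.sqrt n%:R)^-1 *
  \sum_(d <- divisors n) \sum_(b < d)
     phi (((n %/ d)%N%:R * z + b%:R) / d%:R).

(* Closed standard fundamental domain of SL_2(Z); it differs from a strict
   fundamental domain by a null set. *)
Definition fundamental_domain : set (R * R) :=
  [set p | [/\ 0 < p.2, `|p.1| <= 2^-1 & 1 <= p.1 ^+ 2 + p.2 ^+ 2]].

(* Squared L^2 norm on SL_2(Z)\H for the hyperbolic measure dx dy / y^2 *)
Definition petersson_norm2 phi : \bar R :=
  (\int[lebesgue_measure \x lebesgue_measure]_(p in fundamental_domain)
     ((phi (p.1 +i* p.2)%C) ^+ 2 / p.2 ^+ 2)%:E)%E.

Record even_hecke_maass_cusp_form (t : R) phi : Prop := {
  maass_spectral_gt0 : 0 < t ;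
  maass_C2 : C2_on [set p | 0 < p.2] (in_coordinates phi) ;
  maass_eigen : forall x y : R, 0 < y ->
    y ^+ 2 * euclidean_laplacian (in_coordinates phi) (x, y)
      + (4^-1 + t ^+ 2) * phi (x +i* y) = 0 ;
  maass_invariant : forall (g : 'M[int]_2) z,
    \det g = 1 -> upper_half_plane z -> phi (moebius g z) = phi z ;
  maass_even : forall z, upper_half_plane z -> phi (- z^*%C) = phi z ;
  maass_cuspidal : forall y : R, 0 < y ->
    (\int[lebesgue_measure]_(x in `[0%R, 1%R]) (phi (x +i* y)%C)%:E = 0)%E ;
  maass_normalized : petersson_norm2 phi = 1%E ;
  maass_hecke : forall n : nat, (0 < n)%N -> exists lambda : R,
    forall z, upper_half_plane z -> hecke_operator n phi z = lambda * phi z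
}.

Definition closed_horocycle (Y : R) : set R[i] :=
  [set z | - 2^-1 < complex.Re z <= 2^-1 /\ complex.Im z = Y].

(* Zeros are counted as points, without multiplicity. *)
Definition has_zeros_on (phi : R[i] -> R) (C : set R[i]) (n : nat) : Prop :=
  (C `&` [set z | phi z = 0]) #= `I_n.

End MaassForms.

(* Main.v *)
Require Import Defs.
From HB Require Import structures.
From mathcomp Require Import all_boot all_order all_algebra.
From mathcomp Require Import finmap complex.
From mathcomp Require Import all_classical all_reals all_analysis.
From mathcomp Require Import measurable_realfun ring lra.

Set Implicit Arguments.
Unset Strict Implicit.
Unset Printing Implicit Defensive.

Import Order.TTheory GRing.Theory Num.Theory.
Import numFieldNormedType.Exports.

Local Open Scope classical_set_scope.
Local Open Scope ring_scope.

(**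
High in the cusp, at height [Y_l = t / (2 pi l)], the cosine expansion of the
form has coefficients [lam n * K_{it}(t n / l)] up to a common factor.  The term
[n = l] sits exactly at the turning point of the Bessel function.  An energy
estimate for its differential equation shows that the value there dominates: the
terms [n < l] lose a power of [t] against it, and those with [n > l] decay
exponentially.  Hence, as soon as [|lam l| >= 1/2], the form restricted to the
horocycle is a small [C^1] perturbation of a multiple of [cos (2 pi l x)] and has
exactly [2 l] zeros.

The terms [n < l] are controlled in mean square.  A crude polynomial bound, read
off from the sup norm of the form, is amplified by iterating Hecke
multiplicativity into [sum_(n <= N) lam n ^ 2 << t^eps N].

Finally [lam p ^ 2 = lam (p ^ 2) + 1] forces [|lam p| >= 1/2] or
[|lam (p ^ 2)| >= 1/2] for each prime [p], so that [l] can be taken to be [p] or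
[p ^ 2] with [p <= t^(1/12 - eps')]; Chebyshev's lower bound counts these.
*)

(** Why these exponents: below the turning point the squared profile is at most of order
    [t^(-1/3) * sqrt (l / (l - n))], so Cauchy-Schwarz against the mean square bounds the sum over
    [n < l] by about [t^(eps/2) * l * t^(-1/6)]. This is small for [l] below [t^(1/6)], and as [l]
    may have to be [p ^ 2], only primes up to [t^(1/12)] are available. The transition zone of the
    equation has width [t^(-2/3)] in the logarithm of the argument, which is why [t] is written
    [tau ^+ 3]. No Bessel function is constructed. In logarithmic height every cosine coefficient,
    suitably scaled, solves [k'' = (exp (2 s) - t^2) k], and finiteness of the Petersson norm
    excludes growing solutions; all bounds are read off from these two facts. All constants must be
    uniform in the form, so its size never enters in absolute terms: the sup norm and the
    coefficients are both measured against [k0], the value at the turning point, which cancels. *)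

(** * Monotonicity from the sign of a derivative; elementary exponential bounds *)

Lemma is_derive_nondecreasing (R : realType) (f df : R -> R) (a b : R) :
  a <= b -> (forall x, a <= x <= b -> is_derive x 1 f (df x)) ->
  (forall x, a <= x <= b -> 0 <= df x) -> f a <= f b.
Proof.
move=> ab dfE df0.
have cf : {within `[a, b], continuous f}.
  apply: derivable_within_continuous => x; rewrite in_itv/= => xab.
  by have := dfE x xab => -[].
have dfE' x : x \in `]a, b[%R -> is_derive x 1 f (df x).
  by rewrite in_itv/= => /andP[ax xb]; apply: dfE; rewrite !ltW.
have [c cab E] := MVT_segment ab dfE' cf.
by rewrite -subr_ge0 E mulr_ge0 ?subr_ge0// df0// -in_itv.
Qed.

Lemma is_derive_nonincreasing (R : realType) (f df : R -> R) (a b : R) :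
  a <= b -> (forall x, a <= x <= b -> is_derive x 1 f (df x)) ->
  (forall x, a <= x <= b -> df x <= 0) -> f b <= f a.
Proof.
move=> ab dfE df0; rewrite -lerN2.
apply: (@is_derive_nondecreasing _ (fun x => - f x) (fun x => - df x)) => // x xab.
  by have ? := dfE x xab; exact: is_deriveN.
by rewrite oppr_ge0 df0.
Qed.


Lemma expR_le_inv (R : realType) (x : R) : x < 1 -> expR x <= (1 - x)^-1.
Proof.
move=> x1; rewrite -[x in expR x]opprK expRN lef_pV2 ?posrE ?expR_gt0 ?subr_gt0//.
exact: expR_ge1Dx.
Qed.

Lemma expR_le1D2 (R : realType) (x : R) : 0 <= x <= 2^-1 -> expR x <= 1 + 2 * x.
Proof.
move=> /andP[x0 x1]; apply: (le_trans (expR_le_inv _)); first lra.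
rewrite -[leLHS]mul1r ler_pdivrMr; nra.
Qed.

Lemma expRN_le (R : realType) (x : R) : 0 <= x <= 1 -> expR (- x) <= 1 - x / 2.
Proof.
move=> /andP[x0 x1]; apply: (le_trans (expR_le_inv _)); first lra.
rewrite opprK -[leLHS]mul1r ler_pdivrMr; nra.
Qed.

Lemma expR1_le4 (R : realType) : expR 1 <= 4 :> R.
Proof.
have -> : (1 : R) = 2^-1 + 2^-1 by lra.
rewrite expRD; have := @expR_le1D2 R 2^-1 ltac:(lra).
have := expR_gt0 (2^-1 : R); nra.
Qed.

(** * The modified Bessel equation in a logarithmic variable *)

Section ModifiedBesselEquation.
Context (R : realType) (k dk : R -> R) (t : R).
Hypothesis hk : forall s : R, is_derive s 1 k (dk s).
Hypothesis hdk : forall s : R, is_derive s 1 dk ((expR (2 * s) - t ^+ 2) * k s).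

Local Notation q s := (expR (2 * s) - t ^+ 2).

Lemma is_derive_sol_mul_deriv (s : R) :
  is_derive s 1 (fun s => k s * dk s) (dk s ^+ 2 + q s * k s ^+ 2).
Proof.
have ? := hk s; have ? := hdk s.
by apply: is_derive_eq; rewrite /GRing.scale/=; ring.
Qed.

Lemma is_derive_sol_sqr (s : R) : is_derive s 1 (fun s => k s ^+ 2) (2 * (k s * dk s)).
Proof. by have ? := hk s; apply: is_derive_eq; rewrite /GRing.scale/=; ring. Qed.

Lemma potential_le (s s' : R) : s <= s' -> q s <= q s'.
Proof. by move=> ss'; rewrite lerD2r ler_expR ler_pM2l. Qed.

(** With [p = k k'], the identity [p' = k'^2 + q k^2] keeps [p] positive, and once [q >= 1] it gives
    [p' >= 2 p], so [p] grows like [exp (2 s)]; then so does [k^2], whose derivative is [2 p]. *)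
Lemma growing_solution (s1 : R) : 0 <= q s1 -> 0 < k s1 * dk s1 ->
  exists c S : R, 0 < c /\ forall s, S <= s -> c * expR (2 * s) <= k s ^+ 2.
Proof.
move=> q1 p1.
(* Past [t ^+ 2 + 1], the inequality [expR x >= 1 + x] already gives [q >= 1]. *)
pose s2 := Num.max s1 (t ^+ 2 + 1).
have s12 : s1 <= s2 by rewrite le_max lexx.
have q2 s : s2 <= s -> 1 <= q s.
  move=> s2s; apply: le_trans (potential_le s2s).
  have : t ^+ 2 + 1 <= s2 by rewrite le_max lexx orbT.
  have := expR_ge1Dx (2 * s2); have := sqr_ge0 t; lra.
pose p s := k s * dk s.
have p2 : p s1 <= p s2.
  apply: (@is_derive_nondecreasing _ p (fun s => dk s ^+ 2 + q s * k s ^+ 2)) => // s /andP[s1s _].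
    exact: is_derive_sol_mul_deriv.
  apply: addr_ge0; first exact: sqr_ge0.
  by apply: mulr_ge0 (sqr_ge0 _); apply: le_trans q1 (potential_le _).
have p20 : 0 < p s2 by apply: lt_le_trans p2.
have pge s : s2 <= s -> p s2 * expR (2 * (s - s2)) <= p s.
  move=> s2s.
  have : p s2 * expR (- (2 * s2)) <= p s * expR (- (2 * s)).
    apply: (@is_derive_nondecreasing _ (fun s => k s * dk s * expR (- (2 * s)))
      (fun s => (dk s ^+ 2 + q s * k s ^+ 2 - 2 * (k s * dk s)) * expR (- (2 * s)))) => //.
      move=> x _; have ? := is_derive_sol_mul_deriv x.
      by apply: is_derive_eq; rewrite /GRing.scale/=; ring.
    move=> x /andP[s2x _]; rewrite mulr_ge0 ?expR_ge0//.
    have := q2 _ s2x; have := sqr_ge0 (k x - dk x); have := sqr_ge0 (k x); nra.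
  rewrite -(ler_pM2r (expR_gt0 (2 * s))) -!mulrA -!expRD addNr expR0 mulr1.
  by rewrite mulrBr addrC.
(* One unit past [s2], [exp (2 (s - s2)) >= 2], so half of the exponential pays for the [- 1] left
   by integrating from [s2]. *)
exists (p s2 / 2 * expR (- (2 * s2))), (s2 + 1); split.
  by rewrite mulr_gt0 ?expR_gt0 ?divr_gt0.
move=> s s2s; have s2s' : s2 <= s by lra.
have -> : p s2 / 2 * expR (- (2 * s2)) * expR (2 * s) = p s2 / 2 * expR (2 * (s - s2)).
  by rewrite -(mulrA _ (expR _)) -expRD; congr (_ * expR _); ring.
have : k s2 ^+ 2 - p s2 * expR (2 * (s2 - s2)) <= k s ^+ 2 - p s2 * expR (2 * (s - s2)).
  apply: (@is_derive_nondecreasing _ (fun s => k s ^+ 2 - p s2 * expR (2 * (s - s2)))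
     (fun s => 2 * (k s * dk s) - p s2 * (2 * expR (2 * (s - s2))))) => //.
    move=> x _; have ? := is_derive_sol_sqr x.
    by apply: is_derive_eq; rewrite /GRing.scale/=; ring.
  by move=> x /andP[s2x _]; have := pge _ s2x; rewrite /p; lra.
rewrite subrr mulr0 expR0.
have := expR_ge1Dx (2 * (s - s2)); have := sqr_ge0 (k s2); nra.
Qed.

Hypothesis knogrow :
  ~ exists c S : R, 0 < c /\ forall s, S <= s -> c * expR (2 * s) <= k s ^+ 2.

Lemma sol_mul_deriv_le0 (s : R) : 0 <= q s -> k s * dk s <= 0.
Proof.
by move=> qs; rewrite leNgt; apply/negP => ps; exact/knogrow/(growing_solution qs ps).
Qed.

Lemma sol_sqr_nonincreasing (s s' : R) : 0 <= q s -> s <= s' -> k s' ^+ 2 <= k s ^+ 2.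
Proof.
move=> qs ss'; apply: (@is_derive_nonincreasing _ (fun s => k s ^+ 2) (fun s => 2 * (k s * dk s))) => // x /andP[sx _].
  exact: is_derive_sol_sqr.
by rewrite pmulr_rle0//; apply/sol_mul_deriv_le0/(le_trans qs)/potential_le.
Qed.

(** With [w = k k' + kap k^2], it is enough that [w <= 0], that is [(k^2)' <= - 2 kap k^2]. Since
    [q >= kap^2], [w' >= (k' + kap k)^2], and [k^2] times the right side is [w^2]. A positive value
    of [w] would therefore force at least linear growth, while [w <= kap k^2] stays bounded because
    [k k' <= 0] and [k^2] decreases. *)
Lemma sol_sqr_decay (a kap s : R) : 0 < kap -> kap ^+ 2 <= q a -> a <= s ->
  k s ^+ 2 <= k a ^+ 2 * expR (- (2 * kap * (s - a))).
Proof.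
move=> kap0 qa as_.
have qx x : a <= x -> kap ^+ 2 <= q x by move=> ax; apply: le_trans (potential_le ax).
have qx0 x : a <= x -> 0 <= q x by move=> /qx; apply: le_trans; exact: sqr_ge0.
pose w x := k x * dk x + kap * k x ^+ 2.
pose dw x := dk x ^+ 2 + q x * k x ^+ 2 + kap * (2 * (k x * dk x)).
have dwE (x : R) : is_derive x 1 w (dw x).
  have ? := is_derive_sol_sqr x; have ? := is_derive_sol_mul_deriv x.
  by apply: is_derive_eq; rewrite /GRing.scale/= /dw; ring.
have dwge x : a <= x -> (dk x + kap * k x) ^+ 2 <= dw x.
  by move=> ax; rewrite /dw; have := qx _ ax; have := sqr_ge0 (k x); nra.
have w0 x : a <= x -> w x <= 0.
  move=> ax; rewrite leNgt; apply/negP => wx.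
  have wmon y : x <= y -> w x <= w y.
    move=> xy; apply: (@is_derive_nondecreasing _ w dw) => // z /andP[xz _].
    by apply: le_trans (dwge _ (le_trans ax xz)); exact: sqr_ge0.
  have B0 : 0 < k x ^+ 2.
    rewrite lt_neqAle sqr_ge0 andbT eq_sym sqrf_eq0; apply: contraTN wx => /eqP kx0.
    by rewrite /w kx0 mul0r expr0n/= mulr0 addr0 ltxx.
  have wlin y : x <= y -> w x + w x ^+ 2 / k x ^+ 2 * (y - x) <= w y.
    move=> xy; rewrite -lerBrDr.
    have := @is_derive_nondecreasing _ (fun y => w y - w x ^+ 2 / k x ^+ 2 * (y - x))
      (fun y => dw y - w x ^+ 2 / k x ^+ 2) x y xy.
    rewrite subrr mulr0 subr0; apply => z.
      move=> _; have ? := dwE z.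
      by apply: is_derive_eq; rewrite /GRing.scale/=; ring.
    move=> /andP[xz _]; have az := le_trans ax xz; rewrite subr_ge0.
    apply: le_trans (dwge _ az); rewrite ler_pdivrMr//.
    have kz := sol_sqr_nonincreasing (qx0 _ ax) xz.
    have wz := wmon _ xz.
    have : w x ^+ 2 <= w z ^+ 2 by rewrite ler_sqr ?nnegrE ?(ltW wx) ?(le_trans (ltW wx)).
    have -> : w z ^+ 2 = (dk z + kap * k z) ^+ 2 * k z ^+ 2 by rewrite /w; ring.
    move=> h; apply: (le_trans h); apply: ler_wpM2l => //; exact: sqr_ge0.
  (* At [y] the linear lower bound for [w] has gained [kap * k x ^+ 2], the most that [w] can be. *)
  pose y := x + (kap * k x ^+ 2) * (k x ^+ 2 / w x ^+ 2).
  have w2 : 0 < w x ^+ 2 by rewrite exprn_gt0.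
  have xy : x <= y by rewrite lerDl; apply: mulr_ge0; [apply: mulr_ge0|apply: divr_ge0]; exact: ltW.
  have wy := wlin _ xy.
  have E : w x ^+ 2 / k x ^+ 2 * (y - x) = kap * k x ^+ 2.
    by rewrite /y; field; rewrite gt_eqF//= -sqrf_eq0 gt_eqF.
  rewrite {}E {2}/w in wy.
  have ay := le_trans ax xy.
  have := sol_mul_deriv_le0 (qx0 _ ay); have := sol_sqr_nonincreasing (qx0 _ ax) xy.
  by rewrite -(ler_pM2l kap0) => ? ?; lra.
have : k s ^+ 2 * expR (2 * kap * s) <= k a ^+ 2 * expR (2 * kap * a).
  apply: (@is_derive_nonincreasing _ (fun s => k s ^+ 2 * expR (2 * kap * s))
    (fun s => 2 * w s * expR (2 * kap * s))) => // x.
    move=> _; have ? := is_derive_sol_sqr x.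
    by apply: is_derive_eq; rewrite /GRing.scale/= /w; ring.
  move=> /andP[ax _]; have := w0 _ ax; have := expR_gt0 (2 * kap * x); nra.
rewrite -(ler_pM2r (expR_gt0 (- (2 * kap * s)))) -(mulrA (k s ^+ 2)) -(mulrA (k a ^+ 2)).
rewrite -!expRD subrr expR0 mulr1.
by have -> : 2 * kap * a - 2 * kap * s = - (2 * kap * (s - a)) by ring.
Qed.

(** A zero where [q >= 0] kills [k] to its right, as [k^2] decreases there; to the left, a Gronwall
    weight propagates a common zero of [k] and [dk]. *)
Lemma sol_eq0 (s1 : R) : 0 <= q s1 -> k s1 = 0 -> forall s, k s = 0.
Proof.
move=> q1 k10.
have kr s : s1 <= s -> k s = 0.
  move=> s1s; apply/eqP; rewrite -sqrf_eq0 eq_le sqr_ge0 andbT.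
  by have := sol_sqr_nonincreasing q1 s1s; rewrite k10 expr0n.
(* The mean value theorem supplies a point [c] to the right of [s1] at which [dk] vanishes as
   well. *)
have [c cin E] : exists2 c, c \in `]s1, (s1 + 1)[%R & k (s1 + 1) - k s1 = dk c * (s1 + 1 - s1).
  apply: (@MVT _ k dk) ; first by rewrite ltrDl.
  by apply: derivable_within_continuous => x _; have [] := hk x.
move: cin; rewrite in_itv/= => /andP[s1c _].
have dkc : dk c = 0.
  move: E; rewrite (kr (s1 + 1)) ?lerDl// k10 subrr => /esym/eqP.
  by rewrite (_ : s1 + 1 - s1 = 1) ?mulr1; [move/eqP|ring].
move=> s; have [cs|sc] := leP c s; first by apply/kr/(le_trans (ltW s1c)).
(* Dominates [|1 + q|] on all of [s <= c], which suffices as [2 |k dk| <= k^2 + dk^2]. *)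
pose C := 1 + expR (2 * c) + t ^+ 2.
have : (k s ^+ 2 + dk s ^+ 2) * expR (C * s) <= (k c ^+ 2 + dk c ^+ 2) * expR (C * c).
  apply: (@is_derive_nondecreasing _ (fun s => (k s ^+ 2 + dk s ^+ 2) * expR (C * s))
    (fun s => (2 * (k s * dk s) * (1 + q s) + C * (k s ^+ 2 + dk s ^+ 2)) * expR (C * s))).
  - exact: ltW.
  - move=> x _; have ? := hk x; have ? := hdk x.
    by apply: is_derive_eq; rewrite /GRing.scale/=; ring.
  - move=> x /andP[_ xc]; rewrite mulr_ge0 ?expR_ge0// /C.
    have := potential_le xc; have := expR_gt0 (2 * x); have := sqr_ge0 t.
    set e := expR (2 * x); set f := expR (2 * c); set T := t ^+ 2 => T0 e0 ef.
    have h1 := sqr_ge0 (k x + dk x); have h2 := sqr_ge0 (k x - dk x).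
    have -> : 2 * (k x * dk x) * (1 + (e - T)) + (1 + f + T) * (k x ^+ 2 + dk x ^+ 2)
      = (1 + e) * (k x + dk x) ^+ 2 + (f - e) * (k x ^+ 2 + dk x ^+ 2) + T * (k x - dk x) ^+ 2 by ring.
    have h3 : 0 <= k x ^+ 2 + dk x ^+ 2 by rewrite addr_ge0 ?sqr_ge0.
    by apply: addr_ge0; [apply: addr_ge0|]; apply: mulr_ge0 => //; lra.
rewrite (kr c (ltW s1c)) dkc expr0n/= add0r mul0r pmulr_lle0 ?expR_gt0// => h.
apply/eqP; rewrite -sqrf_eq0 eq_le sqr_ge0 andbT (le_trans _ h)//.
by rewrite lerDl sqr_ge0.
Qed.

End ModifiedBesselEquation.

(** * The solution normalized to be 1 at its turning point *)

(** Source of the constant [2000]: the chain of inequalities gives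
    [2 * 4 * (3 / 2) * 156 = 1872]. *)
Lemma energy_compare (R : realFieldType) (g h g1 h1 e e1 T : R) :
  g <= 2 * h -> 0 <= g -> h * e <= h1 * e1 -> 1 <= e -> 0 < e1 -> e1 <= 4 ->
  2 * h1 <= 3 * g1 -> 0 <= h1 -> g1 <= 156 * T -> g <= 2000 * T.
Proof.
move=> gh g0 hH e_1 e1_0 e14 hg h10 gT.
have h0 : h <= h * e by rewrite ler_peMr//; lra.
have : h1 * e1 <= h1 * 4 by rewrite ler_wpM2l.
lra.
Qed.

Section NormalizedBessel.
Context (R : realType) (k dk : R -> R) (tau s0 : R).
Local Notation t := (tau ^+ 3).
Hypothesis tau2 : 2 <= tau.
Hypothesis s0E : expR s0 = t.
Hypothesis hk : forall s : R, is_derive s 1 k (dk s).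
Hypothesis hdk : forall s : R, is_derive s 1 dk ((expR (2 * s) - t ^+ 2) * k s).
Hypothesis knogrow :
  ~ exists c S : R, 0 < c /\ forall s, S <= s -> c * expR (2 * s) <= k s ^+ 2.
Hypothesis k01 : k s0 = 1.

Local Notation q s := (expR (2 * s) - t ^+ 2).

Let tau0 : 0 < tau. Proof. by apply: lt_le_trans tau2. Qed.
Let itau2 : 0 < tau ^- 2 <= 4^-1.
Proof.
rewrite invr_gt0 exprn_gt0//= lef_pV2 ?posrE ?exprn_gt0//.
by have := tau2; nra.
Qed.
Let itauE : tau ^- 2 * tau ^+ 6 = tau ^+ 4.
Proof. by field; rewrite gt_eqF. Qed.

Lemma expR_shift (s : R) : expR (2 * s) = tau ^+ 6 * expR (2 * (s - s0)).
Proof.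
have -> : tau ^+ 6 = expR s0 * expR s0 by rewrite s0E; ring.
by rewrite -!expRD; congr expR; ring.
Qed.

Let t2E : t ^+ 2 = tau ^+ 6. Proof. by ring. Qed.

Let q_ge0 (s : R) : s0 <= s -> 0 <= q s.
Proof.
move=> s0s; rewrite (expR_shift s) t2E -[X in _ - X]mulr1 -mulrBr.
rewrite mulr_ge0 ?exprn_ge0 ?(ltW tau0)// subr_ge0.
by have := expR_ge1Dx (2 * (s - s0)); lra.
Qed.

Let kcont a b : {within `[a, b], continuous k}.
Proof. by apply: derivable_within_continuous => x _; have [] := hk x. Qed.

Lemma bessel_gt0 (s : R) : s0 <= s -> 0 < k s.
Proof.
move=> s0s; rewrite ltNge; apply/negP => ks.
have [c cin kc] : exists2 c, c \in `[s0, s]%R & k c = 0.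
  by apply: IVT => //; rewrite k01 ge_min ks orbT le_max ler01.
have s0c : s0 <= c by rewrite (itvP cin).
have := sol_eq0 hk hdk knogrow (q_ge0 s0c) kc s0.
by rewrite k01 => /eqP; rewrite oner_eq0.
Qed.

Lemma bessel_le1 (s : R) : s0 <= s -> k s <= 1.
Proof.
move=> s0s; have := sol_sqr_nonincreasing hk hdk knogrow (q_ge0 (lexx _)) s0s.
rewrite k01 expr1n -[leRHS](expr1n _ 2) ler_sqr ?nnegrE//.
exact/ltW/bessel_gt0.
Qed.

Lemma bessel_deriv_le0 (s : R) : s0 <= s -> dk s <= 0.
Proof.
move=> s0s; have := sol_mul_deriv_le0 hk hdk knogrow (q_ge0 s0s).
by rewrite pmulr_rle0// bessel_gt0.
Qed.

Let q_le (s : R) : s0 <= s <= s0 + tau ^- 2 -> q s <= 4 * tau ^+ 4.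
Proof.
move=> /andP[s0s ss]; rewrite (expR_shift s) t2E -itauE.
have h : expR (2 * (s - s0)) <= 1 + 2 * (2 * (s - s0)).
  by apply: expR_le1D2; have /andP[] := itau2; lra.
have t6 : 0 < tau ^+ 6 by rewrite exprn_gt0.
have -> : tau ^+ 6 * expR (2 * (s - s0)) - tau ^+ 6 =
  (expR (2 * (s - s0)) - 1) * tau ^+ 6 by ring.
by rewrite [leRHS]mulrA ler_pM2r//; lra.
Qed.

(** On the window of length [tau^-2] beyond [s0] the slope rises by at most
    [4 tau^4 * tau^-2 = 4 tau^2]; a slope below [- 5 tau^2] at [s0] would then drag [k] from [1] to
    below [0]. *)
Lemma bessel_deriv_turning : - (5 * tau ^+ 2) <= dk s0.
Proof.
have /andP[h0 h1] := itau2.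
have t20 : 0 < tau ^+ 2 by rewrite exprn_gt0.
have hE : tau ^- 2 * tau ^+ 4 = tau ^+ 2 by field; rewrite gt_eqF.
have hE1 : tau ^- 2 * tau ^+ 2 = 1 by field; rewrite gt_eqF.
have dks (s : R) : s0 <= s <= s0 + tau ^- 2 -> dk s <= dk s0 + 4 * tau ^+ 2.
  move=> /andP[s0s ss].
  have := @is_derive_nonincreasing _ (fun s => dk s - 4 * tau ^+ 4 * (s - s0))
    (fun s => q s * k s - 4 * tau ^+ 4) s0 s s0s.
  rewrite subrr mulr0 subr0 => h.
  have : dk s - 4 * tau ^+ 4 * (s - s0) <= dk s0.
    apply: h => x.
      by move=> _; have ? := hdk x; apply: is_derive_eq; rewrite /GRing.scale/=; ring.
    move=> /andP[s0x xs]; rewrite subr_le0.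
    have qx : q x <= 4 * tau ^+ 4 by apply: q_le; rewrite s0x (le_trans xs).
    by have := bessel_gt0 s0x; have := bessel_le1 s0x; have := q_ge0 s0x; nra.
  have : (s - s0) * tau ^+ 4 <= tau ^- 2 * tau ^+ 4 by rewrite ler_pM2r ?exprn_gt0//; lra.
  by rewrite hE; lra.
have s0h : s0 <= s0 + tau ^- 2 by lra.
have := @is_derive_nonincreasing _ (fun s => k s - (dk s0 + 4 * tau ^+ 2) * (s - s0))
    (fun s => dk s - (dk s0 + 4 * tau ^+ 2)) s0 _ s0h.
rewrite subrr mulr0 subr0 k01 => h.
have : k (s0 + tau ^- 2) - (dk s0 + 4 * tau ^+ 2) * (s0 + tau ^- 2 - s0) <= 1.
  apply: h => x xin; last by rewrite subr_le0 dks.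
  by have ? := hk x; apply: is_derive_eq; rewrite /GRing.scale/=; ring.
rewrite (_ : s0 + _ - _ = tau ^- 2); last by ring.
have := bessel_gt0 s0h; rewrite mulrDl -mulrA (mulrC (tau ^+ 2)) hE1 => h2 h3.
have : 0 <= dk s0 * tau ^- 2 + 5 by lra.
rewrite -(ler_pM2r t20) mul0r mulrDl -mulrA hE1; lra.
Qed.

(** Beyond [s0] the solution is convex and stays above its tangent at [s0]:
    [1 - 5 tau^2 * tau^-2 / 10 = 1 / 2]. *)
Lemma bessel_near_turning (s : R) : s0 <= s <= s0 + tau ^- 2 / 10 -> 2^-1 <= k s.
Proof.
move=> /andP[s0s ss]; have := bessel_deriv_turning.
have t20 : 0 < tau ^+ 2 by rewrite exprn_gt0.
have hE1 : tau ^- 2 * tau ^+ 2 = 1 by field; rewrite gt_eqF.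
have := @is_derive_nondecreasing _ (fun s => k s - dk s0 * (s - s0))
    (fun s => dk s - dk s0) s0 _ s0s.
rewrite subrr mulr0 subr0 k01 => h.
have : 1 <= k s - dk s0 * (s - s0).
  apply: h => x.
    by move=> _; have ? := hk x; apply: is_derive_eq; rewrite /GRing.scale/=; ring.
  move=> /andP[s0x _]; rewrite subr_ge0.
  apply: (@is_derive_nondecreasing _ dk (fun s => q s * k s)) => // y /andP[s0y _].
  by rewrite mulr_ge0 ?q_ge0// ltW// bessel_gt0.
move=> h1 h2.
have : (s - s0) * tau ^+ 2 <= 10^-1.
  apply: (@le_trans _ _ (tau ^- 2 / 10 * tau ^+ 2)); first by rewrite ler_pM2r//; lra.
  by rewrite mulrAC hE1 mul1r.
nra.
Qed.

Lemma bessel_decay (a kap s : R) : 0 < kap -> kap ^+ 2 <= q a -> s0 <= a -> a <= s ->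
  k s <= expR (- (kap * (s - a))).
Proof.
move=> kap0 qa s0a as_.
rewrite -ler_sqr ?nnegrE ?expR_ge0//; last exact/ltW/bessel_gt0/(le_trans s0a).
apply: (le_trans (sol_sqr_decay hk hdk knogrow kap0 qa as_)).
rewrite -expRM_natl (_ : 2 * - (kap * (s - a)) = - (2 * kap * (s - a))); last by ring.
rewrite ler_piMl ?expR_ge0// expr_le1//; first exact: bessel_le1.
exact/ltW/bessel_gt0.
Qed.

(** Energy adapted to the transition zone, where a derivative costs [tau^2]. *)
Let V (s : R) := k s ^+ 2 + dk s ^+ 2 / tau ^+ 4.

(** Within [tau^-2] left of [s0] one has [- 2 <= q / tau^4 <= 0], hence [V' >= - tau^2 V], and going
    back over the zone costs at most a factor [e <= 4]. With [V s0 <= 1 + 25] this gives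
    [104 = 26 * 4]. *)
Let V_le (s : R) : s0 - tau ^- 2 <= s <= s0 -> V s <= 104.
Proof.
move=> /andP[ss s0s]; have /andP[h0 h1] := itau2.
have t40 : 0 < tau ^+ 4 by rewrite exprn_gt0.
have t20 : 0 < tau ^+ 2 by rewrite exprn_gt0.
have hE1 : tau ^- 2 * tau ^+ 2 = 1 by field; rewrite gt_eqF.
have V0 : V s0 <= 26.
  rewrite /V k01 expr1n; have := bessel_deriv_le0 (lexx _); have := bessel_deriv_turning.
  move=> d1 d2; have : dk s0 ^+ 2 / tau ^+ 4 <= 25.
    by rewrite ler_pdivrMr// (_ : tau ^+ 4 = tau ^+ 2 ^+ 2); [nra|rewrite -exprM].
  by lra.
have : V s * expR (tau ^+ 2 * s) <= V s0 * expR (tau ^+ 2 * s0).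
  apply: (@is_derive_nondecreasing _ (fun s => V s * expR (tau ^+ 2 * s))
     (fun s => (2 * (k s * dk s) * (1 + q s / tau ^+ 4) + tau ^+ 2 * V s) * expR (tau ^+ 2 * s))) => //.
    move=> x _; have ? := hk x; have ? := hdk x; rewrite /V.
    by apply: is_derive_eq; rewrite /GRing.scale/=; field; rewrite gt_eqF.
  move=> x /andP[sx xs0]; rewrite mulr_ge0 ?expR_ge0//.
  have q1 : q x / tau ^+ 4 <= 0.
    by rewrite pmulr_lle0 ?invr_gt0// (le_trans (potential_le t xs0))// expR_shift
      subrr mulr0 expR0 mulr1 t2E subrr.
  have q2 : -2 <= q x / tau ^+ 4.
    rewrite ler_pdivlMr// (expR_shift x) t2E -itauE.
    have h : 1 + 2 * (x - s0) <= expR (2 * (x - s0)) by exact: expR_ge1Dx.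
    have t6 : 0 < tau ^+ 6 by rewrite exprn_gt0.
    have -> : tau ^+ 6 * expR (2 * (x - s0)) - tau ^+ 6 =
      (expR (2 * (x - s0)) - 1) * tau ^+ 6 by ring.
    by rewrite [leLHS]mulrA ler_pM2r//; lra.
  have -> : tau ^+ 2 * V x = (tau * k x) ^+ 2 + (dk x / tau) ^+ 2.
    by rewrite /V; field; rewrite gt_eqF.
  have -> : k x * dk x = (tau * k x) * (dk x / tau) by field; rewrite gt_eqF.
  set A := tau * k x; set B := dk x / tau; set C := q x / tau ^+ 4.
  have -> : 2 * (A * B) * (1 + C) + (A ^+ 2 + B ^+ 2) =
     (1 + C / 2) * (A + B) ^+ 2 + (- C / 2) * (A - B) ^+ 2 by field.
  by rewrite addr_ge0// mulr_ge0 ?sqr_ge0//; rewrite -/C in q1 q2; lra.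
rewrite -(ler_pM2r (expR_gt0 (- (tau ^+ 2 * s)))) -(mulrA (V s)) -(mulrA (V s0)).
rewrite -!expRD subrr expR0 mulr1 -mulrBr => /le_trans; apply.
apply: (@le_trans _ _ (26 * 4)); last by lra.
apply: ler_pM => //; rewrite ?expR_ge0//.
  by rewrite /V addr_ge0 ?sqr_ge0// divr_ge0 ?sqr_ge0// ltW.
apply: le_trans (expR1_le4 R); rewrite ler_expR mulrC.
have : (s0 - s) * tau ^+ 2 <= tau ^- 2 * tau ^+ 2 by rewrite ler_pM2r//; lra.
by rewrite hE1.
Qed.


(** Left of the transition zone, with [r = sqrt (t^2 - exp (2 s))], the WKB energy
    [G = r k^2 + k'^2 / r] drifts, but subtracting [A k k'] with [A = exp (2 s) / r^3] removes the
    main variation: [H' = - A' k k'], which is controlled by [A' H], and [A] stays in [[0, 1]]. So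
    [G] is bounded by a constant times its value at [s1], of order [tau^2]. The first conclusion is
    [r k^2 <= 2000 tau^2] squared, which avoids the root. *)
Lemma bessel_oscillatory (s : R) : s <= s0 ->
  k s ^+ 4 * (t ^+ 2 - expR (2 * s)) <= (2000 * tau ^+ 2) ^+ 2 /\ k s ^+ 2 <= 2000.
Proof.
move=> ss0; have /andP[h0 h1] := itau2.
have t40 : 0 < tau ^+ 4 by rewrite exprn_gt0.
have t20 : 0 < tau ^+ 2 by rewrite exprn_gt0.
have t60 : 0 < tau ^+ 6 by rewrite exprn_gt0.
(* Left end of the transition zone; between [s1] and [s0] the energy [V] suffices. *)
pose s1 := s0 - tau ^- 2.
have QE (x : R) : t ^+ 2 - expR (2 * x) = tau ^+ 6 * (1 - expR (2 * (x - s0))).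
  by rewrite (expR_shift x) t2E; ring.
have Q1u (x : R) : s1 <= x -> t ^+ 2 - expR (2 * x) <= 2 * tau ^+ 4.
  move=> sx; rewrite QE -itauE [leRHS]mulrA [leRHS]mulrC ler_pM2l//.
  have := expR_ge1Dx (2 * (x - s0)); rewrite /s1 in sx; lra.
have [s1s|ss1] := leP s1 s.
  have Vs : V s <= 104 by apply: V_le; rewrite s1s.
  have k2 : k s ^+ 2 <= 104.
    by apply: le_trans Vs; rewrite lerDl divr_ge0 ?sqr_ge0// ltW.
  split; last by lra.
  have Q0 : 0 <= t ^+ 2 - expR (2 * s).
    by rewrite QE mulr_ge0 ?(ltW t60)// subr_ge0 expR_le1; lra.
  have k4 : k s ^+ 4 <= 104 ^+ 2.
    by rewrite (exprM (k s) 2 2) ler_sqr ?nnegrE ?sqr_ge0.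
  have k40 : 0 <= k s ^+ 4 by rewrite (exprM (k s) 2 2) sqr_ge0.
  have -> : (2000 * tau ^+ 2) ^+ 2 = 2000 ^+ 2 * tau ^+ 4 by rewrite (exprM tau 2 2) -exprMn.
  apply: (@le_trans _ _ (104 ^+ 2 * (2 * tau ^+ 4))); first exact: (ler_pM k40 Q0 k4 (Q1u _ s1s)).
  by rewrite mulrA ler_pM2r//; lra.
have Q1l (x : R) : x <= s1 -> tau ^+ 4 <= t ^+ 2 - expR (2 * x).
  move=> xs; rewrite QE -itauE [leLHS]mulrC ler_pM2l//.
  have : expR (2 * (x - s0)) <= expR (- (2 * tau ^- 2)).
    by rewrite ler_expR; rewrite /s1 in xs; lra.
  have := @expRN_le R (2 * tau ^- 2) ltac:(lra); lra.
pose r (x : R) : R := Num.sqrt (t ^+ 2 - expR (2 * x)).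
have Q0 (x : R) : x <= s1 -> 0 < t ^+ 2 - expR (2 * x) by move=> /Q1l; apply: lt_le_trans.
have rE (x : R) : x <= s1 -> r x ^+ 2 = t ^+ 2 - expR (2 * x).
  by move=> xs; rewrite sqr_sqrtr// ltW// Q0.
have r2 (x : R) : x <= s1 -> tau ^+ 2 <= r x.
  move=> xs; rewrite -ler_sqr ?nnegrE ?sqrtr_ge0 ?(ltW t20)// rE// -(exprM tau 2 2).
  exact: Q1l.
have r0 (x : R) : x <= s1 -> 0 < r x by move=> /r2; apply: lt_le_trans.
pose u2 (x : R) : R := expR (2 * x).
have dr (x : R) : x <= s1 -> is_derive x 1 r (- u2 x / r x).
  move=> xs; have ? := is_derive1_sqrt (Q0 _ xs).
  apply: is_derive_eq; rewrite /GRing.scale/= -/(r x) /u2.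
  by field; rewrite gt_eqF ?r0.
have du2 (x : R) : is_derive x 1 u2 (2 * u2 x).
  by apply: is_derive_eq; rewrite /GRing.scale/= /u2; ring.
pose G (x : R) : R := r x * k x ^+ 2 + dk x ^+ 2 / r x.
pose A (x : R) : R := u2 x / r x ^+ 3.
pose H (x : R) : R := G x - A x * (k x * dk x).
pose dA (x : R) : R := 2 * u2 x / r x ^+ 3 + 3 * u2 x ^+ 2 / r x ^+ 5.
have dA0 (x : R) : x <= s1 -> 0 <= dA x.
  move=> xs; have rx := ltW (r0 _ xs).
  have ux : 0 <= u2 x by exact: expR_ge0.
  by rewrite addr_ge0// divr_ge0 ?exprn_ge0// mulr_ge0 ?sqr_ge0.
(* Because [u2 <= tau^6 <= r^3] left of [s1]. *)
have A01 (x : R) : x <= s1 -> 0 <= A x <= 1.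
  move=> xs; have rx := r0 _ xs.
  rewrite /A divr_ge0 ?expR_ge0 ?exprn_ge0 ?(ltW rx)//= ler_pdivrMr ?exprn_gt0// mul1r.
  apply: (@le_trans _ _ (tau ^+ 6)); last first.
    rewrite (exprM tau 2 3) lerXn2r ?nnegrE ?(ltW rx) ?(ltW t20)//.
    exact: r2.
  by have := Q0 _ xs; rewrite /u2 t2E; lra.
have kdk (x : R) : x <= s1 -> 2 * `|k x * dk x| <= G x.
  move=> xs; have rx := r0 _ xs; rewrite /G.
  suff: 0 <= r x * k x ^+ 2 + dk x ^+ 2 / r x - 2 * (k x * dk x) /\
        0 <= r x * k x ^+ 2 + dk x ^+ 2 / r x + 2 * (k x * dk x).
    by case: (ger0P (k x * dk x)) => _ [? ?]; lra.
  have e1 : r x * k x ^+ 2 + dk x ^+ 2 / r x - 2 * (k x * dk x) =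
    (r x * k x - dk x) ^+ 2 / r x by field; rewrite gt_eqF.
  have e2 : r x * k x ^+ 2 + dk x ^+ 2 / r x + 2 * (k x * dk x) =
    (r x * k x + dk x) ^+ 2 / r x by field; rewrite gt_eqF.
  by rewrite e1 e2; split; rewrite divr_ge0 ?sqr_ge0 ?ltW.
have HG (x : R) : x <= s1 -> G x <= 2 * H x /\ 2 * H x <= 3 * G x.
  move=> xs; have := kdk _ xs; have /andP[a0 a1] := A01 _ xs; rewrite /H.
  have : `|A x * (k x * dk x)| <= `|k x * dk x| by rewrite normrM ger0_norm// ler_piMl.
  by rewrite ler_norml => /andP[? ?] ?; split; lra.
(* [156 = 3 / 2 * 104], the factor [3 / 2] bounding the [sqrt 2] in [r s1 <= sqrt 2 tau^2]. *)
have G1 : G s1 <= 156 * tau ^+ 2.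
  have s1s1 := lexx s1.
  have V1 : V s1 <= 104 by apply: V_le; rewrite lexx/= /s1; lra.
  have ru : r s1 <= 3 / 2 * tau ^+ 2.
    have c0 : 0 <= 3 / 2 * tau ^+ 2 by lra.
    rewrite -ler_sqr ?nnegrE ?sqrtr_ge0// rE//.
    by apply: (le_trans (Q1u _ s1s1)); rewrite exprMn -(exprM tau 2 2); lra.
  apply: (@le_trans _ _ (3 / 2 * tau ^+ 2 * V s1)); last by nra.
  rewrite /V mulrDr; apply: lerD; first by apply: ler_wpM2r => //; exact: sqr_ge0.
  apply: (@le_trans _ _ (dk s1 ^+ 2 / tau ^+ 2)).
    by apply: ler_wpM2l; [exact: sqr_ge0|rewrite lef_pV2 ?posrE ?r0 ?r2].
  have -> : 3 / 2 * tau ^+ 2 * (dk s1 ^+ 2 / tau ^+ 4) = 3 / 2 * (dk s1 ^+ 2 / tau ^+ 2).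
    by field; rewrite gt_eqF.
  have : 0 <= dk s1 ^+ 2 / tau ^+ 2 by rewrite divr_ge0 ?sqr_ge0 ?ltW.
  by lra.
(* [expR A] is the integrating factor for [H' >= - A' H]. *)
have : H s * expR (A s) <= H s1 * expR (A s1).
  apply: (@is_derive_nondecreasing _ (fun x => H x * expR (A x))
    (fun x => (- dA x * (k x * dk x) + dA x * H x) * expR (A x))); first exact: ltW.
    move=> x /andP[_ xs]; have rx := r0 _ xs; have rx0 : r x != 0 by rewrite gt_eqF.
    have ? := hk x; have ? := dr _ xs.
    have ? : is_derive x 1 dk (- r x ^+ 2 * k x).
      by have := hdk x; rewrite rE// opprB.
    have rx3 : r x ^+ 3 != 0 by rewrite expf_neq0.
    rewrite /H /A /G /dA.
    by apply: is_derive_eq; rewrite /GRing.scale/=; field.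
  move=> x /andP[_ xs]; apply: mulr_ge0 (expR_ge0 _).
  have [h2 _] := HG _ xs; have h3 := kdk _ xs; have h4 := ler_norm (k x * dk x).
  have h5 := dA0 _ xs; move: h2 h3 h4 h5; move: (G x) (H x) (dA x) (k x * dk x) => g h d p h2 h3 h4 h5.
  have -> : - d * p + d * h = d * (h - p) by ring.
  by rewrite mulr_ge0//; lra.
have ss1' := ltW ss1.
have [g1 _] := HG _ ss1'; have [_ g2] := HG _ (lexx s1).
have /andP[a0 _] := A01 _ ss1'; have /andP[_ a1] := A01 _ (lexx s1).
have e1 : 1 <= expR (A s) by have := expR_ge1Dx (A s); lra.
have e2 : expR (A s1) <= 4 by apply: le_trans (expR1_le4 R); rewrite ler_expR.
have e3 := expR_gt0 (A s1).
move=> hH.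
have Gs0 : 0 <= G s by apply: le_trans (kdk _ ss1'); rewrite mulr_ge0.
have H10 : 0 <= H s1.
  have [g3 _] := HG _ (lexx s1).
  have : 0 <= 2 * H s1 by apply: le_trans g3; apply: le_trans (kdk _ (lexx s1)); rewrite mulr_ge0.
  by rewrite pmulr_rge0.
have Gs : G s <= 2000 * tau ^+ 2 := energy_compare g1 Gs0 hH e1 e3 e2 g2 H10 G1.
have rk : r s * k s ^+ 2 <= 2000 * tau ^+ 2.
  apply: le_trans Gs; rewrite lerDl divr_ge0 ?sqr_ge0//; exact/ltW/r0.
split.
  rewrite -rE// (_ : k s ^+ 4 * _ = (r s * k s ^+ 2) ^+ 2); last by ring.
  have c1 : 0 <= r s * k s ^+ 2 by apply: mulr_ge0 (sqr_ge0 _); exact/ltW/r0.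
  move: rk; move: (2000 * tau ^+ 2) => M rk.
  by rewrite ler_sqr ?nnegrE ?(le_trans c1 rk).
have : tau ^+ 2 * k s ^+ 2 <= r s * k s ^+ 2.
  by apply: ler_wpM2r (r2 _ ss1'); exact: sqr_ge0.
move=> /le_trans /(_ rk); move: (2000 : R) => M.
by rewrite mulrC ler_pM2r.
Qed.

End NormalizedBessel.

(** * The divisor bound and Chebyshev's lower bound for primes *)

(** A divisor is determined by its [p]-adic valuation and its part prime to [p]. *)
Lemma size_divisors_part (p n : nat) : prime p -> (0 < n)%N ->
  (size (divisors n) <= (logn p n).+1 * size (divisors n`_(negn p)))%N.
Proof.
move=> pp n0.
pose s := [seq (p ^ i * d)%N | i <- iota 0 (logn p n).+1, d <- divisors n`_(negn p)].
suff : (size (divisors n) <= size s)%N by rewrite size_allpairs size_iota.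
apply: uniq_leq_size (divisors_uniq n) _ => d.
rewrite -dvdn_divisors// => dn; have d0 := dvdn_gt0 n0 dn.
apply/allpairsP; exists (logn p d, (d`_(negn p))%N); split.
- by rewrite mem_iota/= add0n ltnS dvdn_leq_log.
- by rewrite -dvdn_divisors ?part_gt0// partn_dvd.
- by rewrite -p_part partnC.
Qed.

Lemma prime_part_part (p q n : nat) : prime q -> (q %| n`_(negn p))%N -> q != p.
Proof.
move=> pq qn; have := part_pnat (negn p) n.
move=> /pnatP -/(_ (part_gt0 _ _)) /(_ q pq qn).
by rewrite !inE.
Qed.

(** A prime power [p^a] contributes the factor [a + 1]. If [p^e >= 2] this is at most [(p^e)^a];
    each of the finitely many smaller primes costs one factor [c]. *)
Lemma divisor_bound (R : realType) (e : R) : 0 < e ->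
  exists2 C : R, 1 <= C & forall n, (0 < n)%N ->
    (size (divisors n))%:R <= C * n%:R `^ e.
Proof.
move=> e0.
have ln20 : 0 < ln 2 :> R by rewrite ln_gt0// ltr1n.
(* Chosen so that [a + 1 <= c (1 + e a ln 2) <= c 2^(e a)]: one entry of the maximum serves the
   constant term, the other the linear one. *)
pose c : R := Num.max 1 (e * ln 2)^-1.
have c1 : 1 <= c by rewrite le_max lexx.
have c0 : 0 < c by apply: lt_le_trans c1.
have eln : 0 < e * ln 2 by rewrite mulr_gt0.
have ca a : a.+1%:R <= c * (2 `^ e) ^+ a.
  rewrite -powR_mulrn ?powR_ge0// -powRrM /powR pnatr_eq0/=.
  apply: (@le_trans _ _ (c * (1 + e * a%:R * ln 2))); last first.
    by rewrite ler_pM2l// expR_ge1Dx.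
  have : 1 <= c * (e * ln 2).
    have : (e * ln 2)^-1 <= c by rewrite le_max lexx orbT.
    by rewrite -ler_pdivrMr// div1r.
  have : 0 <= a%:R :> R by [].
  rewrite -natr1; nra.
have [B Bp] : exists B : nat, forall p : nat, (B <= p)%N -> 2 <= p%:R `^ e :> R.
  exists (Num.truncn (2 `^ e^-1 : R)).+1 => p Bp.
  have -> : 2 = (2 `^ e^-1) `^ e :> R by rewrite -powRrM mulVf ?gt_eqF// powRr1.
  rewrite ge0_ler_powR ?nnegrE ?powR_ge0 ?(ltW e0)//.
  apply: (@le_trans _ _ (Num.truncn (2 `^ e^-1 : R)).+1%:R); last by rewrite ler_nat.
  by apply/ltW; rewrite truncnS_gt.
exists (c ^+ B); first by rewrite exprn_ege1.
(* Strong induction removing the least prime factor: [x] bounds the remaining prime factors from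
   below, and [B - x] counts the factors [c] still to be spent. *)
suff main m x n : (n < m)%N -> (0 < n)%N -> (forall q, prime q -> (q %| n)%N -> (x <= q)%N) ->
    (size (divisors n))%:R <= c ^+ (B - x) * n%:R `^ e.
  by move=> n n0; have := main n.+1 0%N n (ltnSn n) n0; rewrite subn0; apply.
elim: m x n => // m IHm x n; rewrite ltnS => nm n0 nx.
have [n1|n1] := leqP n 1.
  have -> : n = 1%N by apply/eqP; rewrite eqn_leq n1.
  by rewrite /= powR1 mulr1 exprn_ege1.
pose p := pdiv n; have pp : prime p := pdiv_prime n1.
have pn : (p %| n)%N := pdiv_dvd n.
have xp : (x <= p)%N by exact: nx.
have p0 := prime_gt0 pp.
pose b := (n`_(negn p))%N; have b0 : (0 < b)%N by exact: part_gt0.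
have nE : (n = p ^ logn p n * b)%N by rewrite -p_part partnC.
have a0 : (0 < logn p n)%N by rewrite logn_gt0 mem_primes pp n0.
have bm : (b < m)%N.
  apply: leq_trans nm; rewrite [X in (_ < X)%N]nE ltn_Pmull//.
  by rewrite -(exp1n (logn p n)) ltn_exp2r// prime_gt1.
have hb : forall q, prime q -> (q %| b)%N -> (p.+1 <= q)%N.
  move=> q pq qb; rewrite ltn_neqAle eq_sym (prime_part_part pq qb)/=.
  by apply: pdiv_min_dvd; rewrite ?prime_gt1// (dvdn_trans qb) ?dvdn_part.
have IH := IHm _ _ bm b0 hb.
apply: (@le_trans _ _ ((logn p n).+1%:R * (size (divisors b))%:R)).
  by rewrite -natrM ler_nat size_divisors_part.
have -> : n%:R `^ e = (p%:R `^ e) ^+ (logn p n) * b%:R `^ e :> R.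
  rewrite {1}nE natrM powRM// natrX; congr (_ * _).
  by rewrite -[in LHS]powR_mulrn// -[in RHS]powR_mulrn ?powR_ge0// -!powRrM mulrC.
set a := logn p n in a0 *.
suff : a.+1%:R * c ^+ (B - p.+1) <= c ^+ (B - x) * (p%:R `^ e) ^+ a.
  move=> h; apply: (@le_trans _ _ (a.+1%:R * (c ^+ (B - p.+1) * b%:R `^ e))).
    by rewrite ler_wpM2l.
  by rewrite !mulrA ler_wpM2r ?powR_ge0.
have [Bp'|pB] := leqP B p.
  have -> : (B - p.+1 = 0)%N by apply/eqP; rewrite subn_eq0 leqW.
  rewrite expr0 mulr1; apply: (@le_trans _ _ (2 ^+ a)).
    by rewrite -natrX ler_nat ltn_expl.
  apply: (@le_trans _ _ ((p%:R `^ e) ^+ a)).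
    by rewrite lerXn2r ?nnegrE ?powR_ge0//; exact: Bp.
  by rewrite ler_peMl ?exprn_ge0 ?powR_ge0// exprn_ege1.
apply: (@le_trans _ _ (c * (2 `^ e) ^+ a * c ^+ (B - p.+1))).
  by rewrite ler_wpM2r ?exprn_ge0 ?(ltW c0).
have -> : c * (2 `^ e) ^+ a * c ^+ (B - p.+1) = c ^+ (B - p) * (2 `^ e) ^+ a.
  by rewrite -(subnSK pB) exprS [RHS]mulrAC.
apply: ler_pM; rewrite ?exprn_ge0 ?powR_ge0 ?(ltW c0)//.
  by rewrite ler_weXn2l// leq_sub2l.
rewrite lerXn2r ?nnegrE ?powR_ge0// ge0_ler_powR ?nnegrE ?(ltW e0)//.
by rewrite ler_nat prime_gt1.
Qed.

(** By Pascal's rule and symmetry the central coefficient at [n + 1] is twice ['C(2n + 1, n)], which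
    is at least the one at [n]. *)
Lemma expn2_le_central_bin n : (2 ^ n <= 'C(n.*2, n))%N.
Proof.
elim: n => [|n IH]; first by rewrite bin0.
rewrite doubleS binS expnS mul2n -addnn.
have -> : 'C(n.*2.+1, n.+1) = 'C(n.*2.+1, n).
  rewrite -(@bin_sub n.*2.+1 n); last by rewrite -addnn leqW// leq_addr.
  by congr 'C(_, _); rewrite subSn -addnn ?addnK ?leq_addr.
have h : (2 ^ n <= 'C(n.*2.+1, n))%N.
  apply: (leq_trans IH); case: n {IH} => // n.
  by rewrite binS leq_addr.
by rewrite leq_add.
Qed.

(** By Legendre's formula the valuation is a sum over [k] of [floor(2n / p^k) - 2 floor(n / p^k)],
    each term [0] or [1], and [0] once [p^k > 2n]. If [p^v] exceeded [2n], fewer than [v] terms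
    would survive. *)
Lemma central_bin_logn p n : prime p -> (0 < n)%N ->
  (p ^ logn p 'C(n.*2, n) <= n.*2)%N.
Proof.
move=> pp n0; set v := logn p _.
rewrite leqNgt; apply/negP => lt2n.
have p1 := prime_gt1 pp; have p0 := prime_gt0 pp.
have vE : (logn p (n.*2)`! = v + (logn p n`!).*2)%N.
  have := @bin_fact n.*2 n; rewrite -addnn leq_addr addnK => /(_ isT) <-.
  by rewrite !lognM ?muln_gt0 ?fact_gt0 ?bin_gt0 ?leq_addr// addnn addnn.
have e1 : logn p (n.*2)`! = (\sum_(1 <= k < n.*2.+1) n.*2 %/ p ^ k)%N by rewrite logn_fact.
have e2 : logn p n`! = (\sum_(1 <= k < n.*2.+1) n %/ p ^ k)%N.
  have z : (\sum_(n.+1 <= k < n.*2.+1) n %/ p ^ k = 0)%N.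
    rewrite big_nat_cond big1// => k; rewrite andbT => /andP[nk _].
    by rewrite divn_small// (ltn_trans nk)// ltn_expl.
  rewrite logn_fact// (@big_cat_nat _ _ _ n.+1 1 n.*2.+1)//=; last by rewrite ltnS -addnn leq_addr.
  by rewrite z addn0.
have v0 : (0 < v)%N.
  rewrite lt0n; apply: contraTN lt2n => /eqP ->.
  by rewrite expn0 -leqNgt double_gt0.
(* The sum on the right has only [v - 1] terms, so this bound is absurd. *)
have : (v <= \sum_(1 <= k < v) 1)%N; last first.
  by rewrite sum_nat_const_nat muln1 subn1 leqNgt prednK// leqnn.
have hv : (\sum_(1 <= k < n.*2.+1) n.*2 %/ p ^ k <=
   \sum_(1 <= k < n.*2.+1 | (k < v)%N) 1 + \sum_(1 <= k < n.*2.+1) (n %/ p ^ k).*2)%N.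
  rewrite [X in (_ <= X + _)%N]big_mkcond -big_split/=; apply: leq_sum => k _.
  case: ltnP => kv.
    rewrite -leq_subLR subn1.
    have pk0 : (0 < p ^ k)%N by rewrite expn_gt0 p0.
    have : (n.*2 %/ p ^ k < (n %/ p ^ k).+1.*2)%N.
      by rewrite ltn_divLR// -mul2n -mul2n -mulnA ltn_pmul2l// ltn_ceil.
    by rewrite doubleS; case: (_ %/ _)%N => //= x; rewrite ltnS.
  by rewrite divn_small// (leq_trans lt2n)// leq_exp2l.
move: hv; rewrite -e1 vE e2 -(big_morph _ doubleD double0) leq_add2r => /leq_trans; apply.
have [h|h] := leqP v n.*2.+1.
  by rewrite [leqRHS](@big_nat_widen _ _ _ 1 v n.*2.+1).
rewrite [leqRHS](@big_cat_nat _ _ _ n.*2.+1)//=; last exact: ltnW.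
apply: leq_trans (leq_addr _ _); rewrite big_mkcond/=; apply: leq_sum => k _.
by case: ifP.
Qed.

(** The central binomial coefficient is a product of prime powers, one for each of its primes, none
    of them above [2n]. *)
Lemma chebyshev_lower n : (0 < n)%N ->
  (2 ^ n <= n.*2 ^ size [seq p <- iota 0 n.*2.+1 | prime p])%N.
Proof.
move=> n0; apply: (leq_trans (expn2_le_central_bin n)).
set N := 'C(_, _).
have N0 : (0 < N)%N by rewrite bin_gt0 -addnn leq_addr.
have -> : N = (\prod_(p <- primes N) p ^ logn p N)%N.
  rewrite {1}[N]prod_prime_decomp// prime_decompE big_map/=.
  by apply: eq_bigr.
have sz : (size (primes N) <= size [seq p <- iota 0 n.*2.+1 | prime p])%N.
  apply: uniq_leq_size (primes_uniq _) _ => p.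
  rewrite mem_primes mem_filter => /and3P[pp _ pN]; rewrite pp mem_iota/= add0n ltnS.
  apply: leq_trans (central_bin_logn pp n0).
  rewrite -{1}(expn1 p) leq_exp2l ?prime_gt1//.
  by rewrite logn_gt0 mem_primes pp N0.
apply: (@leq_trans (n.*2 ^ size (primes N))); last first.
  by rewrite leq_pexp2l// double_gt0.
have -> : (n.*2 ^ size (primes N) = \prod_(p <- primes N) n.*2)%N.
  by rewrite big_const_seq count_predT iter_muln_1.
rewrite !big_seq; elim/big_ind2: _ => // [a b c d|p]; first exact: leq_mul.
by rewrite mem_primes => /and3P[pp _ _]; exact: central_bin_logn.
Qed.

(** * Hecke multiplicativity and sums of squares *)

Lemma ler_sum_uniq_sub (R : numDomainType) (T : eqType) (s s' : seq T) (F : T -> R) :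
  uniq s -> {subset s <= s'} -> (forall x, 0 <= F x) ->
  \sum_(x <- s) F x <= \sum_(x <- s') F x.
Proof.
elim: s s' => [|x s IH] s'; first by move=> _ _ F0; rewrite big_nil sumr_ge0.
move=> /= /andP[xs us] sub F0.
have xs' : x \in s' by apply: sub; rewrite inE eqxx.
rewrite big_cons (perm_big _ (perm_to_rem xs'))/= big_cons lerD2l.
apply: IH => // y ys.
have : y \in x :: rem x s' by rewrite -(perm_mem (perm_to_rem xs')) sub// inE ys orbT.
by rewrite inE => /predU1P[yx|//]; rewrite -yx ys in xs.
Qed.

Lemma sqr_sum_le (R : realFieldType) (T : Type) (s : seq T) (F : T -> R) :
  (\sum_(x <- s) F x) ^+ 2 <= (size s)%:R * \sum_(x <- s) F x ^+ 2.
Proof.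
elim: s => [|x s IH]; first by rewrite !big_nil expr0n mul0r.
rewrite !big_cons /= -natr1 mulrDl mul1r sqrrD.
set S := \sum_(j <- s) F j in IH *; set Q := \sum_(j <- s) F j ^+ 2 in IH *.
have : F x * S *+ 2 <= (size s)%:R * F x ^+ 2 + Q.
  case: s @S @Q IH => [|y s] S Q IH.
    by rewrite /S /Q !big_nil mulr0 mul0rn mul0r add0r.
  have n0 : 0 < (size (y :: s))%:R :> R by rewrite ltr0n.
  set n := (size (y :: s))%:R in IH n0 *.
  rewrite -(ler_pM2l n0); have := sqr_ge0 (n * F x - S); nra.
by lra.
Qed.

Section HeckeSums.
Context (R : realType) (lam : nat -> R).
Hypothesis hecke : forall m n, (0 < m)%N -> (0 < n)%N ->
  lam m * lam n = \sum_(d <- divisors (gcdn m n)) lam (m * n %/ d ^ 2)%N.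

Definition sum_sqr (f : nat -> R) (N : nat) : R := \sum_(n <- iota 1 N) f n ^+ 2.

Local Notation S := (sum_sqr lam).

Lemma sum_multiples_le (f : nat -> R) (d N : nat) : (forall n, 0 <= f n) -> (0 < d)%N ->
  \sum_(m <- iota 1 N | (d %| m)%N) f m <= \sum_(m <- iota 1 (N %/ d)) f (d * m)%N.
Proof.
move=> f0 d0; rewrite -big_filter -(big_map (muln d) predT f).
apply: ler_sum_uniq_sub => //; first by rewrite filter_uniq ?iota_uniq.
move=> m; rewrite mem_filter mem_iota add1n ltnS => /and3P[/dvdnP[k ->] km kN].
apply/mapP; exists k; last by rewrite mulnC.
rewrite mem_iota add1n ltnS leq_divRL// kN andbT.
by move: km; rewrite muln_gt0 => /andP[].
Qed.

(** An integer [k] arises as a product [m * n] in at most as many ways as it has divisors. *)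
Lemma sum_products_le (f : nat -> R) (M : nat) (T : R) : (forall n, 0 <= f n) ->
  (forall n, (0 < n <= M ^ 2)%N -> (size (divisors n))%:R <= T) ->
  \sum_(m <- iota 1 M) \sum_(n <- iota 1 M) f (m * n)%N <= T * \sum_(n <- iota 1 (M ^ 2)) f n.
Proof.
move=> f0 hT.
apply: (@le_trans _ _ (\sum_(m <- iota 1 M) \sum_(k <- iota 1 (M ^ 2) | (m %| k)%N) f k)).
  rewrite big_seq [leRHS]big_seq; apply: ler_sum => m.
  rewrite mem_iota add1n ltnS => /andP[m0 mM].
  rewrite -(big_map (muln m) predT f) -[leRHS]big_filter; apply: ler_sum_uniq_sub => //.
    rewrite map_inj_uniq ?iota_uniq// => x y /eqP.
    by rewrite eqn_mul2l => /orP[/eqP m00|/eqP//]; rewrite m00 in m0.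
  move=> _ /mapP[k + ->]; rewrite mem_iota add1n ltnS => /andP[k0 kM].
  by rewrite mem_filter dvdn_mulr// mem_iota muln_gt0 m0 k0 add1n ltnS -mulnn leq_mul.
under eq_bigr do rewrite big_mkcond/=.
rewrite exchange_big/= mulr_sumr big_seq [leRHS]big_seq; apply: ler_sum => k.
rewrite mem_iota add1n ltnS => /andP[k0 kM].
rewrite -big_mkcond/= big_const_seq iter_addr addr0 -mulr_natl ler_wpM2r//.
apply: le_trans (hT k _); last by rewrite k0 kM.
rewrite ler_nat -size_filter; apply: uniq_leq_size; first by rewrite filter_uniq ?iota_uniq.
by move=> m; rewrite mem_filter -dvdn_divisors// => /andP[].
Qed.

(** [S N ^+ 2] is a double sum of [(lam m * lam n)^2], which multiplicativity and Cauchy-Schwarz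
    over the common divisors expand into terms [lam (m n / d^2)^2], at the cost of one [T]. For
    fixed [d] the arguments run up to [(N / d)^2], each attained at most [T] times, so the bound at
    length [X^2] gives [T A (N / d)^2]; summing [1 / d^2] leaves the factor [2]. *)
Lemma hecke_sum_step (X : nat) (A T : R) : 0 <= A -> 0 <= T ->
  (forall n, (0 < n <= X ^ 2)%N -> (size (divisors n))%:R <= T) ->
  (forall N, (N <= X ^ 2)%N -> S N <= A * N%:R) ->
  forall N, (N <= X)%N -> S N ^+ 2 <= 2 * T ^+ 2 * A * N%:R ^+ 2.
Proof.
move=> A0 T0 hT hA N NX.
have -> : S N ^+ 2 = \sum_(m <- iota 1 N) \sum_(n <- iota 1 N) (lam m * lam n) ^+ 2.
  rewrite expr2 /sum_sqr mulr_suml; apply: eq_bigr => m _.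
  by rewrite mulr_sumr; apply: eq_bigr => n _; rewrite exprMn.
(* Divisibility is moved into the summand, so that [d] ranges over an interval independent of [m]
   and [n] and can be summed outermost. *)
pose g d m n := if (d %| m)%N && (d %| n)%N then lam ((m %/ d) * (n %/ d))%N ^+ 2 else 0.
apply: (@le_trans _ _ (\sum_(m <- iota 1 N) \sum_(n <- iota 1 N)
    (T * \sum_(d <- iota 1 N) g d m n))).
  rewrite big_seq [leRHS]big_seq; apply: ler_sum => m.
  rewrite mem_iota add1n ltnS => /andP[m0 mN].
  rewrite big_seq [leRHS]big_seq; apply: ler_sum => n.
  rewrite mem_iota add1n ltnS => /andP[n0 nN].
  have g0 : (0 < gcdn m n)%N by rewrite gcdn_gt0 m0.
  rewrite hecke//; apply: (le_trans (sqr_sum_le _ _)).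
  apply: ler_pM; rewrite ?ler0n//; first by apply: sumr_ge0 => d _; exact: sqr_ge0.
    apply: hT; rewrite g0/=; apply: (@leq_trans m); first by rewrite dvdn_leq// dvdn_gcdl.
    by apply: (leq_trans mN); apply: (leq_trans NX); rewrite -mulnn; case: (X) => // x; rewrite leq_pmulr.
  rewrite /g -big_mkcond/= -[leRHS]big_filter.
  have -> : \sum_(d <- divisors (gcdn m n)) lam (m * n %/ d ^ 2)%N ^+ 2 =
      \sum_(d <- divisors (gcdn m n)) lam ((m %/ d) * (n %/ d))%N ^+ 2.
    apply: eq_big_seq => d; rewrite -dvdn_divisors// dvdn_gcd => /andP[dm dn].
    have d0 := dvdn_gt0 m0 dm.
    congr (lam _ ^+ 2); rewrite -{1}(divnK dm) -{1}(divnK dn) mulnACA mulnn mulnK ?expn_gt0 ?d0//.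
  apply: (@ler_sum_uniq_sub _ _ _ _ (fun d => lam ((m %/ d) * (n %/ d))%N ^+ 2)); [exact: divisors_uniq| |by move=> d; exact: sqr_ge0].
  move=> d; rewrite -dvdn_divisors// dvdn_gcd mem_filter mem_iota => dmn.
  have /andP[dm _] := dmn.
  by rewrite dmn add1n ltnS (dvdn_gt0 m0 dm)/= (leq_trans (dvdn_leq m0 dm)).
have -> : \sum_(m <- iota 1 N) \sum_(n <- iota 1 N) (T * \sum_(d <- iota 1 N) g d m n) =
  T * \sum_(d <- iota 1 N) \sum_(m <- iota 1 N) \sum_(n <- iota 1 N) g d m n.
  rewrite [X in T * X]exchange_big/= mulr_sumr; apply: eq_bigr => m _.
  by rewrite [X in T * X]exchange_big/= mulr_sumr.
have step d : (0 < d <= N)%N -> \sum_(m <- iota 1 N) \sum_(n <- iota 1 N) g d m n <=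
    T * (A * N%:R ^+ 2 * d%:R ^- 2).
  move=> /andP[d0 dN].
  have dR : 0 < d%:R :> R by rewrite ltr0n.
  apply: (@le_trans _ _ (\sum_(m <- iota 1 (N %/ d)) \sum_(n <- iota 1 (N %/ d)) lam (m * n)%N ^+ 2)).
    apply: (@le_trans _ _ (\sum_(m <- iota 1 N | (d %| m)%N)
       \sum_(n <- iota 1 (N %/ d)) lam ((m %/ d) * n)%N ^+ 2)).
      rewrite [leRHS]big_mkcond/=; apply: ler_sum => m _; rewrite /g.
      case: (d %| m)%N => /=; last by rewrite big1.
      rewrite -big_mkcond/=.
      apply: (le_trans (sum_multiples_le _ (f := fun n => lam ((m %/ d) * (n %/ d))%N ^+ 2) _ d0)).
        by move=> n; exact: sqr_ge0.
      by apply: ler_sum => n _; rewrite mulKn.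
    apply: (le_trans (sum_multiples_le _
      (f := fun m => \sum_(n <- iota 1 (N %/ d)) lam ((m %/ d) * n)%N ^+ 2) _ d0)).
      by move=> n; apply: sumr_ge0 => *; exact: sqr_ge0.
    by apply: ler_sum => m _; rewrite mulKn.
  have NdX : ((N %/ d) ^ 2 <= X ^ 2)%N.
    by rewrite leq_exp2r// (leq_trans (leq_div _ _)).
  apply: (le_trans (@sum_products_le (fun n => lam n ^+ 2) (N %/ d) T _ _)).
  - by move=> n; exact: sqr_ge0.
  - by move=> n /andP[n0 nN]; apply: hT; rewrite n0 (leq_trans nN).
  - rewrite ler_wpM2l//; apply: (le_trans (hA _ NdX)).
    rewrite -mulrA ler_wpM2l// natrX -exprVn -exprMn lerXn2r ?nnegrE ?divr_ge0//.
    by rewrite ler_pdivlMr// -natrM ler_nat leq_trunc_div.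
apply: (@le_trans _ _ (T * \sum_(d <- iota 1 N) T * (A * N%:R ^+ 2 * d%:R ^- 2))).
  rewrite ler_wpM2l// big_seq [leRHS]big_seq; apply: ler_sum => d.
  by rewrite mem_iota add1n ltnS; exact: step.
(* The telescoping term [- 1 / (M + 1)] is what lets the induction close. *)
have zeta2 M : \sum_(d <- iota 1 M.+1) d%:R ^- 2 <= 2 - (M.+1)%:R^-1 :> R.
  elim: M => [|M IH]; first by rewrite big_seq1 invr1 expr1n invr1; lra.
  rewrite -[M.+2]addn1 iotaD big_cat/= big_seq1 add1n.
  apply: (le_trans (lerD IH (lexx _))).
  have m0 : 0 < (M.+1)%:R :> R by rewrite ltr0n.
  rewrite natrD -[M.+2]addn1 natrD; move: m0; move: (M.+1)%:R => x m0.
  rewrite -subr_ge0 (_ : _ - _ = (x * (x + 1) ^+ 2)^-1); last first.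
    by field; rewrite !gt_eqF// ?addr_gt0.
  by rewrite invr_ge0 mulr_ge0 ?sqr_ge0// ltW.
rewrite -mulr_sumr -mulr_sumr.
have : \sum_(d <- iota 1 N) d%:R ^- 2 <= 2 :> R.
  case: (N) => [|M]; first by rewrite big_nil.
  by apply: (le_trans (zeta2 M)); rewrite gerBl invr_ge0.
move=> z2; rewrite (_ : 2 * T ^+ 2 * A * N%:R ^+ 2 = T * (T * (A * N%:R ^+ 2 * 2))); last by ring.
by rewrite ler_wpM2l// ler_wpM2l// ler_wpM2l// mulr_ge0 ?sqr_ge0.
Qed.

Lemma sum_sqr_ge0 (N : nat) : 0 <= S N.
Proof. by apply: sumr_ge0 => n _; exact: sqr_ge0. Qed.

(* Each doubling of the exponent of [X] replaces the excess factor [b ^+ 2 ^ j]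
   by its square root, while the divisor function only costs [T]. *)
Lemma hecke_sum_iter (X K : nat) (b T : R) : 0 <= b -> 0 <= T -> (0 < X)%N ->
  (forall n, (0 < n <= X ^ (2 ^ K))%N -> (size (divisors n))%:R <= T) ->
  (forall N, (N <= X ^ (2 ^ K))%N -> S N <= 2 * T ^+ 2 * b ^+ (2 ^ K) * N%:R) ->
  forall N, (N <= X)%N -> S N <= 2 * T ^+ 2 * b * N%:R.
Proof.
move=> b0 T0 X0; elim: K => [|K IH] hT hS; first by move=> N NX; exact: hS.
have XE : (X ^ 2 ^ K.+1 = (X ^ (2 ^ K)) ^ 2)%N by rewrite -expnM expnS mulnC.
apply: IH => [n /andP[n0 nX]|N NX].
  by apply: hT; rewrite n0 (leq_trans nX)// leq_pexp2l// leq_exp2l.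
rewrite -ler_sqr ?nnegrE ?sum_sqr_ge0//; last by rewrite !mulr_ge0 ?sqr_ge0 ?exprn_ge0.
have c0 : 0 <= 2 * T ^+ 2 * b ^+ (2 ^ K.+1) by rewrite !mulr_ge0 ?sqr_ge0 ?exprn_ge0.
rewrite XE in hT hS.
apply: (le_trans (hecke_sum_step c0 T0 hT hS NX)).
by rewrite expnS mulnC exprM le_eqVlt; apply/orP; left; apply/eqP; ring.
Qed.

End HeckeSums.

(** * Integrals of continuous functions over the unit interval *)

Section UnitIntegral.
Context (R : realType).
Local Notation mu := (@lebesgue_measure R).
Implicit Types f g : R -> R.

Definition unit_integral (g : R -> R) : R := \int[mu]_(x in `[0, 1]) g x.
Local Notation I := unit_integral.

Lemma integrable_unit g : continuous g -> mu.-integrable `[0, 1] (EFin \o g).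
Proof.
move=> cg; apply: continuous_compact_integrable; first exact: segment_compact.
exact: continuous_subspaceT.
Qed.

Lemma unit_integralD f g : continuous f -> continuous g ->
  I (fun x => f x + g x) = I f + I g.
Proof. by move=> cf cg; rewrite /I RintegralD//; exact: integrable_unit. Qed.

Lemma unit_integralB f g : continuous f -> continuous g ->
  I (fun x => f x - g x) = I f - I g.
Proof. by move=> cf cg; rewrite /I RintegralB//; exact: integrable_unit. Qed.

Lemma unit_integralZ (a : R) g : continuous g -> I (fun x => a * g x) = a * I g.
Proof. by move=> cg; rewrite /I RintegralZl//; exact: integrable_unit. Qed.

Lemma unit_integral_le f g : continuous f -> continuous g ->
  (forall x, 0 <= x <= 1 -> f x <= g x) -> I f <= I g.
Proof.
move=> cf cg fg; apply: le_Rintegral => //; try exact: integrable_unit.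
Qed.

Lemma unit_integral_cst (a : R) : I (fun=> a) = a.
Proof.
have m1 : mu `[0, 1]%classic = 1%E.
  by rewrite lebesgue_measure_itv/= lte_fin ltr01 oppr0 adde0.
transitivity (a * fine (mu `[0, 1]%classic)); last by rewrite m1 mulr1.
by rewrite /I -Rintegral_cst.
Qed.

Lemma unit_integral_FTC f g : continuous g ->
  (forall x : R, is_derive x 1 f (g x)) -> I g = f 1 - f 0.
Proof.
move=> cg fg; rewrite /I /Rintegral (@continuous_FTC2 _ g f)//.
- exact: continuous_subspaceT.
- have cf : continuous f by move=> x; apply/differentiable_continuous/derivable1_diffP; case: (fg x).
  split; first by move=> x _; case: (fg x).
  + by apply: cvg_at_right_filter; exact: cf.
  + by apply: cvg_at_left_filter; exact: cf.
- by move=> x _; rewrite derive1E; apply: derive_val.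
Qed.

Lemma unit_integral_norm_le g (M : R) : continuous g ->
  (forall x, 0 <= x <= 1 -> `|g x| <= M) -> `|I g| <= M.
Proof.
move=> cg gM; rewrite ler_norml -{1}(unit_integral_cst (- M)) -{2}(unit_integral_cst M).
have cM a : continuous (fun _ : R => a : R) by move=> x; exact: cvg_cst.
by apply/andP; split; apply: unit_integral_le => // x /gM; rewrite ler_norml => /andP[].
Qed.

Lemma unit_integral_sum (T : Type) (s : seq T) (f : T -> R -> R) :
  (forall i, continuous (f i)) ->
  continuous (fun x => \sum_(i <- s) f i x) /\
  I (fun x => \sum_(i <- s) f i x) = \sum_(i <- s) I (f i).
Proof.
move=> cf; elim: s => [|a s [IH1 IH2]].
  have -> : (fun x => \sum_(i <- [::]) f i x) = (fun=> 0) by apply/funext => x; rewrite big_nil.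
  by rewrite unit_integral_cst big_nil; split => // x; exact: cvg_cst.
have -> : (fun x => \sum_(i <- a :: s) f i x) = (fun x => f a x + \sum_(i <- s) f i x).
  by apply/funext => x; rewrite big_cons.
by rewrite unit_integralD// IH2 big_cons; split => // x; apply: cvgD; [exact: cf|exact: IH1].
Qed.

Lemma unit_integral_gt0 g (x0 : R) : continuous g -> (forall x, 0 <= g x) ->
  0 <= x0 <= 1 -> 0 < g x0 -> 0 < I g.
Proof.
move=> cg g0 x01 gx0.
have : \forall x \near x0, g x0 / 2 < g x.
  have := cg x0; move/cvgrPdist_lt => /(_ (g x0 / 2) ltac:(lra)).
  apply: filterS => x; rewrite ltr_norml => /andP[]; lra.
move=> /nbhs_ballP[d /= d0 hd].
pose a := Num.max 0 (x0 - d / 2); pose b := Num.min 1 (x0 + d / 2).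
have ab : a < b.
  by rewrite gt_max !lt_min ltr01 /=; apply/andP; split; [|apply/andP; split]; lra.
have gab x : x \in `[a, b] -> g x0 / 2 <= g x.
  rewrite in_itv/= /a /b le_min ge_max => /andP[/andP[_ h1] /andP[_ h2]].
  by apply/ltW/hd; rewrite /= /ball/= ltr_norml; apply/andP; split; lra.
apply: (@lt_le_trans _ _ (g x0 / 2 * (b - a))); first by rewrite mulr_gt0 ?subr_gt0 ?divr_gt0.
have mab : mu `[a, b]%classic = (b - a)%:E.
  by rewrite lebesgue_measure_itv/= lte_fin ab EFinB.
rewrite /I /Rintegral -lee_fin fineK; last by have := integrable_fin_num _ (integrable_unit cg); apply.
apply: (@le_trans _ _ (\int[mu]_(x in `[a, b]) (g x)%:E)%E).
  rewrite EFinM -mab -integral_cst//; apply: ge0_le_integral => //.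
  - by move=> x _; rewrite lee_fin divr_ge0// ltW.
  - apply/measurable_EFinP; apply: measurable_funTS; exact: continuous_measurable_fun.
apply: ge0_subset_integral => //.
- apply/measurable_EFinP; apply: measurable_funTS; exact: continuous_measurable_fun.
- by move=> x _; rewrite lee_fin.
- move=> x /=; rewrite !in_itv/= /a /b le_min ge_max => /andP[/andP[-> _] /andP[-> _]] //.
Qed.


Implicit Type h : R -> R.

Lemma continuous_mul g h : continuous g -> continuous h -> continuous (fun x => g x * h x).
Proof. by move=> cg ch x; apply: cvgM; [exact: cg|exact: ch]. Qed.

Lemma continuous_sub g h : continuous g -> continuous h -> continuous (fun x => g x - h x).
Proof. by move=> cg ch x; apply: cvgB; [exact: cg|exact: ch]. Qed.

Lemma continuous_const (a : R) : continuous (fun _ : R => a).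
Proof. by move=> x; exact: cvg_cst. Qed.

End UnitIntegral.

(** * Cosine series on the circle: orthogonality, Bessel's inequality, uniqueness *)

Section CosineSeries.
Context (R : realType).
Local Notation I := (@unit_integral R).
Implicit Types g h : R -> R.

Definition cosn (n : nat) (x : R) : R := cos (2 * pi * n%:R * x).

Lemma continuous_cosn n : continuous (cosn n).
Proof.
move=> x; apply: continuous_comp; last exact: continuous_cos.
by apply: cvgM; [exact: cvg_cst|exact: cvg_id].
Qed.

Lemma cosn0 x : cosn 0 x = 1.
Proof. by rewrite /cosn mulr0 mul0r cos0. Qed.

Lemma normr_cosn_le1 n x : `|cosn n x| <= 1.
Proof. exact: cos_max. Qed.

Lemma cosn_mul (m n : nat) (x : R) : (n <= m)%N ->
  cosn m x * cosn n x = 2^-1 * cosn (m - n) x + 2^-1 * cosn (m + n) x.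
Proof.
move=> nm; rewrite /cosn natrB// natrD.
have -> : 2 * pi * (m%:R - n%:R) * x = 2 * pi * m%:R * x - 2 * pi * n%:R * x by ring.
have -> : 2 * pi * (m%:R + n%:R) * x = 2 * pi * m%:R * x + 2 * pi * n%:R * x by ring.
by rewrite cosB cosD; field.
Qed.

Lemma sin_2pin (n : nat) : sin (2 * pi * n%:R) = 0 :> R.
Proof.
elim: n => [|n IH]; first by rewrite mulr0 sin0.
rewrite -[n.+1]addn1 natrD mulrDr mulr1 [X in _ + X]mulr_natl.
by rewrite sinD2pi.
Qed.

Lemma cos_2pin (n : nat) : cos (2 * pi * n%:R) = 1 :> R.
Proof.
elim: n => [|n IH]; first by rewrite mulr0 cos0.
rewrite -[n.+1]addn1 natrD mulrDr mulr1 [X in _ + X]mulr_natl.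
by rewrite cosD2pi.
Qed.

Lemma cosnD1 n x : cosn n (x + 1) = cosn n x.
Proof. by rewrite /cosn mulrDr mulr1 cosD cos_2pin sin_2pin mulr1 mulr0 subr0. Qed.

Lemma cosnN n x : cosn n (- x) = cosn n x.
Proof. by rewrite /cosn mulrN cosN. Qed.

Lemma cosn_sym n x : cosn n (1 - x) = cosn n x.
Proof. by rewrite -cosnN opprB -cosnD1 subrK. Qed.

Lemma unit_integral_cosn n : (0 < n)%N -> I (cosn n) = 0.
Proof.
move=> n0; have n0' : 2 * pi * n%:R != 0 :> R.
  by rewrite !mulf_neq0// ?gt_eqF ?pi_gt0// ltr0n.
pose F (x : R) : R := (2 * pi * n%:R)^-1 * sin (2 * pi * n%:R * x).
have dF (x : R) : is_derive x 1 F (cosn n x).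
  rewrite /F /cosn; move: (2 * pi * n%:R) n0' => a a0.
  by apply: is_derive_eq; rewrite /GRing.scale/=; field.
rewrite (unit_integral_FTC (@continuous_cosn n) dF) /F.
by rewrite mulr1 mulr0 sin0 sin_2pin mulr0 subrr.
Qed.

Lemma cosn_orthogonal (m n : nat) : (0 < m)%N -> (0 < n)%N ->
  I (fun x => cosn m x * cosn n x) = if m == n then 2^-1 else 0.
Proof.
wlog nm : m n / (n <= m)%N.
  move=> h m0 n0; have [nm|/ltnW mn] := leqP n m; first exact: h.
  rewrite eq_sym -h//; congr I; apply/funext => x; exact: mulrC.
move=> m0 n0; under eq_fun do rewrite cosn_mul//.
rewrite unit_integralD; try exact: (continuous_mul (@continuous_const R _) (@continuous_cosn _)).
rewrite !unit_integralZ; try exact: continuous_cosn.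
rewrite (@unit_integral_cosn (m + n)) ?addn_gt0 ?m0// mulr0 addr0.
case: eqP => [->|/eqP mn].
  rewrite subnn (_ : cosn 0 = fun=> 1) ?unit_integral_cst ?mulr1//.
  by apply/funext => x; exact: cosn0.
by rewrite unit_integral_cosn ?mulr0// subn_gt0 ltn_neqAle nm eq_sym mn.
Qed.

Definition cos_coef g (n : nat) : R := I (fun x => g x * cosn n x).

(** There is no constant term, since it vanishes for a cusp form; the factor [2] inverts the squared
    norm [1 / 2] of [cosn n]. *)
Definition cos_sum (c : nat -> R) (N : nat) (x : R) : R :=
  \sum_(n <- iota 1 N) 2 * c n * cosn n x.

Lemma continuous_cos_sum c N : continuous (cos_sum c N).
Proof.
have := @unit_integral_sum R nat (iota 1 N) (fun n x => 2 * c n * cosn n x) _.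
case=> // n; exact: (continuous_mul (@continuous_const R _) (@continuous_cosn _)).
Qed.

Lemma cos_coefB g h n : continuous g -> continuous h ->
  cos_coef (fun x => g x - h x) n = cos_coef g n - cos_coef h n.
Proof.
move=> cg ch; rewrite /cos_coef; under eq_fun do rewrite mulrBl.
by rewrite unit_integralB//; apply: continuous_mul => //; exact: continuous_cosn.
Qed.

Lemma cos_coef_norm_le g n (M : R) : continuous g ->
  (forall x, 0 <= x <= 1 -> `|g x| <= M) -> `|cos_coef g n| <= M.
Proof.
move=> cg gM; apply: unit_integral_norm_le.
  by apply: continuous_mul => //; exact: continuous_cosn.
move=> x x01; rewrite normrM -[M]mulr1 ler_pM// ?gM//; exact: normr_cosn_le1.
Qed.

Lemma cos_coef_cos_sum c N m : (0 < m <= N)%N -> cos_coef (cos_sum c N) m = c m.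
Proof.
move=> /andP[m0 mN]; rewrite /cos_coef /cos_sum.
under eq_fun do rewrite mulr_suml.
have cc n : continuous (fun x => 2 * c n * cosn n x * cosn m x).
  apply: continuous_mul; last exact: continuous_cosn.
  exact: (continuous_mul (@continuous_const R _) (@continuous_cosn _)).
have [_ ->] := unit_integral_sum (iota 1 N) cc.
rewrite (eq_big_seq (fun n => if n == m then c m else 0)).
  rewrite -big_mkcond/= (big_rem m)/=; last by rewrite mem_iota m0 add1n ltnS.
  rewrite eqxx big1_seq ?addr0// => n /andP[/eqP ->].
  by rewrite mem_rem_uniq ?iota_uniq// inE eqxx.
move=> n; rewrite mem_iota => /andP[n0 _].
under eq_fun do rewrite -mulrA.
rewrite unit_integralZ; last by apply: continuous_mul; exact: continuous_cosn.
by rewrite cosn_orthogonal//; case: eqP => [->|_]; [field|rewrite mulr0].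
Qed.

Lemma cos_coef0_cos_sum c N : I (cos_sum c N) = 0.
Proof.
have cc n : continuous (fun x => 2 * c n * cosn n x).
  exact: (continuous_mul (@continuous_const R _) (@continuous_cosn _)).
have [_ ->] := unit_integral_sum (iota 1 N) cc.
rewrite big1_seq// => n; rewrite mem_iota => /andP[_ /andP[n0 _]].
by rewrite unit_integralZ ?unit_integral_cosn ?mulr0//; exact: continuous_cosn.
Qed.

(** Expand [0 <= I ((g - s)^2)] with [s] the partial sum: [I (g s) = I (s s)] is twice the sum of
    squares. *)
Lemma bessel_inequality g N (M : R) : continuous g ->
  (forall x, 0 <= x <= 1 -> `|g x| <= M) ->
  \sum_(n <- iota 1 N) cos_coef g n ^+ 2 <= M ^+ 2 / 2.
Proof.
move=> cg gM; pose c := cos_coef g; pose s := cos_sum c N.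
have cs : continuous s by exact: continuous_cos_sum.
have pairing h : continuous h ->
    I (fun x => h x * s x) = \sum_(n <- iota 1 N) 2 * c n * cos_coef h n.
  move=> ch; rewrite /s /cos_sum; under eq_fun do rewrite mulr_sumr.
  have cc n : continuous (fun x => h x * (2 * c n * cosn n x)).
    apply: continuous_mul => //.
    exact: (continuous_mul (@continuous_const R _) (@continuous_cosn _)).
  have [_ ->] := unit_integral_sum (iota 1 N) cc; apply: eq_bigr => n _.
  under eq_fun do rewrite mulrCA.
  by rewrite unit_integralZ//; apply: continuous_mul => //; exact: continuous_cosn.
have e1 := pairing _ cg.
have e2 : I (fun x => s x * s x) = \sum_(n <- iota 1 N) 2 * c n * c n.
  rewrite pairing//; apply: eq_big_seq => n; rewrite mem_iota add1n ltnS => nN.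
  by rewrite cos_coef_cos_sum.
have : 0 <= I (fun x => (g x * g x - 2 * (g x * s x)) + s x * s x).
  rewrite -{1}(unit_integral_cst (0 : R)); apply: unit_integral_le.
  - exact: continuous_const.
  - move=> x; apply: cvgD; last exact: (continuous_mul cs cs).
    apply: cvgB; first exact: (continuous_mul cg cg).
    exact: (continuous_mul (@continuous_const R _) (continuous_mul cg cs)).
  - by move=> x _; have := sqr_ge0 (g x - s x); nra.
rewrite unit_integralD; last 2 first.
  - apply: continuous_sub; first exact: continuous_mul.
    exact: (continuous_mul (@continuous_const R _) (continuous_mul cg cs)).
  - exact: continuous_mul.
rewrite unit_integralB; last 2 first.
  - exact: continuous_mul.
  - exact: (continuous_mul (@continuous_const R _) (continuous_mul cg cs)).
rewrite unit_integralZ; last exact: continuous_mul.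
rewrite e1 e2.
have -> : \sum_(n <- iota 1 N) 2 * c n * c n = 2 * \sum_(n <- iota 1 N) c n ^+ 2.
  by rewrite mulr_sumr; apply: eq_bigr => n _; ring.
have : I (fun x => g x * g x) <= M ^+ 2.
  rewrite -[leRHS]unit_integral_cst; apply: unit_integral_le.
  - exact: continuous_mul.
  - exact: continuous_const.
  - move=> x x01; rewrite -expr2 -[leLHS]real_normK ?num_real//.
    by rewrite lerXn2r ?nnegrE ?gM// (le_trans _ (gM _ x01)).
rewrite /c; lra.
Qed.

Lemma cos_2pi_eq (x y : R) : 0 <= x <= 1 -> 0 <= y <= 1 ->
  cosn 1 x = cosn 1 y -> x = y \/ x = 1 - y.
Proof.
have half (z : R) : 0 <= z <= 1 -> exists2 w, 0 <= w <= 2^-1 & cosn 1 z = cosn 1 w /\ (z = w \/ z = 1 - w).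
  move=> /andP[z0 z1]; have [zh|zh] := leP z 2^-1; first by exists z; [rewrite z0|split => //; left].
  exists (1 - z); first by apply/andP; split; lra.
  split; last by right; lra.
  by rewrite cosn_sym.
have p0 : 0 < pi :> R := pi_gt0 R.
move=> /half[x' x'h [-> xx']] /half[y' y'h [-> yy']]; rewrite /cosn mulr1 => e.
have : 2 * pi * x' = 2 * pi * y'.
  by apply: cos_inj => //; rewrite in_itv/=; apply/andP; split; nra.
move=> /mulfI -/(_ _)/[dup] h; have x'y' : x' = y'.
  by apply: h; rewrite mulf_neq0// gt_eqF.
by case: xx' yy' => -> [] ->; rewrite x'y'; [left|right|right|left]; lra.
Qed.

(** Product-to-sum formula. Iterated, it shows that multiplying [g] by any polynomial in [cosn 1]
    keeps all coefficients zero. *)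
Lemma cos_coef_mul_cos1 g : continuous g -> (forall n, cos_coef g n = 0) ->
  forall n, cos_coef (fun x => g x * cosn 1 x) n = 0.
Proof.
move=> cg g0 [|n]; rewrite /cos_coef.
  have := g0 1%N; rewrite /cos_coef => <-; congr I; apply/funext => x.
  by rewrite cosn0 mulr1.
have -> : (fun x => g x * cosn 1 x * cosn n.+1 x) =
   (fun x => 2^-1 * (g x * cosn n x) + 2^-1 * (g x * cosn n.+2 x)).
  apply/funext => x; rewrite -mulrA (mulrC (cosn 1 x)) cosn_mul// subn1/= addn1.
  by ring.
have cc m : continuous (fun x => g x * cosn m x).
  by apply: continuous_mul => //; exact: continuous_cosn.
rewrite unit_integralD; try exact: (continuous_mul (@continuous_const R _) (cc _)).
rewrite !unit_integralZ//; have := g0 n; have := g0 n.+2; rewrite /cos_coef => -> ->.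
by rewrite mulr0 addr0.
Qed.

Lemma continuous_max0 h : continuous h -> continuous (fun x => Num.max (h x) 0).
Proof.
move=> ch; have -> : (fun x => Num.max (h x) 0) = (fun x => (h x + `|h x|) * 2^-1).
  apply/funext => x; have [hx|hx] := leP (h x) 0.
    by rewrite ler0_norm// subrr mul0r.
  by rewrite gtr0_norm//; field.
move=> x; apply: cvgM; last exact: cvg_cst.
by apply: cvgD; [exact: ch|apply: cvg_norm; exact: ch].
Qed.

(** Were [g x0 > 0], powers of a polynomial [w] in [cosn 1] peaking at [x0] and [1 - x0] would make
    [I (g w^k)] positive for large [k], although it vanishes for every [k]. The symmetry of [g]
    makes both peaks contribute with the same sign. *)
Lemma cos_coef_uniq g : continuous g -> (forall x, g (1 - x) = g x) ->
  (forall n, cos_coef g n = 0) -> forall x, 0 <= x <= 1 -> g x = 0.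
Proof.
wlog suff : g / forall x, continuous g -> (forall x, g (1 - x) = g x) ->
  (forall n, cos_coef g n = 0) -> 0 <= x <= 1 -> g x <= 0.
  move=> h cg gs g0 x x01; apply/eqP; rewrite eq_le h//= -oppr_le0.
  apply: (h (fun x => - g x)) => //.
  - by move=> y; apply: cvgN; exact: cg.
  - by move=> y; rewrite gs.
  - move=> n; rewrite /cos_coef; under eq_fun do rewrite -mulN1r -mulrA.
    have := g0 n; rewrite /cos_coef unit_integralZ => [->|]; first by rewrite mulr0.
    by apply: continuous_mul => //; exact: continuous_cosn.
move=> x0 cg gs g0 x01; rewrite leNgt; apply/negP => gx0.
pose c0 := cosn 1 x0; pose e := g x0 / 2.
have e0 : 0 < e by rewrite divr_gt0.
have cc : continuous (cosn 1) by exact: continuous_cosn.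
have cnorm : continuous (fun x => `|cosn 1 x - c0|).
  move=> x; apply: cvg_norm; exact: (continuous_sub cc (@continuous_const R _)).
have cmax : continuous (fun x => Num.max (g x - e) 0).
  exact: (continuous_max0 (continuous_sub cg (@continuous_const R e))).
(* By compactness: on [[0, 1]] the cosine takes the value [c0] only at [x0] and [1 - x0], and there
   [g] exceeds [e]. *)
have [eta eta0 heta] : exists2 eta : R, 0 < eta & forall x, 0 <= x <= 1 ->
    g x <= e -> eta <= `|cosn 1 x - c0|.
  pose h x := Num.max (g x - e) 0 + `|cosn 1 x - c0|.
  have ch : continuous h by move=> x; apply: cvgD; [exact: cmax|exact: cnorm].
  have [z z01 hz] := @EVT_min R h 0 1 ler01 (continuous_subspaceT ch).
  exists (h z); last first.
    move=> x xx gx; have /hz : x \in `[0, 1] by rewrite in_itv.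
    by rewrite {2}/h (_ : Num.max _ _ = 0) ?add0r//; apply/max_idPr; rewrite subr_le0.
  rewrite /h ltNge; apply/negP => hle.
  have n0 := normr_ge0 (cosn 1 z - c0).
  have m0 : 0 <= Num.max (g z - e) 0 by rewrite le_max lexx orbT.
  have : `|cosn 1 z - c0| = 0 by lra.
  have gz : Num.max (g z - e) 0 = 0 by lra.
  move=> /eqP; rewrite normr_eq0 subr_eq0 => /eqP czc0.
  rewrite in_itv/= in z01.
  have gzx : g z = g x0.
    by have [->//|->] := cos_2pi_eq z01 x01 czc0; rewrite gs.
  have : g z - e <= 0 by rewrite -gz le_max lexx.
  by rewrite gzx /e; lra.
(* On [[0, 1]], [w] is [1] at [x0] and at most [rho < 1] wherever [g <= e]. *)
pose w x := 1 - (cosn 1 x - c0) ^+ 2 / 4.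
have cw : continuous w.
  apply: continuous_sub; first exact: continuous_const.
  apply: continuous_mul; last exact: continuous_const.
  have h := continuous_sub cc (@continuous_const R c0).
  exact: (continuous_mul h h).
have w01 x : 0 <= w x <= 1.
  have : `|cosn 1 x - c0| <= 2.
    apply: (le_trans (ler_normB _ _)).
    by have := normr_cosn_le1 1 x; have := normr_cosn_le1 1 x0; rewrite -/c0; lra.
  rewrite ler_norml /w; move: (cosn 1 x - c0) => d /andP[d1 d2].
  have := sqr_ge0 d; have : 0 <= (2 - d) * (2 + d) by apply: mulr_ge0; lra.
  by move=> ? ?; apply/andP; split; lra.
pose rho := 1 - eta ^+ 2 / 4.
have wB x : 0 <= x <= 1 -> g x <= e -> w x <= rho.
  move=> xx gx; have h := heta _ xx gx; rewrite /w /rho.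
  have : eta ^+ 2 <= (cosn 1 x - c0) ^+ 2.
    by rewrite -(real_normK (num_real (cosn 1 x - c0))) lerXn2r ?nnegrE ?(ltW eta0).
  by lra.
have wx0 : w x0 = 1 by rewrite /w subrr expr0n/= mul0r subr0.
have cwk k : continuous (fun x => w x ^+ k).
  elim: k => [|k IH]; first by under eq_fun do rewrite expr0; exact: continuous_const.
  by under eq_fun do rewrite exprS; exact: continuous_mul.
have gw0 k n : cos_coef (fun x => g x * w x ^+ k) n = 0.
  elim: k n => [|k IH] n.
    have := g0 n; rewrite /cos_coef => <-; congr I; apply/funext => x.
    by rewrite expr0 mulr1.
  pose G x := g x * w x ^+ k.
  have cG : continuous G by exact: continuous_mul.
  have G1 := cos_coef_mul_cos1 cG IH.
  have cG1 : continuous (fun x => G x * cosn 1 x) by exact: continuous_mul.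
  have G2 := cos_coef_mul_cos1 cG1 G1.
  have -> : (fun x => g x * w x ^+ k.+1) = (fun x => (1 - c0 ^+ 2 / 4) * G x -
     ((- (c0 / 2)) * (G x * cosn 1 x) - (- 4^-1) * (G x * cosn 1 x * cosn 1 x))).
    by apply/funext => x; rewrite exprS /G /w; field.
  have cG2 : continuous (fun x => G x * cosn 1 x * cosn 1 x) by exact: continuous_mul.
  have cs a h : continuous h -> continuous (fun x => a * h x).
    by move=> ch; exact: (continuous_mul (@continuous_const R a) ch).
  have Zs a h m : continuous h -> cos_coef (fun x => a * h x) m = a * cos_coef h m.
    move=> ch; rewrite /cos_coef; under eq_fun do rewrite -mulrA.
    by rewrite unit_integralZ//; apply: continuous_mul => //; exact: continuous_cosn.
  rewrite cos_coefB; [|exact: cs|apply: continuous_sub; exact: cs].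
  rewrite cos_coefB; [|exact: cs|exact: cs].
  by rewrite !Zs// IH G1 G2 !mulr0 !subr0.
have [M M0 gM] : exists2 M : R, 0 < M & forall x, 0 <= x <= 1 -> - M <= g x.
  have [z _ hz] := @EVT_min R g 0 1 ler01 (continuous_subspaceT cg).
  exists (1 + `|g z|); first by have := normr_ge0 (g z); lra.
  move=> x xx; have /hz : x \in `[0, 1] by rewrite in_itv.
  by have := ler_norm (- g z); rewrite normrN; lra.
have rho1 : 0 <= rho < 1.
  rewrite /rho; have : 0 < eta ^+ 2 by rewrite exprn_gt0.
  suff : eta <= 2 by move=> h1 h2; apply/andP; split; nra.
  have : cos_coef g 0 = 0 by exact: g0.
  have [x xx gx] : exists2 x, 0 <= x <= 1 & g x <= e.
    apply: contrapT => hn.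
    have hge x : 0 <= x <= 1 -> e <= g x.
      by move=> xx; rewrite leNgt; apply/negP => h; apply: hn; exists x => //; exact: ltW.
    have : e <= I g by rewrite -[leLHS]unit_integral_cst; apply: unit_integral_le => //; exact: continuous_const.
    have := g0 0%N; rewrite /cos_coef; under eq_fun do rewrite cosn0 mulr1.
    by move=> ->; rewrite leNgt e0.
  move=> _; apply: (le_trans (heta _ xx gx)); apply: (le_trans (ler_normB _ _)).
  by have := normr_cosn_le1 1 x; have := normr_cosn_le1 1 x0; rewrite -/c0; lra.
pose r := (1 + rho) / 2.
have r01 : rho < r /\ r < 1 by rewrite /r; lra.
(* the bump [v] lives where both [w] exceeds [r] and [g] exceeds [e] *)
pose v x := Num.max (w x - r) 0.
have cv : continuous v.
  exact: (continuous_max0 (continuous_sub cw (@continuous_const R r))).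
have v0 x : 0 <= v x by rewrite le_max lexx orbT.
have Iv : 0 < I v.
  apply: (unit_integral_gt0 cv v0 x01); rewrite /v lt_max wx0.
  by apply/orP; left; lra.
(* On the bump [w^k >= r^k], while where [g <= e] only [w^k <= rho^k] counts against it; since
   [rho < r], large [k] gives the contradiction. *)
have key k : e * r ^+ k * I v <= M * rho ^+ k.
  have : I (fun x => e * r ^+ k * v x - M * rho ^+ k) <= I (fun x => g x * w x ^+ k).
    apply: unit_integral_le.
    - apply: continuous_sub; last exact: continuous_const.
      exact: (continuous_mul (@continuous_const R _) cv).
    - exact: continuous_mul.
    - move=> x xx; have /andP[wx wx1] := w01 x.
      have wk : 0 <= w x ^+ k by rewrite exprn_ge0.
      have rk : 0 <= rho ^+ k by rewrite exprn_ge0//; case/andP: rho1.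
      have [gx|gx] := leP (g x) e.
        have wr := wB _ xx gx.
        have -> : v x = 0 by apply/max_idPr; lra.
        have : w x ^+ k <= rho ^+ k by rewrite lerXn2r ?nnegrE//; case/andP: rho1.
        by have := gM _ xx; nra.
      apply: (@le_trans _ _ (e * r ^+ k * v x)).
        by rewrite gerBl mulr_ge0// ltW.
      rewrite -mulrA; apply: ler_pM => //; first exact: ltW.
        by rewrite mulr_ge0// exprn_ge0//; case/andP: rho1 => ? _; lra.
        by exact: ltW.
      rewrite /v; have [wr|wr] := leP (w x - r) 0; first by rewrite mulr0.
      apply: (@le_trans _ _ (r ^+ k)).
        rewrite ler_piMr ?exprn_ge0//; first by case/andP: rho1 => ? _; lra.
        by case/andP: rho1 => ? _; lra.
      by rewrite lerXn2r ?nnegrE//; [case/andP: rho1 => ? _|]; lra.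
  rewrite unit_integralB; [|exact: (continuous_mul (@continuous_const R _) cv)|exact: continuous_const].
  rewrite unit_integralZ// unit_integral_cst.
  have := gw0 k 0%N; rewrite /cos_coef; under eq_fun do rewrite cosn0 mulr1.
  by move=> ->; lra.
have r0 : 0 < r by case/andP: rho1 => ? _; lra.
have [k hk] : exists k, (rho / r) ^+ k < e * I v / M.
  have : (rho / r) ^+ n @[n --> \oo] --> (0 : R).
    have rr : 0 <= rho by case/andP: rho1.
    apply: cvg_expr; rewrite (ger0_norm (divr_ge0 rr (ltW r0))).
    by rewrite ltr_pdivrMr// mul1r; case: r01.
  have p0 : 0 < e * I v / M by rewrite divr_gt0 ?mulr_gt0.
  move/cvgrPdist_lt => /(_ _ p0)[k _ /(_ k (leqnn k))] /=.
  rewrite sub0r normrN => h; exists k.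
  by apply: le_lt_trans h; exact: ler_norm.
have rk0 : 0 < r ^+ k by rewrite exprn_gt0.
move: hk; rewrite ltr_pdivlMr// expr_div_n mulrAC ltr_pdivrMr// => hk.
by have := key k; rewrite mulrAC (mulrC M) leNgt hk.
Qed.

End CosineSeries.

(** * Inversion of cosine series with an explicit remainder *)

Lemma le_div_nat_eq0 (R : realType) (x C : R) (m : nat) :
  (forall N, (m <= N)%N -> `|x| <= C / N.+1%:R) -> x = 0.
Proof.
move=> h; apply/eqP; rewrite -normr_le0 leNgt; apply/negP => x0.
have C0 : 0 < C.
  have := h m (leqnn m) => /(lt_le_trans x0); rewrite pmulr_lgt0// invr_gt0 ltr0n//.
pose N := maxn m (Num.truncn (C / `|x|)).
have := h N (leq_maxl _ _); rewrite leNgt => /negP; apply.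
rewrite ltr_pdivrMr ?ltr0n// mulrC -ltr_pdivrMr//.
apply: lt_le_trans (truncnS_gt _) _; by rewrite ler_nat ltnS leq_maxr.
Qed.

(** The intervals of radius [e N] around [u N] meet pairwise, so the supremum of their left ends
    lies in all of them; the rate of convergence comes along. *)
Lemma nested_limit (R : realType) (u e : nat -> R) :
  (forall N M, (N <= M)%N -> `|u M - u N| <= e N) ->
  exists l, forall N, `|l - u N| <= e N.
Proof.
move=> h.
have ab N M : u N - e N <= u M + e M.
  have e0 K : 0 <= e K by have := h K K (leqnn _); rewrite subrr normr0.
  have [NM|/ltnW MN] := leqP N M.
    by have := h _ _ NM; rewrite ler_norml => /andP[]; have := e0 M; lra.
  by have := h _ _ MN; rewrite ler_norml => /andP[]; have := e0 N; lra.
pose A := [set x | exists N, x = u N - e N].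
have A0 : A !=set0 by exists (u 0%N - e 0%N); exists 0%N.
have Aub : has_ubound A by exists (u 0%N + e 0%N) => _ [N ->].
exists (sup A) => N; rewrite ler_norml; apply/andP; split.
  have : u N - e N <= sup A by apply: ub_le_sup => //; exists N.
  lra.
have : sup A <= u N + e N by apply: ge_sup => // _ [M ->].
lra.
Qed.

Section CosineInversion.
Context (R : realType).
Implicit Types g h : R -> R.

Lemma sum_inv_sqr_le (N k : nat) :
  \sum_(n <- iota N.+2 k) n%:R ^- 2 <= N.+1%:R^-1 - (N + k).+1%:R^-1 :> R.
Proof.
elim: k => [|k IH]; first by rewrite big_nil addn0 subrr.
rewrite -[k.+1]addn1 iotaD big_cat/= big_seq1; apply: (le_trans (lerD IH (lexx _))).
have -> : (N + (k + 1)).+1 = (N + k).+2 by rewrite addn1 addnS.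
rewrite !addSn; have : 0 < (N + k).+1%:R :> R by rewrite ltr0n.
have -> : (N + k).+2%:R = (N + k).+1%:R + 1 :> R by rewrite -[(N + k).+2]addn1 natrD.
move: (N + k).+1%:R => x x0.
rewrite -subr_ge0 (_ : _ - _ = (x * (x + 1) ^+ 2)^-1); last first.
  by field; rewrite !gt_eqF// ?addr_gt0.
by rewrite invr_ge0 mulr_ge0 ?sqr_ge0// ltW.
Qed.

Lemma cos_sum_cauchy (c : nat -> R) (D : R) (N M : nat) x : 0 <= D ->
  (forall n, (0 < n)%N -> `|c n| <= D / n%:R ^+ 2) -> (N <= M)%N ->
  `|cos_sum c M.+1 x - cos_sum c N.+1 x| <= 2 * D / N.+1%:R.
Proof.
move=> D0 cD NM; rewrite /cos_sum -(subnKC NM) -addSn iotaD big_cat/= add1n addrAC subrr add0r.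
apply: (le_trans (ler_norm_sum _ _ _)).
apply: (@le_trans _ _ (\sum_(n <- iota N.+2 (M - N)) 2 * D * n%:R ^- 2)).
  rewrite big_seq [leRHS]big_seq; apply: ler_sum => n; rewrite mem_iota => /andP[n2 _].
  rewrite normrM -[leRHS]mulr1 ler_pM// ?normr_cosn_le1// normrM ger0_norm// -mulrA ler_pM2l//.
  by apply: cD; exact: ltn_trans n2.
rewrite -mulr_sumr ler_wpM2l// ?mulr_ge0//; apply: (le_trans (sum_inv_sqr_le _ _)).
by rewrite gerBl invr_ge0.
Qed.

(** The decay of the coefficients makes the series converge uniformly; its sum [s] is continuous,
    symmetric and has the same coefficients as [g], so both agree on [[0, 1]] by uniqueness. The
    explicit remainder lets all later arguments work with finite sums. *)
Lemma cos_inversion g (D : R) : continuous g -> (forall x, g (1 - x) = g x) ->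
  0 <= D -> cos_coef g 0 = 0 ->
  (forall n, (0 < n)%N -> `|cos_coef g n| <= D / n%:R ^+ 2) ->
  forall N x, 0 <= x <= 1 -> `|g x - cos_sum (cos_coef g) N.+1 x| <= 2 * D / N.+1%:R.
Proof.
move=> cg gs D0 g0 gD; pose c := cos_coef g.
have [s hs] : {s : R -> R & forall x N, `|s x - cos_sum c N.+1 x| <= 2 * D / N.+1%:R}.
  apply: (@choice R R (fun x sx => forall N, `|sx - cos_sum c N.+1 x| <= 2 * D / N.+1%:R)) => x.
  apply: (@nested_limit _ (fun N => cos_sum c N.+1 x) (fun N => 2 * D / N.+1%:R)) => N M NM.
  exact: cos_sum_cauchy.
have cs : continuous s.
  move=> x; apply/cvgrPdist_lt => e e0.
  have [N hN'] : exists N : nat, 6 * D / (e : R) < N.+1%:R.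
    by exists (Num.truncn (6 * D / (e : R))); exact: truncnS_gt.
  have N0 : 0 < N.+1%:R :> R by rewrite ltr0n.
  have hN : 2 * D / N.+1%:R < e / 3.
    rewrite ltr_pdivrMr// [ltRHS]mulrC -ltr_pdivrMr ?divr_gt0//.
    apply: (@le_lt_trans _ _ (6 * D / e)); last exact: hN'.
    by rewrite le_eqVlt; apply/orP; left; apply/eqP; field; rewrite gt_eqF.
  have := @continuous_cos_sum R c N.+1 x; move/cvgrPdist_lt => /(_ (e / 3) ltac:(lra)).
  apply: filterS => y; rewrite /= => hy.
  have -> : s x - s y = (s x - cos_sum c N.+1 x) + (cos_sum c N.+1 x - cos_sum c N.+1 y)
    - (s y - cos_sum c N.+1 y) by ring.
  apply: (le_lt_trans (ler_normB _ _)).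
  apply: (le_lt_trans (lerD (ler_normD _ _) (lexx _))).
  have tri (u v w d E : R) : u <= d -> v < E / 3 -> w <= d -> d < E / 3 -> u + v + w < E by lra.
  exact: tri (hs x N) hy (hs y N) hN.
have ss x : s (1 - x) = s x.
  apply/eqP; rewrite -subr_eq0; apply/eqP.
  apply: (@le_div_nat_eq0 _ _ (4 * D) 0) => N _.
  have e : cos_sum c N.+1 (1 - x) = cos_sum c N.+1 x.
    by apply: eq_bigr => n _; rewrite cosn_sym.
  have := hs x N; have := hs (1 - x) N; rewrite e.
  have -> : s (1 - x) - s x = (s (1 - x) - cos_sum c N.+1 x) - (s x - cos_sum c N.+1 x) by ring.
  move=> h1 h2; apply: (le_trans (ler_normB _ _)); apply: (le_trans (lerD h1 h2)).
  by rewrite -mulrDl; have -> : 2 * D + 2 * D = 4 * D by ring.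
have sc m : cos_coef s m = c m.
  apply/eqP; rewrite -subr_eq0; apply/eqP.
  apply: (@le_div_nat_eq0 _ _ (2 * D) m) => N mN.
  have -> : c m = cos_coef (cos_sum c N.+1) m.
    case: m mN => [|m] mN; last by rewrite cos_coef_cos_sum//= ltnW.
    rewrite /c g0 /cos_coef; under eq_fun do rewrite cosn0 mulr1.
    by rewrite cos_coef0_cos_sum.
  rewrite -cos_coefB//; last exact: continuous_cos_sum.
  by apply: cos_coef_norm_le => // x; apply: cvgB; [exact: cs|exact: continuous_cos_sum].
move=> N x x01; suff -> : g x = s x by exact: hs.
apply/eqP; rewrite -subr_eq0; apply/eqP.
apply: (@cos_coef_uniq R (fun x => g x - s x)) => //.
- by move=> y; apply: cvgB; [exact: cg|exact: cs].
- by move=> y; rewrite gs ss.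
- by move=> n; rewrite cos_coefB// sc subrr.
Qed.

End CosineInversion.

Local Open Scope complex_scope.

(** * Modular symmetries of the form in real coordinates *)

Definition mx22 (a b c d : int) : 'M[int]_2 :=
  \matrix_(i < 2, j < 2) if i == 0 then (if j == 0 then a else b) else (if j == 0 then c else d).

Lemma det_mx22 a b c d : \det (mx22 a b c d) = a * d - b * c.
Proof.
rewrite (expand_det_row _ 0) !big_ord_recl big_ord0 /cofactor !det_mx11 !mxE/=.
by rewrite !expr0 expr1; ring.
Qed.

Section FormInCoordinates.
Context (R : realType) (t : R) (phi : R[i] -> R).
Hypothesis mphi : even_hecke_maass_cusp_form t phi.

Local Notation f := (in_coordinates phi).

Lemma form_periodic x y : 0 < y -> f (x + 1, y) = f (x, y).
Proof.
move=> y0; have := @maass_invariant _ _ _ mphi (mx22 1 1 0 1) (x +i* y).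
rewrite det_mx22 => /(_ _ _) h; rewrite /in_coordinates/= -h//.
congr phi; rewrite /moebius !mxE/= mul0r add0r divr1 mul1r.
by apply/eqP; rewrite eq_complex/= addr0 !eqxx.
Qed.

Lemma form_inversion x y : 0 < y ->
  f (- x / (x ^+ 2 + y ^+ 2), y / (x ^+ 2 + y ^+ 2)) = f (x, y).
Proof.
move=> y0; have := @maass_invariant _ _ _ mphi (mx22 0 (-1) 1 0) (x +i* y).
rewrite det_mx22 => /(_ _ _) h; rewrite /in_coordinates/= -[RHS]h//.
congr phi; rewrite /moebius !mxE/= mul0r add0r mul1r addr0 mulN1r.
by apply/eqP; rewrite eq_complex/= mulNr opprK !eqxx.
Qed.

Lemma form_even x y : 0 < y -> f (- x, y) = f (x, y).
Proof.
move=> y0; rewrite /in_coordinates/= -(@maass_even _ _ _ mphi (x +i* y))//.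
by congr phi; apply/eqP; rewrite eq_complex/= opprK !eqxx.
Qed.

Lemma form_sym x y : 0 < y -> f (1 - x, y) = f (x, y).
Proof. by move=> y0; rewrite addrC form_periodic// form_even. Qed.

Lemma form_periodic_nat x y n : 0 < y -> f (x + n%:R, y) = f (x, y).
Proof.
move=> y0; elim: n => [|n IH]; first by rewrite addr0.
by rewrite -[n.+1]addn1 natrD addrA form_periodic.
Qed.

Lemma form_unit_representative x y : 0 < y ->
  exists2 x', 0 <= x' <= 1 & f (x, y) = f (x', y).
Proof.
move=> y0; wlog x0 : x / 0 <= x.
  move=> h; have [|/ltW xn] := leP 0 x; first exact: h.
  have [|x' x'1 e] := h (- x); first by rewrite oppr_ge0.
  by exists x' => //; rewrite -e form_even.
exists (x - (Num.truncn x)%:R); last first.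
  by rewrite -[in LHS](subrK (Num.truncn x)%:R x) form_periodic_nat.
have /andP[h1 h2] := truncn_itv x0; rewrite -natr1 in h2.
by apply/andP; split; lra.
Qed.

(** A point with [|x| <= 1/2] and height at most [1/2] has [|z|^2 <= 1/2], so inversion at least
    doubles its height. The induction runs on the number of doublings still allowed. *)
Lemma form_high_representative x y : 0 < y ->
  exists2 p : R * R, 0 <= p.1 <= 1 /\ 2^-1 <= p.2 & f (x, y) = f p.
Proof.
move=> y0.
have [n hn] : exists n : nat, 2^-1 <= y * 2 ^+ n.
  exists (Num.truncn y^-1); apply: (@le_trans _ _ 1); first by lra.
  rewrite -ler_pdivrMl// mulr1; apply: (@le_trans _ _ (Num.truncn y^-1).+1%:R).
    exact/ltW/truncnS_gt.
  by rewrite -natrX ler_nat ltn_expl.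
elim: n x y y0 hn => [|n IH] x y y0 hn.
  rewrite mulr1 in hn; have [x' x'1 ->] := form_unit_representative x y0.
  by exists (x', y).
have [yh|yh] := leP 2^-1 y.
  by have [x' x'1 ->] := form_unit_representative x y0; exists (x', y).
have [x1 /andP[x10 x11] E] := form_unit_representative x y0.
have [x2 x2h ->] : exists2 x2, `|x2| <= 2^-1 & f (x, y) = f (x2, y).
  have [h|h] := leP x1 2^-1; first by exists x1 => //; rewrite ger0_norm.
  exists (1 - x1); last by rewrite form_sym.
  by rewrite ger0_norm; lra.
pose D := x2 ^+ 2 + y ^+ 2.
have D0 : 0 < D by rewrite ltr_wpDl ?sqr_ge0// exprn_gt0.
have D2 : D <= 2^-1.
  have : x2 ^+ 2 <= 4^-1.
    rewrite -(real_normK (num_real x2)) (_ : 4^-1 = 2^-1 ^+ 2); last by field.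
    by rewrite lerXn2r ?nnegrE.
  rewrite /D; nra.
rewrite -form_inversion// -/D; apply: IH; first by rewrite divr_gt0.
apply: (le_trans hn); rewrite exprS mulrA ler_pM2r ?exprn_gt0//.
by rewrite ler_pdivlMr//; nra.
Qed.

End FormInCoordinates.

(** * Partial derivatives and parameter integrals on the half-plane *)

Lemma mean_value_norm_le (R : realType) (f df : R -> R) (a b M : R) :
  (forall x, Num.min a b <= x <= Num.max a b -> is_derive x 1 f (df x)) ->
  (forall x, Num.min a b <= x <= Num.max a b -> `|df x| <= M) ->
  `|f b - f a| <= M * `|b - a|.
Proof.
wlog ab : a b / a <= b.
  move=> h; have /orP[ab|ba] := le_total a b; first exact: h.
  by rewrite minC maxC distrC (distrC b) => h1 h2; exact: h ba h1 h2.
rewrite (min_idPl ab) (max_idPr ab) => dfE dfM.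
rewrite (ger0_norm (_ : 0 <= b - a)) ?subr_ge0// ler_norml.
have h1 : f b - M * b <= f a - M * a.
  apply: (@is_derive_nonincreasing _ (fun x => f x - M * x) (fun x => df x - M)) => // x xab.
    by have ? := dfE _ xab; apply: is_derive_eq; rewrite /GRing.scale/=; ring.
  by have := dfM _ xab; rewrite ler_norml => /andP[]; lra.
have h2 : f a + M * a <= f b + M * b.
  apply: (@is_derive_nondecreasing _ (fun x => f x + M * x) (fun x => df x + M)) => // x xab.
    by have ? := dfE _ xab; apply: is_derive_eq; rewrite /GRing.scale/=; ring.
  by have := dfM _ xab; rewrite ler_norml => /andP[]; lra.
by apply/andP; split; lra.
Qed.

Section PlaneCalculus.
Context (R : realType).
Implicit Types (f : R * R -> R) (x y : R).
Local Notation U := [set p : R * R | 0 < p.2].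

Lemma is_derive_slice_x f x y : derivable f (x, y) ((1, 0) : R * R) ->
  is_derive x 1 (fun x => f (x, y)) (partial_x f (x, y)).
Proof.
move=> df; have E (h : R) : h^-1 *: (((fun x => f (x, y)) \o shift x) (h *: 1) - f (x, y)) =
    h^-1 *: ((f \o shift (x, y)) (h *: ((1, 0) : R * R)) - f (x, y)).
  by congr (_ *: (f _ - _)); congr pair; rewrite /= scaler0 add0r.
by split; rewrite /derivable /partial_x /derive; under eq_fun do rewrite E.
Qed.

Lemma is_derive_slice_y f x y : derivable f (x, y) ((0, 1) : R * R) ->
  is_derive y 1 (fun y => f (x, y)) (partial_y f (x, y)).
Proof.
move=> df; have E (h : R) : h^-1 *: (((fun y => f (x, y)) \o shift y) (h *: 1) - f (x, y)) =
    h^-1 *: ((f \o shift (x, y)) (h *: ((0, 1) : R * R)) - f (x, y)).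
  by congr (_ *: (f _ - _)); congr pair; rewrite /= scaler0 add0r.
by split; rewrite /derivable /partial_y /derive; under eq_fun do rewrite E.
Qed.

Lemma near_bounded (g : R * R -> R) p : {for p, continuous g} ->
  exists2 M, 0 < M & \forall q \near p, `|g q| <= M.
Proof.
move=> cg; exists (`|g p| + 1); first by rewrite ltr_wpDl.
have := cg; move/cvgrPdist_lt => /(_ 1 ltr01); apply: filterS => q h.
have -> : g q = g p - (g p - g q) by ring.
by apply: (le_trans (ler_normB _ _)); rewrite lerD2l ltW.
Qed.

(** [C1_on] only speaks of derivatives along the axes; joint continuity comes from moving first
    along [y], then along [x], with locally bounded partial derivatives. *)
Lemma C1_continuous f p : C1_on U f -> U p -> {for p, continuous f}.
Proof.
case: p => x0 y0 C1f /= y00; apply/cvgrPdist_lt => e e0.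
have [_ _ cx cy] := C1f (x0, y0) y00.
have [M1 M10 h1] := near_bounded cx; have [M2 M20 h2] := near_bounded cy.
have : nbhs ((x0, y0) : R * R) ([set q | `|partial_x f q| <= M1] `&` [set q | `|partial_y f q| <= M2]).
  exact: (filterI h1 h2).
move=> /nbhs_ballP[d /= d0 hd].
(* The second entry keeps the neighbourhood inside the half-plane. *)
pose d1 := Num.min d y0.
have d10 : 0 < d1 by rewrite lt_min d0.
pose r := Num.min d1 (e / (M1 + M2)).
have r0 : 0 < r by rewrite lt_min d10 divr_gt0// addr_gt0.
suff : nbhs ((x0, y0) : R * R) [set q | `|f (x0, y0) - f q| < e] by [].
apply/nbhs_ballP; exists r => //= -[x y] [/= bx by_].
rewrite /ball/= in bx by_.
have rd1 : r <= d1 by rewrite ge_min lexx.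
have re : r <= e / (M1 + M2) by rewrite ge_min lexx orbT.
have d1d : d1 <= d by rewrite ge_min lexx.
have d1y : d1 <= y0 by rewrite ge_min lexx orbT.
have near1 u : Num.min y0 y <= u <= Num.max y0 y -> `|y0 - u| < r.
  move: by_; rewrite !ltr_norml ge_min le_max => /andP[? ?] /andP[/orP[?|?] /orP[?|?]];
  by apply/andP; split; lra.
have near2 u : Num.min x0 x <= u <= Num.max x0 x -> `|x0 - u| < r.
  move: bx; rewrite !ltr_norml ge_min le_max => /andP[? ?] /andP[/orP[?|?] /orP[?|?]];
  by apply/andP; split; lra.
have hb (u v : R) : `|x0 - u| < d -> `|y0 - v| < d ->
    `|partial_x f (u, v)| <= M1 /\ `|partial_y f (u, v)| <= M2.
  by move=> hu hv; apply: (hd (u, v)); split.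
have rd : r <= d by exact: le_trans d1d.
have ypos u : `|y0 - u| < r -> 0 < u.
  by rewrite ltr_norml => /andP[? ?]; lra.
have yp : 0 < y := ypos _ by_.
have e1 : `|f (x, y) - f (x0, y)| <= M1 * `|x - x0|.
  apply: (@mean_value_norm_le _ (fun x => f (x, y)) (fun x => partial_x f (x, y))) => u /near2 ux.
    have [dx _ _ _] := C1f (u, y) yp.
    exact: (is_derive_slice_x dx).
  by have [] := hb u y (lt_le_trans ux rd) (lt_le_trans by_ rd).
have e2 : `|f (x0, y) - f (x0, y0)| <= M2 * `|y - y0|.
  apply: (@mean_value_norm_le _ (fun y => f (x0, y)) (fun y => partial_y f (x0, y))) => u /near1 uy.
    have u0 : 0 < u := ypos _ uy.
    have [_ dy _ _] := C1f (x0, u) u0.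
    exact: (is_derive_slice_y dy).
  by have [] := hb x0 u _ (lt_le_trans uy rd); rewrite ?subrr ?normr0.
rewrite distrC.
have -> : f (x, y) - f (x0, y0) = (f (x, y) - f (x0, y)) + (f (x0, y) - f (x0, y0)) by ring.
apply: (le_lt_trans (ler_normD _ _)); apply: (le_lt_trans (lerD e1 e2)).
rewrite (distrC x) (distrC y).
apply: (@lt_le_trans _ _ (M1 * r + M2 * r)); first by apply: ltrD; rewrite ltr_pM2l.
by rewrite -mulrDl mulrC -ler_pdivlMr// addr_gt0.
Qed.

Definition continuous_on_half_plane f := forall p, U p -> {for p, continuous f}.

Lemma continuous_slice_x f y : continuous_on_half_plane f -> 0 < y ->
  continuous (fun x => f (x, y)).
Proof.
move=> cf y0 x; apply: (@continuous_comp _ _ _ (fun x => (x, y)) f); last exact: cf.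
exact: (cvg_pair (@cvg_id _ (nbhs x)) (@cvg_cst _ y _ _ _)).
Qed.

Lemma bounded_rectangle f (a b : R) : continuous_on_half_plane f -> 0 < a -> a <= b ->
  exists2 M, 0 <= M & forall x y, 0 <= x <= 1 -> a <= y <= b -> `|f (x, y)| <= M.
Proof.
move=> cf a0 ab.
have kK : compact (`[0, 1]%classic `*` `[a, b]%classic : set (R * R)).
  by apply: compact_setX; exact: segment_compact.
have [||c _ hc] := compact_EVT_max (f := fun p => `|f p|) _ kK.
- by exists (0, a); split => /=; rewrite in_itv/= lexx ?ler01.
- apply: continuous_in_subspaceT => p; rewrite inE => -[_ /=]; rewrite in_itv/= => /andP[ap _].
  by apply: continuous_comp; [apply: cf; exact: lt_le_trans ap|exact: norm_continuous].
exists `|f c| => // x y xx yy; apply: hc; rewrite inE.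
by split; rewrite /= in_itv.
Qed.

(** Differentiation under the integral, dominated by a constant: for heights in []y / 2, 2 y[]
    compactness bounds both [partial_y f] and [w]. *)
Lemma is_derive_unit_integral f (w : R -> R) y : continuous w ->
  C1_on U f -> continuous_on_half_plane (partial_y f) -> 0 < y ->
  is_derive y 1 (fun y => unit_integral (fun x => f (x, y) * w x))
    (unit_integral (fun x => partial_y f (x, y) * w x)).
Proof.
move=> cw C1f cfy y0.
have cf : continuous_on_half_plane f by move=> p; exact: C1_continuous.
pose F (y x : R) := f (x, y) * w x.
have dF (z x : R) : 0 < z -> is_derive z 1 (F ^~ x) (partial_y f (x, z) * w x).
  move=> z0; have ? : is_derive z 1 (fun y => f (x, y)) (partial_y f (x, z)).
    by apply: is_derive_slice_y; case: (C1f (x, z) z0).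
  by apply: is_derive_eq; rewrite /GRing.scale/=; ring.
have pF z x : 0 < z -> partial1of2 F z x = partial_y f (x, z) * w x.
  by move=> z0; rewrite partial1of2E; have ? := dF _ x z0; exact: derive_val.
have y2 : 0 < y / 2 by rewrite divr_gt0.
have [M M0 hM] := @bounded_rectangle _ (y / 2) (2 * y) cfy y2 ltac:(lra).
have [c _ hc] := @EVT_max R (fun x => `|w x|) 0 1 ler01
  (continuous_subspaceT (fun x => cvg_norm (cw x))).
have mI : measurable (`[0%R, 1%R]%classic : set (measurableTypeR R)) by [].
have Ia : `]y / 2, (2 * y)[%classic y by rewrite /= in_itv/=; apply/andP; split; lra.
have intF z : `]y / 2, (2 * y)[%classic z ->
    (@lebesgue_measure R).-integrable `[0, 1] (EFin \o F z).
  rewrite /= in_itv/= => /andP[h _]; apply: integrable_unit.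
  by apply: continuous_mul => //; apply: continuous_slice_x => //; lra.
have derF z x : `]y / 2, (2 * y)[%classic z -> `[0, 1]%classic x -> derivable (F ^~ x) z 1.
  by rewrite /= in_itv/= => /andP[h _] _; have [] := dF z x ltac:(lra).
have G0 (x : R) : 0 <= M * `|w c| by rewrite mulr_ge0.
have intG : (@lebesgue_measure R).-integrable `[0, 1] (EFin \o (fun _ : R => M * `|w c|)).
  by apply: integrable_unit => x; exact: cvg_cst.
have Gub z x : `]y / 2, (2 * y)[%classic z -> `[0, 1]%classic x ->
    `|partial1of2 F z x| <= M * `|w c|.
  rewrite /= !in_itv/= => /andP[h1 h2] x01; rewrite pF ?normrM ?(lt_trans y2 h1)//.
  apply: ler_pM => //; first by apply: hM => //; rewrite !ltW.
  by apply: hc; rewrite in_itv.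
have d1 := @derivable_under_integral R _ (measurableTypeR R) (@lebesgue_measure R) F
  `[0%R, 1%R]%classic mI y (y / 2) (2 * y) Ia intF derF _ G0 intG Gub.
have d2 := @differentiation_under_integral R _ (measurableTypeR R) (@lebesgue_measure R) F
  `[0%R, 1%R]%classic mI y (y / 2) (2 * y) Ia intF derF _ G0 intG Gub.
split; first by rewrite /unit_integral; exact: d1.
rewrite -derive1E /unit_integral d2.
by congr unit_integral; apply/funext => x /=; rewrite pF.
Qed.

End PlaneCalculus.

(** * Measurability in the plane and the mass of a high rectangle *)

Section PlaneMeasurability.
Context (R : realType).
Local Notation RM := (measurableTypeR R).

(** Open sets are countable unions of squares with rational centre and radius; this ties the
    topology of the plane to the product sigma-algebra behind the Petersson norm. *)
Lemma open_measurable_prod (O : set (R * R)) : open O -> measurable (O : set (RM * RM)).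
Proof.
move=> oO.
pose B (q : rat * rat * rat) : set (RM * RM) :=
  `](ratr q.1.1 - ratr q.2), (ratr q.1.1 + ratr q.2)[%classic `*`
  `](ratr q.1.2 - ratr q.2), (ratr q.1.2 + ratr q.2)[%classic.
(* Squares not contained in [O] are replaced by the empty set, so that the union can run over all
   rational triples. *)
have -> : O = \bigcup_q (if `[< B q `<=` O >] then B q else set0).
  apply/seteqP; split => [[x y] Oxy|p [q _]]; last by case: asboolP => // h; exact: h.
  have : nbhs ((x, y) : R * R) O by exact: open_nbhs_nbhs.
  move=> /nbhs_ballP[d /= d0 hd].
  have [r] : exists r : rat, ratr r \in `](d / 4), (d / 2)[ by apply: rat_in_itvoo; lra.
  rewrite in_itv/= => /andP[r1 r2].
  have [a] : exists a : rat, ratr a \in `](x - d / 4), (x + d / 4)[ by apply: rat_in_itvoo; lra.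
  rewrite in_itv/= => /andP[a1 a2].
  have [b] : exists b : rat, ratr b \in `](y - d / 4), (y + d / 4)[ by apply: rat_in_itvoo; lra.
  rewrite in_itv/= => /andP[b1 b2].
  exists ((a, b), r) => //; case: asboolP; last first.
    case=> -[u v] [/=]; rewrite !in_itv/= => /andP[? ?] /andP[? ?]; apply: hd.
    by split; rewrite /ball/= ltr_norml; apply/andP; split; lra.
  by move=> _; split; rewrite /= in_itv/=; apply/andP; split; lra.
apply: countable_bigcupT_measurable => // q; case: asboolP => // _.
by apply: measurableX; exact: measurable_itv.
Qed.

Lemma continuous_measurable_prod (f : R * R -> R) : continuous f ->
  measurable_fun [set: RM * RM] (f : RM * RM -> RM).
Proof.
move=> /continuousP cf; apply: (measurability _ (RGenOpens.measurableE R)).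
move=> _ [_ [a [b ->] <-]]; rewrite setTI; apply: open_measurable_prod.
exact/cf/interval_open.
Qed.

Lemma continuous_fst : continuous (fun p : R * R => p.1).
Proof. by move=> p; exact: cvg_fst. Qed.

Lemma continuous_snd : continuous (fun p : R * R => p.2).
Proof. by move=> p; exact: cvg_snd. Qed.

Lemma measurable_fundamental_domain :
  measurable (fundamental_domain : set (RM * RM)).
Proof.
pose n1 (p : R * R) := `|p.1|; pose n2 (p : R * R) := p.1 ^+ 2 + p.2 ^+ 2.
have -> : fundamental_domain = [set p : R * R | 0 < p.2] `&`
  ~` (n1 @^-1` [set x | 2^-1 < x]) `&` ~` (n2 @^-1` [set x | x < 1]).
  apply/seteqP; split => [p [h1 h2 h3]|p [[/= h1 /negP h2] /negP h3]].
    by split; [split|] => //=; apply/negP; rewrite -leNgt.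
  by split => //; [rewrite leNgt|rewrite /n2 -leNgt in h3].
have c1 : continuous n1 by move=> p; apply: cvg_norm; exact: continuous_fst.
have c2 : continuous n2.
  have -> : n2 = (fun p => p.1 * p.1 + p.2 * p.2) by apply/funext => p; rewrite /n2 !expr2.
  move=> p; apply: cvgD; apply: cvgM; [exact: continuous_fst|exact: continuous_fst|
    exact: continuous_snd|exact: continuous_snd].
apply: measurableI; last first.
  apply: measurableC; apply: open_measurable_prod.
  by move/continuousP: c2; apply; exact: open_lt.
apply: measurableI; last first.
  apply: measurableC; apply: open_measurable_prod.
  by move/continuousP: c1; apply; exact: open_gt.
apply: open_measurable_prod.
by move: continuous_snd => /continuousP /(_ [set x | 0 < x]); apply; exact: open_gt.
Qed.

Local Notation mu := (@lebesgue_measure R).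

(** Brings an integral over half a period, which fits into the fundamental domain, back to
    [unit_integral]. *)
Lemma integral_half_sym (h : R -> R) : continuous h -> (forall x, h (1 - x) = h x) ->
  (\int[mu]_(x in `[0%R, 2^-1%R]) (h x)%:E = (unit_integral h / 2)%:E)%E.
Proof.
move=> ch hs.
have c0 (a b : R) : {within `[a, b], continuous h} by exact: continuous_subspaceT.
have ih (a b : R) : mu.-integrable `[a, b] (EFin \o h).
  by apply: continuous_compact_integrable => //; exact: segment_compact.
have e1 : \int[mu]_(x in `[0, 2^-1]) h x = \int[mu]_(x in `[2^-1, 1]) h x.
  rewrite Rintegration_by_substitution_onem//; last by lra.
  have -> : unstable.onem (2^-1 : R) = 2^-1 by rewrite /unstable.onem; field.
  by apply: eq_Rintegral => x _; rewrite /unstable.onem hs.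
have e2 : unit_integral h = \int[mu]_(x in `[0, 2^-1]) h x + \int[mu]_(x in `[2^-1, 1]) h x.
  have h1 := @Rintegral_itvB R h (BLeft 0) (BRight 1) (2^-1) (ih 0 1).
  have h2 := @Rintegral_itv_obnd_cbnd R 2^-1 (BRight 1) h.
  rewrite -h2; last first.
    by apply: integrableS (ih 2^-1 1) => //; exact: subset_itv_oc_cc.
  by rewrite -h1 ?bnd_simp; [rewrite addrC subrK|lra|lra].
have -> : unit_integral h / 2 = \int[mu]_(x in `[0, 2^-1]) h x by rewrite e2 -e1; field.
by rewrite /Rintegral fineK//; have := integrable_fin_num _ (ih 0 2^-1); apply.
Qed.

(** The rectangle [[0, 1/2] x [Y, Y + B]] lies in the fundamental domain and carries at most the
    total mass [1]; Tonelli and the symmetry [x -> 1 - x] turn its mass into an integral over [y] of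
    full-period means. *)
Lemma petersson_rectangle (t : R) (phi : R[i] -> R) (Y B m : R) :
  even_hecke_maass_cusp_form t phi -> 1 <= Y -> 0 <= B -> 0 <= m ->
  (forall y, Y <= y <= Y + B ->
    m <= unit_integral (fun x => in_coordinates phi (x, y) ^+ 2) / 2 / y ^+ 2) ->
  m * B <= 1.
Proof.
move=> mphi Y1 B0 m0 hm.
pose f := in_coordinates phi.
have [C1f _ _] := maass_C2 mphi.
(* Bounding the height below by [1/2] gives a function continuous on the whole plane that agrees
   with the form on the fundamental domain, where [y >= 1/2]. *)
pose F (p : R * R) : R := f (p.1, Num.max p.2 2^-1).
pose g (p : R * R) : R := F p * F p / (Num.max p.2 2^-1 * Num.max p.2 2^-1).
have max0 (y : R) : 0 < Num.max y 2^-1 by rewrite lt_max; apply/orP; right; lra.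
have cmax : continuous (fun p : R * R => Num.max p.2 2^-1).
  move=> p; apply: (@continuous_max _ _ (fun p : R * R => p.2) (fun=> 2^-1)).
    exact: continuous_snd.
  exact: cvg_cst.
have cF : continuous F.
  move=> p; apply: (@continuous_comp _ _ _ (fun p : R * R => (p.1, Num.max p.2 2^-1)) f).
    have h1 := @continuous_fst p; have h2 := cmax p.
    exact: (cvg_pair h1 h2).
  by apply: C1_continuous => //; exact: max0.
have cg : continuous g.
  move=> p; apply: cvgM; first by apply: cvgM; exact: cF.
  apply: cvgV; first by rewrite mulf_neq0// gt_eqF.
  by apply: cvgM; exact: cmax.
have g0 p : (0 <= (g p)%:E)%E by rewrite lee_fin /g -!expr2 divr_ge0 ?sqr_ge0.
have mg : measurable_fun [set: RM * RM] (EFin \o g).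
  by apply/measurable_EFinP; exact: continuous_measurable_prod.
have mFD := measurable_fundamental_domain.
pose D : set (RM * RM) := `[0, 2^-1]%classic `*` `[Y, Y + B]%classic.
have mD : measurable D by apply: measurableX; exact: measurable_itv.
have DFD : D `<=` fundamental_domain.
  move=> [x y] [/=]; rewrite !in_itv/= => /andP[x0 x1] /andP[y0 y1].
  split => /=; [lra|by rewrite ger0_norm|].
  by have := sqr_ge0 x; nra.
have e1 : (\int[mu \x mu]_(p in fundamental_domain) (g p)%:E = 1)%E.
  rewrite -(maass_normalized mphi) /petersson_norm2; apply: eq_integral => -[x y].
  rewrite inE => -[/= y0 x1 xy].
  have yh : 2^-1 <= y.
    rewrite leNgt; apply/negP => yl.
    have : x ^+ 2 <= 4^-1.
      rewrite -(real_normK (num_real x)) (_ : 4^-1 = 2^-1 ^+ 2); last by field.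
      by rewrite lerXn2r ?nnegrE.
    by nra.
  by rewrite /g /F /= (max_idPl yh) -!expr2.
have le1 : (\int[mu \x mu]_(p in D) (g p)%:E <= 1)%E.
  rewrite -e1; apply: ge0_subset_integral => //.
  by apply: measurable_funTS.
rewrite integral_mkcond in le1.
pose G := (EFin \o g) \_ D.
have mG : measurable_fun [set: RM * RM] G.
  by apply/(measurable_restrictT _ mD)/measurable_funTS.
have G0 p : (0 <= G p)%E by rewrite /G patchE; case: ifP => _; [exact: g0|exact: lexx].
rewrite (@fubini_tonelli2 _ _ _ _ _ _ _ _ mG G0) in le1.
rewrite -lee_fin; apply: le_trans le1.
have -> : (m * B)%:E = (\int[mu]_y (((cst m%:E) \_ `[Y, (Y + B)%R]) y))%E.
  rewrite -integral_mkcond integral_cst//= lebesgue_measure_itv/= lte_fin.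
  case: ltP => h; first by rewrite -EFinD -EFinM; congr EFin; ring.
  by have -> : B = 0; [lra|rewrite mulr0 mule0].
apply: ge0_le_integral => //.
- by move=> y _; rewrite patchE; case: ifP => // _; rewrite lee_fin.
- have mI : measurable (`[Y, Y + B]%classic : set RM) by exact: measurable_itv.
  by apply/(measurable_restrictT _ mI); exact: measurable_cst.
- exact: measurable_fun_fubini_tonelli_G.
move=> y _; rewrite /fubini_G patchE; case: ifPn => [|_]; last first.
  by apply: integral_ge0.
rewrite inE/= in_itv/= => yY.
have -> : (\int[mu]_x G (x, y) = \int[mu]_(x in `[0%R, 2^-1%R]) (g (x, y))%:E)%E.
  rewrite [RHS]integral_mkcond; apply: eq_integral => x _; rewrite /G !patchE.
  congr (if _ then _ else _); apply/idP/idP; rewrite !inE.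
    by case.
  by move=> h; split => //=; rewrite in_itv.
have y0 : 0 < y by have /andP[? _] := yY; lra.
have yh : 2^-1 <= y by have /andP[? _] := yY; lra.
have -> : (fun x : R => (g (x, y))%:E) = (fun x => (y ^- 2 * (f (x, y) ^+ 2))%:E).
  by apply/funext => x; rewrite /g /F /= (max_idPl yh) -!expr2 mulrC.
have cfy : continuous (fun x => f (x, y)).
  by apply: continuous_slice_x => // p; exact: C1_continuous.
rewrite (@integral_half_sym (fun x => y ^- 2 * f (x, y) ^+ 2)).
- rewrite lee_fin unit_integralZ.
    by apply: (le_trans (hm _ yY)); rewrite mulrC mulrA.
  by under eq_fun do rewrite expr2; exact: continuous_mul.
- apply: continuous_mul; first exact: continuous_const.
  by under eq_fun do rewrite expr2; exact: continuous_mul.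
- by move=> x; rewrite /f (form_sym mphi).
Qed.

End PlaneMeasurability.

(** * Fourier coefficients of the form and its boundedness *)

Lemma expRN_le_pow (R : realType) (x : R) (n : nat) : 0 < x ->
  expR (- x) <= n.+1`!%:R / x ^+ n.+1.
Proof.
move=> x0; rewrite expRN -[leLHS]div1r ler_pdivrMr ?expR_gt0//.
have xn : 0 < x ^+ n.+1 by rewrite exprn_gt0.
have := @expR_ge1Dxn R x n (ltW x0).
have f0 : 0 < n.+1`!%:R :> R by rewrite ltr0n fact_gt0.
rewrite mulrAC ler_pdivlMr// mul1r => h.
have : x ^+ n.+1 / n.+1`!%:R <= expR x by apply: le_trans h; rewrite lerDr.
by rewrite ler_pdivrMr// mulrC.
Qed.

Section FourierCoefficients.
Context (R : realType) (t : R) (phi : R[i] -> R).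
Hypothesis mphi : even_hecke_maass_cusp_form t phi.
Implicit Types (n : nat) (x y s : R).

Local Notation f := (in_coordinates phi).
Local Notation I := (@unit_integral R).

Definition coef n y : R := cos_coef (fun x => f (x, y)) n.
Definition dcoef n y : R := I (fun x => partial_y f (x, y) * cosn n x).

Let C1f := let: And3 h _ _ := maass_C2 mphi in h.
Let C1fx := let: And3 _ h _ := maass_C2 mphi in h.
Let C1fy := let: And3 _ _ h := maass_C2 mphi in h.

Lemma form_continuous : continuous_on_half_plane f.
Proof. by move=> p; exact: C1_continuous. Qed.

Let cfy : continuous_on_half_plane (partial_y f).
Proof. by move=> p; exact: (C1_continuous C1fy). Qed.
Let cfyy : continuous_on_half_plane (partial_y (partial_y f)).
Proof. by move=> p up; case: (C1fy up). Qed.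
Let cfxx : continuous_on_half_plane (partial_x (partial_x f)).
Proof. by move=> p up; case: (C1fx up). Qed.

Lemma form_slice_continuous y : 0 < y -> continuous (fun x => f (x, y)).
Proof. by move=> y0; apply: continuous_slice_x => //; exact: form_continuous. Qed.

Lemma is_derive_coef n y : 0 < y -> is_derive y 1 (coef n) (dcoef n y).
Proof. by move=> y0; exact: (is_derive_unit_integral (@continuous_cosn R n) C1f cfy y0). Qed.

Lemma partial_x_periodic y : 0 < y -> partial_x f (1, y) = partial_x f (0, y).
Proof.
move=> y0.
have d0 (x : R) : is_derive x 1 (fun x => f (x, y)) (partial_x f (x, y)).
  by apply: is_derive_slice_x; case: (@C1f (x, y) y0).
have E (h : R) : h^-1 *: (((fun x => f (x + 1, y)) \o shift 0) (h *: 1) - f (0 + 1, y)) =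
    h^-1 *: (((fun x => f (x, y)) \o shift 1) (h *: 1) - f (1, y)) :> R.
  by rewrite /= addr0 add0r.
have d : 'D_1 (fun x : R => f (x + 1, y)) (0 : R) = 'D_1 (fun x : R => f (x, y)) (1 : R).
  by rewrite /derive; under eq_fun do rewrite E.
have e : (fun x => f (x + 1, y)) = (fun x => f (x, y)).
  by apply/funext => x; rewrite (form_periodic mphi).
rewrite e in d; have d1 := d0 1; have d2 := d0 0.
by rewrite -(@derive_val _ _ _ _ _ _ _ d1) -(@derive_val _ _ _ _ _ _ _ d2).
Qed.

(** Separation of variables: the eigenvalue equation trades the second [y]-derivative for [- f_xx],
    and two integrations by parts in [x] turn that into multiplication by [(2 pi n)^2]. *)
Lemma is_derive_dcoef n y : 0 < y ->
  is_derive y 1 (dcoef n) (((2 * pi * n%:R) ^+ 2 - (4^-1 + t ^+ 2) / y ^+ 2) * coef n y).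
Proof.
move=> y0; have := is_derive_unit_integral (@continuous_cosn R n) C1fy cfyy y0.
suff -> : I (fun x => partial_y (partial_y f) (x, y) * cosn n x) =
  ((2 * pi * n%:R) ^+ 2 - (4^-1 + t ^+ 2) / y ^+ 2) * coef n y by [].
pose a : R := 2 * pi * n%:R.
pose L : R := (4^-1 + t ^+ 2) / y ^+ 2.
(* One primitive performs both integrations by parts; periodicity makes its values at [0] and [1]
   agree. *)
pose P (x : R) := partial_x f (x, y) * cosn n x + a * (f (x, y) * sin (a * x)).
pose dP (x : R) := partial_x (partial_x f) (x, y) * cosn n x + a ^+ 2 * (f (x, y) * cosn n x).
have cc := @continuous_cosn R n.
have cs1 := form_slice_continuous y0.
have cxx := continuous_slice_x cfxx y0.
have c1 : continuous (fun x => f (x, y) * cosn n x) by exact: continuous_mul.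
have c2 : continuous (fun x => partial_x (partial_x f) (x, y) * cosn n x) by exact: continuous_mul.
have c3 (b : R) : continuous (fun x => b * (f (x, y) * cosn n x)).
  by apply: continuous_mul => //; exact: continuous_const.
have cdP : continuous dP by move=> x; apply: cvgD; [exact: c2|exact: c3].
have ddP (x : R) : is_derive x 1 P (dP x).
  have ? : is_derive x 1 (fun x => f (x, y)) (partial_x f (x, y)).
    by apply: is_derive_slice_x; case: (@C1f (x, y) y0).
  have ? : is_derive x 1 (fun x => partial_x f (x, y)) (partial_x (partial_x f) (x, y)).
    by apply: is_derive_slice_x; case: (@C1fx (x, y) y0).
  rewrite /P /dP /cosn -/a; apply: is_derive_eq; rewrite /GRing.scale/=.
  ring.
have IdP : I dP = 0.
  rewrite (unit_integral_FTC cdP ddP) /P partial_x_periodic// mulr1 mulr0 sin0.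
  by rewrite /a sin_2pin -[cosn n 1](cosn_sym) subrr !mulr0 subrr.
have -> : (fun x => partial_y (partial_y f) (x, y) * cosn n x) =
   (fun x => (a ^+ 2 - L) * (f (x, y) * cosn n x) - dP x).
  apply/funext => x; have := maass_eigen mphi x y0; rewrite /euclidean_laplacian.
  rewrite -[phi _]/(f (x, y)) => E.
  have -> : partial_y (partial_y f) (x, y) = - partial_x (partial_x f) (x, y) - L * f (x, y).
    have y2 : y ^+ 2 != 0 by rewrite expf_neq0// gt_eqF.
    apply: (mulfI y2); rewrite /L.
    have -> : y ^+ 2 * (- partial_x (partial_x f) (x, y) - (4^-1 + t ^+ 2) / y ^+ 2 * f (x, y)) =
      - (y ^+ 2 * partial_x (partial_x f) (x, y)) - (4^-1 + t ^+ 2) * f (x, y).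
      by field; rewrite gt_eqF.
    by lra.
  by rewrite /dP; ring.
by rewrite (unit_integralB (c3 (a ^+ 2 - L)) cdP) (unit_integralZ _ c1) IdP subr0.
Qed.

(** With [exp s = 2 pi n y], dividing by the square root of this argument removes the first-order
    term, and all [n] obey the same equation. For a cusp form this is a multiple of
    [K_{it}(exp s)]. *)
Definition kfun n s : R := expR (- (s / 2)) * coef n (expR s / (2 * pi * n%:R)).
Definition dkfun n s : R :=
  let y := expR s / (2 * pi * n%:R) in
  - 2^-1 * kfun n s + expR (- (s / 2)) * (y * dcoef n y).

Let pin_gt0 n : (0 < n)%N -> 0 < 2 * pi * n%:R :> R.
Proof. by move=> n0; rewrite !mulr_gt0 ?pi_gt0 ?ltr0n. Qed.

Lemma is_derive_kfun n s : (0 < n)%N -> is_derive s 1 (kfun n) (dkfun n s).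
Proof.
move=> /pin_gt0 a0; rewrite /dkfun /kfun/=; move: (2 * pi * n%:R) a0 => a a0.
have ? : is_derive (expR s / a) 1 (coef n) (dcoef n (expR s / a)).
  by apply: is_derive_coef; rewrite divr_gt0 ?expR_gt0.
by apply: is_derive_eq; rewrite /GRing.scale/= /kfun; ring.
Qed.

Lemma is_derive_dkfun n s : (0 < n)%N ->
  is_derive s 1 (dkfun n) ((expR (2 * s) - t ^+ 2) * kfun n s).
Proof.
move=> n0; have hk (s : R) := is_derive_kfun s n0.
have e2 : expR (2 * s) = expR s ^+ 2 by rewrite -expRM_natl.
have ? := hk s.
have a0 := pin_gt0 n0.
have y0 : 0 < expR s / (2 * pi * n%:R) by rewrite divr_gt0 ?expR_gt0.
have ? := is_derive_dcoef n y0.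
rewrite /dkfun; apply: is_derive_eq; rewrite /GRing.scale/= /dkfun /kfun e2.
move: (2 * pi * n%:R) a0 (expR s) (expR_gt0 s) => a a0 E E0.
by field; rewrite !gt_eqF.
Qed.

Lemma coef_kfun n y : (0 < n)%N -> 0 < y ->
  coef n y ^+ 2 = (2 * pi * n%:R * y) * kfun n (ln (2 * pi * n%:R * y)) ^+ 2.
Proof.
move=> /pin_gt0 a0 y0; have ay : 0 < 2 * pi * n%:R * y by rewrite mulr_gt0.
have e : 2 * pi * n%:R * y / (2 * pi * n%:R) = y by rewrite mulrAC mulfV ?gt_eqF// mul1r.
rewrite /kfun lnK ?posrE// e exprMn -expRM_natl.
have -> : 2 * - (ln (2 * pi * n%:R * y) / 2) = - ln (2 * pi * n%:R * y) by field.
by rewrite expRN lnK ?posrE// mulrA mulfV ?gt_eqF// mul1r.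
Qed.

(** Expand [0 <= I ((g - 2 c cosn n)^2)], where [c] is the coefficient. *)
Lemma coef_sqr_le n y : (0 < n)%N -> 0 < y ->
  coef n y ^+ 2 <= I (fun x => f (x, y) ^+ 2) / 2.
Proof.
move=> n0 y0; pose g x := f (x, y); pose c := coef n y.
have cg : continuous g by exact: form_slice_continuous.
have cc := @continuous_cosn R n.
have cgg : continuous (fun x => g x * g x) by exact: continuous_mul.
have cgc : continuous (fun x => g x * cosn n x) by exact: continuous_mul.
have ccc : continuous (fun x => cosn n x * cosn n x) by exact: continuous_mul.
have cs (b : R) h : continuous h -> continuous (fun x => b * h x).
  by move=> ch; exact: (continuous_mul (@continuous_const R b) ch).
have : 0 <= I (fun x => (g x * g x - (4 * c) * (g x * cosn n x)) -
      (- 4 * c ^+ 2) * (cosn n x * cosn n x)).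
  rewrite -{1}(unit_integral_cst (0 : R)); apply: unit_integral_le.
  - exact: continuous_const.
  - by do 2 (apply: continuous_sub; last exact: cs).
  - by move=> x _; have := sqr_ge0 (g x - 2 * c * cosn n x); nra.
rewrite unit_integralB; [|apply: continuous_sub => //; exact: cs|exact: cs].
rewrite unit_integralB//; last exact: cs.
rewrite !unit_integralZ// cosn_orthogonal// eqxx -[I (fun x => g x * cosn n x)]/c.
have -> : I (fun x => f (x, y) ^+ 2) = I (fun x => g x * g x).
  by congr I; apply/funext => x; rewrite expr2.
by rewrite -/c; nra.
Qed.

(** Such growth means [coef^2 >= c y^2] high in the cusp, so the hyperbolic mass has density at
    least [c] in [y] there; a strip of height [2 / c] would then carry mass at least [2], more than
    the whole norm. *)
Lemma kfun_nongrowing n : (0 < n)%N ->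
  ~ exists c S : R, 0 < c /\ forall s, S <= s -> c * expR (2 * s) <= kfun n s ^+ 2.
Proof.
move=> n0 [c [S [c0 hS]]]; have a0 := pin_gt0 n0.
have a1 : 1 <= 2 * pi * n%:R :> R.
  have : 1 <= n%:R :> R by rewrite ler1n.
  have := pi_ge2 R; nra.
pose Y := Num.max 1 (expR S / (2 * pi * n%:R)).
have Y1 : 1 <= Y by rewrite le_max lexx.
have : c * (2 / c) <= 1.
  apply: (petersson_rectangle mphi Y1) => //; [by rewrite divr_ge0// ltW|exact: ltW|].
  move=> y /andP[Yy _]; have y1 : 1 <= y by exact: le_trans Yy.
  have y0 : 0 < y by lra.
  have ay : 0 < 2 * pi * n%:R * y by rewrite mulr_gt0.
  rewrite ler_pdivlMr ?exprn_gt0//.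
  apply: le_trans (coef_sqr_le n0 y0); rewrite coef_kfun//.
  have Ss : S <= ln (2 * pi * n%:R * y).
    rewrite -[S]expRK ler_ln ?posrE ?expR_gt0// mulrC -ler_pdivrMr//.
    by apply: le_trans Yy; rewrite le_max lexx orbT.
  apply: (@le_trans _ _ (2 * pi * n%:R * y * (c * (2 * pi * n%:R * y) ^+ 2))).
    have yay : y <= 2 * pi * n%:R * y by rewrite ler_peMl// ltW.
    move: (2 * pi * n%:R * y) ay yay => z z0 yz.
    have : y ^+ 2 <= z ^+ 2 by rewrite lerXn2r ?nnegrE ?(ltW z0) ?(ltW y0).
    move=> h; apply: (@le_trans _ _ (c * z ^+ 2)); first by rewrite ler_pM2l.
    by rewrite ler_peMl ?sqr_ge0 ?mulr_ge0 ?sqr_ge0 ?(ltW c0)//; lra.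
  rewrite ler_pM2l//; apply: le_trans (hS _ Ss).
  by rewrite expRM_natl lnK ?posrE.
by rewrite mulrCA mulfV ?gt_eqF//; lra.
Qed.

(** The [- 1] beside [2 * kap] is the loss from the factor [2 pi n y] in [coef_kfun]. *)
Lemma coef_decay n y ya kap : (0 < n)%N -> 0 < ya -> ya <= y -> 0 < kap ->
  kap ^+ 2 + t ^+ 2 <= (2 * pi * n%:R * ya) ^+ 2 ->
  coef n y ^+ 2 <= coef n ya ^+ 2 * expR (- ((2 * kap - 1) * ln (y / ya))).
Proof.
move=> n0 ya0 yay kap0 hk; have a0 := pin_gt0 n0.
have y0 : 0 < y by exact: lt_le_trans yay.
rewrite !coef_kfun//; move: (2 * pi * n%:R) a0 hk => a a0 hk.
have aya : 0 < a * ya by rewrite mulr_gt0.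
have ay : 0 < a * y by rewrite mulr_gt0.
have lnE : ln (a * y) - ln (a * ya) = ln (y / ya).
  by rewrite -ln_div ?posrE// invfM mulrACA mulfV ?gt_eqF// mul1r.
have := @sol_sqr_decay R (kfun n) (dkfun n) t (fun s => is_derive_kfun s n0)
  (fun s => is_derive_dkfun s n0) (kfun_nongrowing n0) (ln (a * ya)) kap (ln (a * y)) kap0.
rewrite expRM_natl lnK ?posrE// lnE => /(_ _ _) h.
have {}h : kfun n (ln (a * y)) ^+ 2 <= kfun n (ln (a * ya)) ^+ 2 * expR (- (2 * kap * ln (y / ya))).
  by apply: h; [lra|rewrite ler_ln ?posrE// ler_pM2l].
apply: (@le_trans _ _ (a * y * (kfun n (ln (a * ya)) ^+ 2 * expR (- (2 * kap * ln (y / ya)))))).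
  by rewrite ler_pM2l.
have -> : - ((2 * kap - 1) * ln (y / ya)) = ln (y / ya) + - (2 * kap * ln (y / ya)) by ring.
rewrite expRD lnK ?posrE ?divr_gt0// le_eqVlt; apply/orP; left; apply/eqP.
by field; rewrite gt_eqF.
Qed.

(** The hypothesis is what [coef_decay] yields with [2 kap = b n] when the height at least doubles,
    whence [ln 2]. The constant [7] comes from [2 * 4! = 48 <= 49]. *)
Lemma exp_decay_inv_sqr (B b x : R) n : (0 < n)%N -> 0 <= B -> 0 < b ->
  x ^+ 2 <= B ^+ 2 * expR (- ((b * n%:R - 1) * ln 2)) ->
  `|x| <= 7 * B / (b * ln 2) ^+ 2 / n%:R ^+ 2.
Proof.
move=> n0 B0 b0 hx.
have ln20 : 0 < ln 2 :> R by rewrite ln_gt0// ltr1n.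
have nR : 0 < n%:R :> R by rewrite ltr0n.
have z0 : 0 < b * ln 2 * n%:R by rewrite !mulr_gt0.
have -> : 7 * B / (b * ln 2) ^+ 2 / n%:R ^+ 2 = 7 * B / (b * ln 2 * n%:R) ^+ 2.
  by field; rewrite !gt_eqF.
have z2 : 0 < (b * ln 2 * n%:R) ^+ 2 by rewrite exprn_gt0.
have c0 : 0 <= 7 * B / (b * ln 2 * n%:R) ^+ 2 by apply: divr_ge0; [exact: mulr_ge0|exact: ltW].
rewrite -ler_sqr ?nnegrE// real_normK ?num_real//.
apply: (le_trans hx).
have -> : - ((b * n%:R - 1) * ln 2) = ln 2 + - (b * ln 2 * n%:R) by ring.
rewrite expRD lnK ?posrE//.
apply: (@le_trans _ _ (B ^+ 2 * (2 * (4`!%:R / (b * ln 2 * n%:R) ^+ 4)))).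
  by rewrite ler_wpM2l ?sqr_ge0// ler_pM2l//; exact: expRN_le_pow.
move: (b * ln 2 * n%:R) z0 z2 => z z0 z2.
have -> : (7 * B / z ^+ 2) ^+ 2 = B ^+ 2 * (49 / z ^+ 4) by field; rewrite gt_eqF.
rewrite ler_wpM2l ?sqr_ge0// mulrA ler_pM2r ?invr_gt0 ?exprn_gt0//.
by rewrite -natrM ler_nat.
Qed.

(** Frequencies past [2 t / b] decay over the doubling from [y / 2] to [y]; the finitely many others
    are absorbed by enlarging [D]. *)
Lemma coef_summable y : 0 < y ->
  exists2 D, 0 <= D & forall n, (0 < n)%N -> `|coef n y| <= D / n%:R ^+ 2.
Proof.
move=> y0; have y20 : 0 < y / 2 by rewrite divr_gt0.
have [B B0 hB] := @bounded_rectangle R f (y / 2) y form_continuous y20 ltac:(lra).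
have cB n z : y / 2 <= z <= y -> `|coef n z| <= B.
  move=> zz; apply: cos_coef_norm_le; last by move=> x xx; exact: hB.
  by apply: form_slice_continuous; have /andP[? _] := zz; exact: lt_le_trans y20 _.
pose b : R := pi * y.
have b0 : 0 < b by rewrite mulr_gt0 ?pi_gt0.
have t0 := maass_spectral_gt0 mphi.
have ln20 : 0 < ln 2 :> R by rewrite ln_gt0// ltr1n.
exists (B * (2 * t / b) ^+ 2 + 7 * B / (b * ln 2) ^+ 2).
  apply: addr_ge0; first by apply: mulr_ge0 => //; exact: sqr_ge0.
  by apply: divr_ge0; [exact: mulr_ge0|exact: sqr_ge0].
move=> n n0; have nR : 0 < n%:R :> R by rewrite ltr0n.
have nR2 : 0 < n%:R ^+ 2 :> R by rewrite exprn_gt0.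
rewrite mulrDl; have [hn|hn] := leP (2 * t / b) n%:R.
  apply: (@le_trans _ _ (7 * B / (b * ln 2) ^+ 2 / n%:R ^+ 2)); last first.
    by rewrite lerDr; apply: divr_ge0 (sqr_ge0 _); apply: mulr_ge0 => //; exact: sqr_ge0.
  apply: exp_decay_inv_sqr => //.
  have kap0 : 0 < b * n%:R / 2 by apply: divr_gt0 => //; exact: mulr_gt0.
  have := @coef_decay n y (y / 2) (b * n%:R / 2) n0 y20 ltac:(lra) kap0 _.
  have -> : y / (y / 2) = 2 by field; rewrite gt_eqF.
  have -> : 2 * (b * n%:R / 2) - 1 = b * n%:R - 1 by field.
  have -> : 2 * pi * n%:R * (y / 2) = b * n%:R by rewrite /b; field.
  move=> h; apply: (le_trans (h _)).
    have : 2 * t <= b * n%:R by rewrite [leRHS]mulrC -ler_pdivrMr.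
    move: (b * n%:R) => z hz.
    have : (2 * t) ^+ 2 <= z ^+ 2 by rewrite lerXn2r ?nnegrE//; lra.
    by have := sqr_ge0 z; nra.
  rewrite ler_wpM2r ?expR_ge0// -(real_normK (num_real (coef n (y / 2)))).
  by rewrite lerXn2r ?nnegrE// cB// lexx; lra.
apply: (@le_trans _ _ (B * (2 * t / b) ^+ 2 / n%:R ^+ 2)); last first.
  by rewrite lerDl; apply: divr_ge0 (ltW nR2); apply: divr_ge0 (sqr_ge0 _); exact: mulr_ge0.
apply: (@le_trans _ _ B); first by apply: cB; rewrite lexx andbT; lra.
rewrite ler_pdivlMr// ler_wpM2l// lerXn2r ?nnegrE ?(ltW nR)//; last exact: ltW.
by apply: divr_ge0 (ltW b0); apply: mulr_ge0 (ltW t0).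
Qed.

Lemma form_fourier y D : 0 < y -> 0 <= D ->
  (forall n, (0 < n)%N -> `|coef n y| <= D / n%:R ^+ 2) ->
  forall N x, 0 <= x <= 1 ->
    `|f (x, y) - cos_sum (coef ^~ y) N.+1 x| <= 2 * D / N.+1%:R.
Proof.
move=> y0 D0 hD N x x01.
apply: (@cos_inversion R (fun x => f (x, y)) D) => //.
- exact: form_slice_continuous.
- by move=> u; rewrite (form_sym mphi).
- rewrite /cos_coef; under eq_fun do rewrite cosn0 mulr1.
  by rewrite /unit_integral /Rintegral (maass_cuspidal mphi y0).
Qed.

(** Comparing with the fixed height [1 + t], at rate [kap = n], makes the coefficient bound uniform
    in [y]. *)
Lemma form_cusp_bounded : exists M, forall x y, 0 <= x <= 1 -> 2 * (1 + t) <= y ->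
  `|f (x, y)| <= M.
Proof.
have t0 := maass_spectral_gt0 mphi.
have ln20 : 0 < ln 2 :> R by rewrite ln_gt0// ltr1n.
have ya0 : 0 < 1 + t by lra.
have [B B0 hB] := @bounded_rectangle R f (1 + t) (1 + t) form_continuous ya0 (lexx _).
pose D := 7 * B / (2 * ln 2) ^+ 2.
have D0 : 0 <= D by rewrite /D divr_ge0 ?sqr_ge0 ?mulr_ge0 ?sqr_ge0.
exists (4 * D) => x y x01 yh.
have y0 : 0 < y by lra.
have hD n : (0 < n)%N -> `|coef n y| <= D / n%:R ^+ 2.
  move=> n0; apply: exp_decay_inv_sqr => //.
  have n1 : 1 <= n%:R :> R by rewrite ler1n.
  have nR : 0 < n%:R :> R by rewrite ltr0n.
  have cond : n%:R ^+ 2 + t ^+ 2 <= (2 * pi * n%:R * (1 + t)) ^+ 2.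
    apply: (@le_trans _ _ ((n%:R * (1 + t)) ^+ 2)).
      have -> : (n%:R * (1 + t)) ^+ 2 = n%:R ^+ 2 + 2 * (n%:R ^+ 2 * t) + n%:R ^+ 2 * t ^+ 2 by ring.
      have : t ^+ 2 <= n%:R ^+ 2 * t ^+ 2 by rewrite ler_peMl ?sqr_ge0// exprn_ege1.
      have : 0 <= n%:R ^+ 2 * t by apply: mulr_ge0 (ltW t0); exact: sqr_ge0.
      by lra.
    rewrite lerXn2r ?nnegrE ?mulr_ge0 ?pi_ge0 ?(ltW nR) ?(ltW ya0)//.
    rewrite ler_pM2r// ler_peMl ?(ltW nR)//; have := pi_ge2 R; lra.
  have yay : 1 + t <= y by lra.
  apply: (le_trans (coef_decay n0 ya0 yay nR cond)).
  apply: ler_pM; rewrite ?sqr_ge0 ?expR_ge0//.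
    rewrite -(real_normK (num_real (coef n (1 + t)))) lerXn2r ?nnegrE//.
    apply: cos_coef_norm_le; first exact: form_slice_continuous.
    by move=> u u01; apply: hB => //; rewrite lexx.
  rewrite ler_expR lerN2 ler_wpM2l//; first by lra.
  by rewrite ler_ln ?posrE ?divr_gt0// ler_pdivlMr.
have := form_fourier y0 D0 hD 0 x01; rewrite divr1 => h.
have : `|cos_sum (coef ^~ y) 1 x| <= 2 * D.
  rewrite /cos_sum big_seq1 normrM -[leRHS]mulr1 ler_pM// ?normr_cosn_le1//.
  by rewrite normrM ger0_norm// ler_pM2l//; have := hD 1%N isT; rewrite expr1n divr1.
have -> : f (x, y) = (f (x, y) - cos_sum (coef ^~ y) 1 x) + cos_sum (coef ^~ y) 1 x by ring.
by move=> h2; apply: (le_trans (ler_normD _ _)); lra.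
Qed.

Lemma form_bounded : exists M, forall x y, 0 < y -> `|f (x, y)| <= M.
Proof.
have t0 := maass_spectral_gt0 mphi.
have [M1 h1] := form_cusp_bounded.
have [M2 M20 h2] := @bounded_rectangle R f 2^-1 (2 * (1 + t)) form_continuous ltac:(lra) ltac:(lra).
exists (Num.max M1 M2) => x y y0.
have [[x' y'] /= [x'1 y'h] ->] := form_high_representative mphi x y0.
rewrite le_max; have [h|/ltW h] := leP (2 * (1 + t)) y'; first by rewrite h1.
by rewrite h2 ?orbT// y'h.
Qed.

Lemma form_neq0 : exists p : R * R, 0 < p.2 /\ f p != 0.
Proof.
apply: contrapT => hn.
have f0 p : 0 < p.2 -> f p = 0.
  by move=> p0; apply/eqP; apply: contrapT => /negP h; apply: hn; exists p.
have := maass_normalized mphi; rewrite /petersson_norm2.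
rewrite integral0_eq; first by move=> /eqP; rewrite eq_sym onee_eq0.
move=> p [p0 _ _]; have := f0 p p0; rewrite /in_coordinates => ->.
by rewrite expr0n/= mul0r.
Qed.

(** A positive least upper bound is what bounds Hecke eigenvalues: it is compared with itself after
    applying a Hecke operator. *)
Lemma form_sup : exists2 Phi, 0 < Phi & (forall x y, 0 < y -> `|f (x, y)| <= Phi) /\
  (forall M, (forall x y, 0 < y -> `|f (x, y)| <= M) -> Phi <= M).
Proof.
pose A := [set r | exists p : R * R, 0 < p.2 /\ r = `|f p|].
have [M hM] := form_bounded.
have Aub : has_ubound A by exists M => _ [[x y] [/= y0 ->]]; exact: hM.
have [p [p0 fp]] := form_neq0.
have Ap : A `|f p| by exists p.
have h1 x y : 0 < y -> `|f (x, y)| <= sup A by move=> y0; apply: ub_le_sup => //; exists (x, y).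
exists (sup A); first by apply: lt_le_trans (ub_le_sup Aub Ap); rewrite normr_gt0.
split => // M' hM'; apply: ge_sup; first by exists `|f p|.
by move=> _ [[x y] [/= y0 ->]]; exact: hM'.
Qed.

End FourierCoefficients.

(** * Hecke operators acting on Fourier coefficients *)

Lemma unit_representative (R : realType) (x : R) : exists2 x' : R, 0 <= x' <= 1 &
  forall h : R -> R, (forall u, h (u + 1) = h u) -> (forall u, h (- u) = h u) -> h x = h x'.
Proof.
wlog x0 : x / 0 <= x.
  move=> H; have [|/ltW xn] := leP 0 x; first exact: H.
  have [|x' x'1 e] := H (- x); first by rewrite oppr_ge0.
  by exists x' => // h h1 h2; rewrite -(e h h1 h2) h2.
exists (x - (Num.truncn x)%:R).
  have /andP[h1 h2] := truncn_itv x0; rewrite -natr1 in h2.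
  by apply/andP; split; lra.
move=> h h1 _; rewrite -[in LHS](subrK (Num.truncn x)%:R x).
move: (Num.truncn x) => n; elim: n (x - _) => [|n IH] u; first by rewrite addr0.
by rewrite -[n.+1]addn1 natrD addrA h1 IH.
Qed.

(** Multiplication by [sin (al / 2)], with [al = 2 pi j / d], makes the sum telescope, and that sine
    vanishes only if [d] divides [j]. *)
Lemma sum_cos_arith (R : realType) (th : R) (j d : nat) : (0 < d)%N ->
  \sum_(b < d) cos (th + 2 * pi * j%:R * b%:R / d%:R) =
    if (d %| j)%N then d%:R * cos th else 0.
Proof.
move=> d0; have dR : 0 < d%:R :> R by rewrite ltr0n.
have dN : d%:R != 0 :> R by rewrite gt_eqF.
case: ifPn => dj.
  rewrite (eq_bigr (fun=> cos th)); last first.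
    move=> b _; have /dvdnP[k ->] := dj; rewrite natrM.
    have -> : th + 2 * pi * (k%:R * d%:R) * b%:R / d%:R = th + 2 * pi * (k * b)%N%:R.
      by rewrite natrM; field.
    by rewrite cosD cos_2pin sin_2pin mulr1 mulr0 subr0.
  by rewrite sumr_const card_ord mulr_natl.
pose al : R := 2 * pi * j%:R / d%:R.
have s0 : sin (al / 2) != 0.
  pose q := (j %/ d)%N; pose r := (j %% d)%N.
  have r0 : (0 < r)%N by rewrite lt0n.
  have rd : (r < d)%N by rewrite ltn_mod.
  have jE : j%:R = q%:R * d%:R + r%:R :> R by rewrite {1}(divn_eq j d) natrD natrM.
  have -> : al / 2 = pi * r%:R / d%:R + q%:R * pi by rewrite /al jE; field.
  have sinDn (z : R) n : `|sin (z + n%:R * pi)| = `|sin z|.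
    elim: n => [|n IH]; first by rewrite mul0r addr0.
    by rewrite -[n.+1]addn1 natrD mulrDl mul1r addrA sinDpi normrN.
  rewrite -normr_eq0 sinDn normr_eq0 gt_eqF//; apply: sin_gt0_pi.
  have rR : 0 < r%:R :> R by rewrite ltr0n.
  have p0 := pi_gt0 R.
  rewrite divr_gt0 ?mulr_gt0//= ltr_pdivrMr// ltr_pM2l// ltr_nat//.
apply: (mulfI s0); rewrite mulr0 mulr_sumr.
have tel (n : nat) : \sum_(b < n) sin (al / 2) * cos (th + 2 * pi * j%:R * b%:R / d%:R) =
   2^-1 * (sin (th + al * n%:R - al / 2) - sin (th - al / 2)).
  elim: n => [|n IH]; first by rewrite big_ord0 mulr0 addr0 subrr mulr0.
  rewrite big_ord_recr/= IH.
  have -> : th + 2 * pi * j%:R * n%:R / d%:R = th + al * n%:R by rewrite /al; field.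
  have -> : th + al * n.+1%:R - al / 2 = th + al * n%:R + al / 2.
    by rewrite -[n.+1]addn1 natrD; field.
  set Z := sin (th - al / 2).
  by rewrite (sinB (th + al * n%:R)) (sinD (th + al * n%:R)); field.
rewrite tel.
have -> : th + al * d%:R - al / 2 = th - al / 2 + 2 * pi * j%:R by rewrite /al; field.
by rewrite sinD cos_2pin sin_2pin mulr1 mulr0 addr0 subrr mulr0.
Qed.

Section Hecke.
Context (R : realType) (t : R) (phi : R[i] -> R).
Hypothesis mphi : even_hecke_maass_cusp_form t phi.
Implicit Types (n m : nat) (x y : R).

Local Notation f := (in_coordinates phi).
Local Notation coef := (coef phi).

Lemma form_fourier_all y D : 0 < y -> 0 <= D ->
  (forall n, (0 < n)%N -> `|coef n y| <= D / n%:R ^+ 2) ->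
  forall N x, `|f (x, y) - cos_sum (coef ^~ y) N.+1 x| <= 2 * D / N.+1%:R.
Proof.
move=> y0 D0 hD N x; have [x' x'1 hx] := unit_representative x.
rewrite (hx (fun x => f (x, y) - cos_sum (coef ^~ y) N.+1 x)).
- exact: (form_fourier mphi).
- move=> u; rewrite (form_periodic mphi)//; congr (_ - _).
  by apply: eq_bigr => n _; rewrite cosnD1.
- move=> u; rewrite (form_even mphi)//; congr (_ - _).
  by apply: eq_bigr => n _; rewrite cosnN.
Qed.

(** Summing over [b] keeps only the frequencies [j] divisible by [d], which become [a j / d];
    matching with [m] leaves at most [j = d m / a]. *)
Lemma cos_coef_dilate (a d m : nat) y : (0 < a)%N -> (0 < d)%N -> (0 < m)%N -> 0 < y ->
  cos_coef (fun x => \sum_(b < d) f ((a%:R * x + b%:R) / d%:R, y)) m =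
  if (a %| m)%N then d%:R * coef (d * (m %/ a))%N y else 0.
Proof.
move=> a0 d0 m0 y0; have dR : 0 < d%:R :> R by rewrite ltr0n.
have [D D0 hD] := coef_summable mphi y0.
have caff b : continuous (fun x : R => (a%:R * x + b) / d%:R).
  move=> x; apply: cvgM; last exact: cvg_cst.
  by apply: cvgD; [apply: cvgM; [exact: cvg_cst|exact: cvg_id]|exact: cvg_cst].
have cT (g : R -> R) : continuous g ->
    continuous (fun x => \sum_(b < d) g ((a%:R * x + b%:R) / d%:R)).
  move=> cg; have [] // := @unit_integral_sum R 'I_d (index_enum 'I_d)
    (fun b x => g ((a%:R * x + b%:R) / d%:R)) _.
  move=> b x; apply: (@continuous_comp _ _ _ (fun x : R => (a%:R * x + b%:R) / d%:R) g).
    exact: caff.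
  exact: cg.
apply/eqP; rewrite -subr_eq0; apply/eqP.
(* The series is truncated with error [2 D / (N + 1)] in each of the [d] summands; [N >= d * m]
   ensures that the one surviving frequency is retained. *)
apply: (@le_div_nat_eq0 _ _ (d%:R * (2 * D)) (d * m)) => N hN.
pose S := cos_sum (coef ^~ y) N.+1.
have cS : continuous S by exact: continuous_cos_sum.
have cf := form_slice_continuous mphi y0.
suff -> : (if (a %| m)%N then d%:R * coef (d * (m %/ a))%N y else 0) =
   cos_coef (fun x => \sum_(b < d) S ((a%:R * x + b%:R) / d%:R)) m.
  rewrite -(cos_coefB _ (cT _ cf) (cT _ cS)).
  apply: cos_coef_norm_le.
    exact: (continuous_sub (cT _ cf) (cT _ cS)).
  move=> x _; rewrite -sumrB; apply: (le_trans (ler_norm_sum _ _ _)).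
  apply: (@le_trans _ _ (\sum_(b < d) 2 * D / N.+1%:R)).
    by apply: ler_sum => b _; exact: form_fourier_all.
  by rewrite sumr_const card_ord -[leLHS]mulr_natl mulrA.
have -> : (fun x => \sum_(b < d) S ((a%:R * x + b%:R) / d%:R)) =
   (fun x => \sum_(j <- iota 1 N.+1) (if (d %| j)%N then 2 * coef j y * d%:R else 0) *
       cosn ((j %/ d) * a) x).
  apply/funext => x; rewrite /S /cos_sum exchange_big/=; apply: eq_bigr => j _.
  rewrite -mulr_sumr.
  have -> : \sum_(b < d) cosn j ((a%:R * x + b%:R) / d%:R) =
     \sum_(b < d) cos (2 * pi * j%:R * a%:R * x / d%:R + 2 * pi * j%:R * b%:R / d%:R).
    by apply: eq_bigr => b _; rewrite /cosn; congr cos; field; rewrite gt_eqF.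
  rewrite sum_cos_arith//; case: ifPn => dj; last by rewrite mulr0 mul0r.
  have -> : 2 * pi * j%:R * a%:R * x / d%:R = 2 * pi * ((j %/ d) * a)%N%:R * x.
    by rewrite natrM -{1}(divnK dj) natrM; field; rewrite gt_eqF.
  by rewrite /cosn mulrA.
rewrite /cos_coef; under eq_fun do rewrite mulr_suml.
pose w j : R := if (d %| j)%N then 2 * coef j y * d%:R else 0.
have cc j : continuous (fun x : R => w j * cosn (j %/ d * a) x * cosn m x).
  apply: continuous_mul; last exact: continuous_cosn.
  exact: (continuous_mul (@continuous_const R _) (@continuous_cosn R _)).
have [_ ->] := unit_integral_sum (iota 1 N.+1) cc.
rewrite (eq_big_seq (fun j => if (d %| j)%N && (j %/ d * a == m)%N then coef j y * d%:R else 0)); last first.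
  move=> j; rewrite mem_iota => /andP[j0 _]; rewrite /w.
  case: (boolP (d %| j)%N) => dj /=; last first.
    under eq_fun do rewrite mul0r mul0r.
    by rewrite unit_integral_cst.
  under eq_fun do rewrite -mulrA.
  rewrite unit_integralZ; last by apply: continuous_mul; exact: continuous_cosn.
  rewrite cosn_orthogonal//; last by rewrite muln_gt0 a0 andbT divn_gt0// dvdn_leq.
  by case: ifP => _; [field|rewrite mulr0].
have ms : (a %| m)%N -> (d * (m %/ a))%N \in iota 1 N.+1.
  move=> am; rewrite mem_iota muln_gt0 d0 divn_gt0// dvdn_leq// add1n ltnS/=.
  apply: leqW; apply: leq_trans hN; rewrite leq_mul2l; apply/orP; right; exact: leq_div.
move: (iota 1 N.+1) (iota_uniq 1 N.+1) ms => s us ms.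
case: ifPn => am.
  rewrite -big_mkcond/= (big_rem _ (ms am))/=.
  rewrite dvdn_mulr// mulKn// divnK// eqxx/= big1_seq ?addr0 1?mulrC// => j.
  rewrite mem_rem_uniq// inE => /andP[/andP[dj /eqP jm] /andP[/eqP jn _]].
  by exfalso; apply: jn; rewrite -jm mulnK// mulnC divnK.
rewrite big1// => j _; case: ifP => // /andP[_ /eqP jm].
by move: am; rewrite -jm dvdn_mull.
Qed.

Lemma hecke_coordinates n x y : 0 < y -> (0 < n)%N ->
  hecke_operator n phi (x +i* y) = (Num.sqrt n%:R)^-1 *
    \sum_(d <- divisors n) \sum_(b < d)
      f (((n %/ d)%N%:R * x + b%:R) / d%:R, (n %/ d)%N%:R * y / d%:R).
Proof.
move=> y0 n0; rewrite /hecke_operator; congr (_ * _); apply: eq_big_seq => d.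
rewrite -dvdn_divisors// => dn; have d0 := dvdn_gt0 n0 dn.
have dR : d%:R != 0 :> R by rewrite pnatr_eq0 -lt0n.
apply: eq_bigr => b _; rewrite /in_coordinates/=; congr phi.
have cn (k : nat) : k%:R = (k%:R : R) +i* 0 :> R[i].
  by rewrite -[RHS]/((k%:R : R)%:C) rmorph_nat.
have -> : (d%:R : R[i])^-1 = (d%:R^-1 : R) +i* 0.
  by rewrite -[RHS]/((d%:R^-1 : R)%:C) fmorphV rmorph_nat.
rewrite !cn; apply/eqP; rewrite eq_complex/= !mul0r !mulr0 !subr0 !addr0 !add0r.
by rewrite !eqxx.
Qed.

Lemma hecke_coef n (la : R) : (0 < n)%N ->
  (forall z, upper_half_plane z -> hecke_operator n phi z = la * phi z) ->
  forall m y, (0 < m)%N -> 0 < y ->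
  (Num.sqrt n%:R)^-1 * \sum_(d <- divisors n)
     (if (n %/ d %| m)%N then d%:R * coef (d * (m %/ (n %/ d)))%N ((n %/ d)%N%:R * y / d%:R) else 0)
  = la * coef m y.
Proof.
move=> n0 hla m y m0 y0.
(* The value [1] off the divisors keeps every height positive, hence every [g d] continuous. *)
pose eta d : R := if (d \in divisors n) then (n %/ d)%N%:R * y / d%:R else 1.
have eta0 d : 0 < eta d.
  rewrite /eta; case: ifP => //; rewrite -dvdn_divisors// => dn.
  have d0 := dvdn_gt0 n0 dn.
  by rewrite divr_gt0 ?mulr_gt0 ?ltr0n// divn_gt0// dvdn_leq.
pose g d x : R := \sum_(b < d) f (((n %/ d)%N%:R * x + b%:R) / d%:R, eta d).
have cg d : continuous (g d).
  have [] // := @unit_integral_sum R 'I_d (index_enum 'I_d)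
    (fun b x => f (((n %/ d)%N%:R * x + b%:R) / d%:R, eta d)) _.
  move=> b x; apply: (@continuous_comp _ _ _ (fun x : R => ((n %/ d)%N%:R * x + b%:R) / d%:R)
    (fun x => f (x, eta d))); last exact: (form_slice_continuous mphi (eta0 d)).
  apply: cvgM; last exact: cvg_cst.
  by apply: cvgD; [apply: cvgM; [exact: cvg_cst|exact: cvg_id]|exact: cvg_cst].
have E x : la * f (x, y) = (Num.sqrt n%:R)^-1 * \sum_(d <- divisors n) g d x.
  rewrite -hla// hecke_coordinates//; congr (_ * _); apply: eq_big_seq => d dn.
  by rewrite /g /eta dn.
have : cos_coef (fun x => la * f (x, y)) m = la * coef m y.
  rewrite /cos_coef; under eq_fun do rewrite -mulrA.
  rewrite unit_integralZ//; apply: continuous_mul; last exact: continuous_cosn.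
  exact: (form_slice_continuous mphi).
move=> <-; under [in RHS]eq_fun do rewrite E.
rewrite /cos_coef.
under [in RHS]eq_fun do rewrite -mulrA mulr_suml.
have cgc d : continuous (fun x => g d x * cosn m x).
  by apply: continuous_mul => //; exact: continuous_cosn.
have [cs Is] := unit_integral_sum (divisors n) cgc.
rewrite unit_integralZ// Is; congr (_ * _); apply: eq_big_seq => d dn.
have dn' : (d %| n)%N by rewrite dvdn_divisors.
have d0 := dvdn_gt0 n0 dn'.
have a0 : (0 < n %/ d)%N by rewrite divn_gt0// dvdn_leq.
rewrite -[RHS]/(cos_coef (g d) m) /g cos_coef_dilate//.
by rewrite /eta dn.
Qed.

(** Hecke operators express every coefficient through the first one, so its vanishing would kill the
    whole expansion, against the normalization. *)
Lemma coef1_neq0 : exists2 y, 0 < y & coef 1 y != 0.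
Proof.
apply: contrapT => hn.
have c0 y : 0 < y -> coef 1 y = 0.
  by move=> y0; apply/eqP; apply: contrapT => /negP h; apply: hn; exists y.
have [[x y] /= [y0 /eqP]] := form_neq0 mphi; apply.
have cn n : (0 < n)%N -> coef n y = 0.
  move=> n0; have nR : 0 < n%:R :> R by rewrite ltr0n.
  have [la hla] := maass_hecke mphi n0.
  have ny : 0 < n%:R * y by rewrite mulr_gt0.
  have := hecke_coef n0 hla (isT : (0 < 1)%N) ny; rewrite c0// mulr0.
  rewrite (big_rem n)/=; last by rewrite -dvdn_divisors.
  rewrite divnn n0 dvd1n divn1 muln1 mul1r mulrAC mulfV ?gt_eqF// mul1r.
  rewrite big1_seq ?addr0; last first.
    move=> d; rewrite mem_rem_uniq ?divisors_uniq// inE -dvdn_divisors// => /andP[_ /andP[dn ddn]].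
    case: ifPn => //; rewrite dvdn1 => /eqP nd1.
    by move: dn; rewrite -(divnK ddn) nd1 mul1n eqxx.
  move=> /eqP; rewrite mulf_eq0 invr_eq0 sqrtr_eq0 leNgt nR/= mulf_eq0 gt_eqF//=.
  by move=> /eqP.
have [D D0 hD] := coef_summable mphi y0.
apply: (@le_div_nat_eq0 _ _ (2 * D) 0) => N _.
have := form_fourier_all y0 D0 hD N x; rewrite /cos_sum big1_seq ?subr0//.
by move=> n; rewrite mem_iota => /andP[_ /andP[n0 _]]; rewrite cn// mulr0 mul0r.
Qed.

Lemma perm_codivisors n : (0 < n)%N ->
  perm_eq (divisors n) [seq (n %/ d)%N | d <- divisors n].
Proof.
move=> n0; rewrite perm_sym; apply: uniq_perm; last first.
- move=> e; apply/mapP/idP => [[d]|].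
    by rewrite -!dvdn_divisors// => dn ->; apply/dvdnP; exists d; rewrite mulnC divnK.
  rewrite -dvdn_divisors// => en; exists (n %/ e)%N; rewrite -?dvdn_divisors//.
    by apply/dvdnP; exists e; rewrite mulnC divnK.
  have e0 := dvdn_gt0 n0 en.
  by rewrite -{1}(divnK en) mulKn// divn_gt0// dvdn_leq.
- exact: divisors_uniq.
- rewrite map_inj_in_uniq ?divisors_uniq// => d e; rewrite -!dvdn_divisors// => dn en E.
  have nd0 : (0 < n %/ d)%N by rewrite divn_gt0 ?(dvdn_gt0 n0 dn)// dvdn_leq.
  apply/eqP; rewrite -(eqn_pmul2l nd0) divnK// E divnK//.
Qed.

(** Taking [m = 1] in [hecke_coef] leaves only [d = n], which is the first relation; substituting it
    back for general [m] gives multiplicativity. The last bound compares sup norms: there are at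
    most [n] divisors, each with at most [n] translates. *)
Lemma hecke_eigenvalues : exists lam : nat -> R,
  [/\ forall n y, (0 < n)%N -> 0 < y ->
        coef n y = lam n / Num.sqrt n%:R * coef 1 (n%:R * y),
      forall m n, (0 < m)%N -> (0 < n)%N ->
        lam m * lam n = \sum_(d <- divisors (gcdn m n)) lam (m * n %/ d ^ 2)%N,
      lam 1%N = 1 &
      forall n, (0 < n)%N -> `|lam n| <= n%:R ^+ 2].
Proof.
have [lam hlam] : {lam : nat -> R & forall n, (0 < n)%N ->
    forall z, upper_half_plane z -> hecke_operator n phi z = lam n * phi z}.
  apply: (@choice nat R (fun n la => (0 < n)%N ->
    forall z, upper_half_plane z -> hecke_operator n phi z = la * phi z)) => -[|n].
    by exists 0.
  by have [la hla] := maass_hecke mphi (isT : (0 < n.+1)%N); exists la.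
have [u u0 cu] := coef1_neq0.
have h1 n y : (0 < n)%N -> 0 < y -> coef n y = lam n / Num.sqrt n%:R * coef 1 (n%:R * y).
  move=> n0 y0; have nR : 0 < n%:R :> R by rewrite ltr0n.
  have ny : 0 < n%:R * y by rewrite mulr_gt0.
  have := hecke_coef n0 (hlam n n0) (isT : (0 < 1)%N) ny.
  rewrite (big_rem n)/=; last by rewrite -dvdn_divisors.
  rewrite divnn n0 dvd1n divn1 muln1 mul1r mulrAC mulfV ?gt_eqF// mul1r.
  rewrite big1_seq ?addr0; last first.
    move=> d; rewrite mem_rem_uniq ?divisors_uniq// inE -dvdn_divisors// => /andP[_ /andP[dn ddn]].
    case: ifPn => //; rewrite dvdn1 => /eqP nd1.
    by move: dn; rewrite -(divnK ddn) nd1 mul1n eqxx.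
  have s0 : 0 < Num.sqrt n%:R :> R by rewrite sqrtr_gt0.
  have nE : n%:R = Num.sqrt n%:R * Num.sqrt n%:R :> R by rewrite -expr2 sqr_sqrtr// ltW.
  move=> E; have -> : lam n / Num.sqrt n%:R * coef 1 (n%:R * y) =
    (lam n * coef 1 (n%:R * y)) / Num.sqrt n%:R by rewrite mulrAC.
  rewrite -E {2}nE; field; rewrite gt_eqF//.
exists lam; split => //.
- move=> m n m0 n0; rewrite mulrC.
  have mR : 0 < m%:R :> R by rewrite ltr0n.
  have nR : 0 < n%:R :> R by rewrite ltr0n.
  (* At height [u / m] every coefficient involved reduces to a multiple of [coef 1 u], which is
     nonzero and cancels. *)
  have y0 : 0 < u / m%:R by rewrite divr_gt0.
  have sm : 0 < Num.sqrt m%:R :> R by rewrite sqrtr_gt0.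
  have sn : 0 < Num.sqrt n%:R :> R by rewrite sqrtr_gt0.
  have myu : m%:R * (u / m%:R) = u by rewrite mulrC divfK// gt_eqF.
  have := hecke_coef n0 (hlam n n0) m0 y0.
  rewrite [in RHS]h1// myu.
  have c0 : (Num.sqrt m%:R)^-1 * coef 1 u != 0 by rewrite mulf_neq0// invr_neq0// gt_eqF.
  have -> : lam n * (lam m / Num.sqrt m%:R * coef 1 u) =
    (lam n * lam m) * ((Num.sqrt m%:R)^-1 * coef 1 u) by ring.
  rewrite mulr_sumr => E; apply: (mulIf c0); rewrite -{}E mulr_suml.
  rewrite (perm_big _ (perm_codivisors n0))/= big_map.
  have -> : \sum_(d <- divisors (gcdn m n)) lam (m * n %/ d ^ 2)%N * ((Num.sqrt m%:R)^-1 * coef 1 u) =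
    \sum_(d <- divisors n | (d %| m)%N) lam (m * n %/ d ^ 2)%N * ((Num.sqrt m%:R)^-1 * coef 1 u).
    rewrite -[RHS]big_filter; apply: perm_big; apply: uniq_perm.
    - exact: divisors_uniq.
    - by rewrite filter_uniq ?divisors_uniq.
    - move=> d; rewrite mem_filter -!dvdn_divisors ?gcdn_gt0 ?m0//.
      by rewrite dvdn_gcd.
  rewrite [RHS]big_mkcond/=; apply: eq_big_seq => a; rewrite -dvdn_divisors// => an.
  have a0 := dvdn_gt0 n0 an.
  have nna : (n %/ (n %/ a) = a)%N.
    by rewrite -{1}(divnK an) mulKn// divn_gt0// dvdn_leq.
  rewrite nna; case: ifPn => am; last by rewrite mulr0.
  have aR : 0 < a%:R :> R by rewrite ltr0n.
  have na0 : (0 < n %/ a)%N by rewrite divn_gt0// dvdn_leq.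
  have ma0 : (0 < m %/ a)%N by rewrite divn_gt0// dvdn_leq.
  rewrite h1 ?muln_gt0 ?na0 ?ma0//; last by apply: divr_gt0; [apply: mulr_gt0|rewrite ltr0n].
  have jE : (n %/ a * (m %/ a))%N = (m * n %/ a ^ 2)%N.
    by rewrite -{2}(divnK am) -{2}(divnK an) mulnACA mulnn mulnK ?expn_gt0 ?a0// mulnC.
  have nE : n%:R = (n %/ a)%N%:R * a%:R :> R by rewrite -natrM divnK.
  have mE : m%:R = (m %/ a)%N%:R * a%:R :> R by rewrite -natrM divnK.
  have pR : 0 < (n %/ a)%N%:R :> R by rewrite ltr0n.
  have qR : 0 < (m %/ a)%N%:R :> R by rewrite ltr0n.
  have -> : (n %/ a * (m %/ a))%N%:R * (a%:R * (u / m%:R) / (n %/ a)%N%:R) = u.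
    by rewrite natrM {1}mE; field; rewrite !gt_eqF.
  rewrite jE -jE; have -> : Num.sqrt (n %/ a * (m %/ a))%N%:R =
      Num.sqrt n%:R * Num.sqrt m%:R / a%:R :> R.
    apply: (mulIf (lt0r_neq0 aR)); rewrite divfK ?gt_eqF//.
    rewrite -sqrtrM ?(ltW nR)// nE mE.
    have -> : (n %/ a)%:R * a%:R * ((m %/ a)%:R * a%:R) = (n %/ a * (m %/ a))%N%:R * a%:R ^+ 2 :> R.
      by rewrite natrM; ring.
    by rewrite sqrtrM// sqrtr_sqr gtr0_norm.
  have naE : (n %/ a)%N%:R = Num.sqrt n%:R ^+ 2 / a%:R :> R.
    by rewrite sqr_sqrtr ?(ltW nR)// nE mulfK// gt_eqF.
  rewrite naE jE; field.
  by rewrite !gt_eqF.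
- have := h1 1%N u isT u0; rewrite sqrtr1 divr1 mul1r => E.
  by apply: (mulIf cu); rewrite mul1r -E.
- move=> n n0; have nR : 0 < n%:R :> R by rewrite ltr0n.
  have n1 : 1 <= n%:R :> R by rewrite ler1n.
  have [Phi Phi0 [ub lub]] := form_sup mphi.
  have [->|l0] := eqVneq (lam n) 0; first by rewrite normr0 sqr_ge0.
  have l0' : 0 < `|lam n| by rewrite normr_gt0.
  (* The right side is shown to bound the form everywhere, and [Phi] is the least such bound. *)
  suff : Phi <= n%:R ^+ 2 * Phi / `|lam n|.
    by rewrite ler_pdivlMr// mulrC ler_pM2r.
  apply: lub => x y y0; rewrite ler_pdivlMr// mulrC -normrM.
  rewrite -[f (x, y)]/(phi (x +i* y)) -hlam// hecke_coordinates//.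
  have s1 : 1 <= Num.sqrt n%:R :> R by rewrite -{1}sqrtr1 ler_sqrt// ltW.
  have s0 : 0 < Num.sqrt n%:R :> R by exact: lt_le_trans s1.
  rewrite normrM gtr0_norm ?invr_gt0// ler_pdivrMl//.
  apply: (@le_trans _ _ (n%:R ^+ 2 * Phi)); last by rewrite ler_peMl// mulr_ge0 ?sqr_ge0 ?(ltW Phi0).
  apply: (le_trans (ler_norm_sum _ _ _)).
  apply: (@le_trans _ _ (\sum_(d <- divisors n) n%:R * Phi)).
    rewrite big_seq [leRHS]big_seq; apply: ler_sum => d; rewrite -dvdn_divisors// => dn.
    have d0 := dvdn_gt0 n0 dn.
    apply: (le_trans (ler_norm_sum _ _ _)).
    apply: (@le_trans _ _ (\sum_(b < d) Phi)).
      apply: ler_sum => b _; apply: ub.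
      by rewrite divr_gt0 ?mulr_gt0 ?ltr0n// divn_gt0// dvdn_leq.
    rewrite sumr_const card_ord -[leLHS]mulr_natl ler_pM2r// ler_nat.
    exact: dvdn_leq.
  rewrite big_const_seq count_predT iter_addr addr0 -[leLHS]mulr_natl mulrA ler_pM2r// expr2 ler_pM2r//.
  rewrite ler_nat; apply: (@leq_trans (size (iota 1 n))); last by rewrite size_iota.
  apply: uniq_leq_size; first exact: divisors_uniq.
  by move=> d; rewrite -dvdn_divisors// mem_iota add1n ltnS => dn; rewrite (dvdn_gt0 n0 dn) dvdn_leq.
Qed.

End Hecke.

(* [K] is the Bessel function K_{it}(e^s) normalized to be 1 at the turning
   point e^s = t, where t = tau ^+ 3. *)
Record bessel_profile (R : realType) (tau : R) (K : R -> R) : Prop := {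
  profile_gt0 : forall s, ln (tau ^+ 3) <= s -> 0 < K s <= 1 ;
  profile_turning : forall s,
    ln (tau ^+ 3) <= s <= ln (tau ^+ 3) + tau ^- 2 / 10 -> 2^-1 <= K s ;
  profile_decay : forall a kap s, 0 < kap ->
    kap ^+ 2 <= expR (2 * a) - (tau ^+ 3) ^+ 2 -> ln (tau ^+ 3) <= a -> a <= s ->
    K s <= expR (- (kap * (s - a))) ;
  profile_oscillatory : forall s, s <= ln (tau ^+ 3) ->
    K s ^+ 4 * ((tau ^+ 3) ^+ 2 - expR (2 * s)) <= (2000 * tau ^+ 2) ^+ 2 /\
    K s ^+ 2 <= 2000
}.

Lemma bessel_profileP (R : realType) (k dk : R -> R) (tau : R) : 2 <= tau ->
  (forall s : R, is_derive s 1 k (dk s)) ->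
  (forall s : R, is_derive s 1 dk ((expR (2 * s) - (tau ^+ 3) ^+ 2) * k s)) ->
  (~ exists c S : R, 0 < c /\ forall s, S <= s -> c * expR (2 * s) <= k s ^+ 2) ->
  k (ln (tau ^+ 3)) != 0 ->
  bessel_profile tau (fun s => k s / k (ln (tau ^+ 3))).
Proof.
move=> tau2 hk hdk hng k0; set k1 := k (ln _) in k0 *.
have t0 : 0 < tau ^+ 3 by rewrite exprn_gt0// (lt_le_trans _ tau2).
have s0E : expR (ln (tau ^+ 3)) = tau ^+ 3 by rewrite lnK ?posrE.
pose K s := k s / k1; pose dK s := dk s / k1.
have hK (s : R) : is_derive s 1 K (dK s).
  by have ? := hk s; apply: is_derive_eq; rewrite /GRing.scale/= /dK mulr0 add0r mulrC.
have hdK (s : R) : is_derive s 1 dK ((expR (2 * s) - (tau ^+ 3) ^+ 2) * K s).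
  by have ? := hdk s; apply: is_derive_eq; rewrite /GRing.scale/= /K mulr0 add0r; field.
have hnK : ~ exists c S : R, 0 < c /\ forall s, S <= s -> c * expR (2 * s) <= K s ^+ 2.
  move=> [c [S [c0 hS]]]; apply: hng; exists (c * k1 ^+ 2), S.
  have k12 : 0 < k1 ^+ 2 by rewrite exprn_even_gt0.
  split; first by rewrite mulr_gt0.
  move=> s /hS; rewrite /K expr_div_n ler_pdivlMr// mulrAC.
  by [].
have K1 : K (ln (tau ^+ 3)) = 1 by rewrite /K divff.
split.
- move=> s hs; apply/andP; split.
    exact: (bessel_gt0 tau2 s0E hK hdK hnK K1).
  exact: (bessel_le1 tau2 s0E hK hdK hnK K1).
- move=> s hs; exact: (bessel_near_turning tau2 s0E hK hdK hnK K1).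
- move=> a kap s h1 h2 h3 h4; exact: (bessel_decay tau2 s0E hK hdK hnK K1).
- move=> s hs; exact: (bessel_oscillatory tau2 s0E hK hdK hnK K1).
Qed.

(** * Sup norm of the form and a crude bound for its Hecke eigenvalues *)

Section FormData.
Context (R : realType) (tau : R) (phi : R[i] -> R).
Local Notation t := (tau ^+ 3).
Hypothesis mphi : even_hecke_maass_cusp_form t phi.
Hypothesis tau2 : 2 <= tau.

Local Notation f := (in_coordinates phi).

Let tau0 : 0 < tau. Proof. by apply: lt_le_trans tau2. Qed.
Let t8 : 8 <= t.
Proof.
have : 2 ^+ 3 <= tau ^+ 3 by rewrite lerXn2r ?nnegrE ?(ltW tau0).
by lra.
Qed.
Let t0 : 0 < t. Proof. by apply: lt_le_trans t8. Qed.

(** All coefficients come from the first one, hence from a single profile. It can be normalized at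
    the turning point: if [kfun] vanished there, [sol_eq0] would make the first coefficient vanish
    identically. *)
Lemma form_data : exists (lam : nat -> R) (K : R -> R) (k0 : R),
  [/\ k0 != 0, bessel_profile tau K,
      (forall n y, (0 < n)%N -> 0 < y ->
        coef phi n y = Num.sqrt (2 * pi * y) * k0 * (lam n * K (ln (2 * pi * n%:R * y)))),
      (forall m n, (0 < m)%N -> (0 < n)%N ->
        lam m * lam n = \sum_(d <- divisors (gcdn m n)) lam (m * n %/ d ^ 2)%N) &
      lam 1%N = 1 /\ (forall n, (0 < n)%N -> `|lam n| <= n%:R ^+ 2)].
Proof.
have [lam [h1 h2 h3 h4]] := hecke_eigenvalues mphi.
pose k := kfun phi 1.
have hk (s : R) : is_derive s 1 k (dkfun phi 1 s) by exact: (is_derive_kfun mphi).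
have hdk (s : R) := is_derive_dkfun mphi s (isT : (0 < 1)%N).
have hng := kfun_nongrowing mphi (isT : (0 < 1)%N).
have k0 : k (ln t) != 0.
  apply/eqP => k00; have [y y0 /eqP] := coef1_neq0 mphi; apply.
  have q0 : 0 <= expR (2 * ln t) - t ^+ 2 by rewrite expRM_natl lnK ?posrE// subrr.
  have := sol_eq0 hk hdk hng q0 k00 => kz.
  apply/eqP; rewrite -sqrf_eq0 (coef_kfun _ (isT : (0 < 1)%N) y0) -/k.
  by rewrite kz expr0n/= mulr0.
exists lam, (fun s => k s / k (ln t)), (k (ln t)); split => //.
  exact: (bessel_profileP tau2 hk hdk hng k0).
move=> n y n0 y0; have nR : 0 < n%:R :> R by rewrite ltr0n.
have p0 : 0 < 2 * pi :> R by rewrite mulr_gt0 ?pi_gt0.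
rewrite h1//; have ny : 0 < n%:R * y by rewrite mulr_gt0.
have u0 : 0 < 2 * pi * n%:R * y by rewrite -mulrA mulr_gt0.
have -> : coef phi 1 (n%:R * y) = Num.sqrt (2 * pi * n%:R * y) * k (ln (2 * pi * n%:R * y)).
  rewrite /k /kfun lnK ?posrE// mulr1.
  have -> : 2 * pi * n%:R * y / (2 * pi) = n%:R * y.
    by rewrite -(mulrA (2 * pi)) mulrAC mulfV ?gt_eqF// mul1r.
  suff e1 : Num.sqrt (2 * pi * n%:R * y) * expR (- (ln (2 * pi * n%:R * y) / 2)) = 1.
    by rewrite mulrA e1 mul1r.
  rewrite -[X in Num.sqrt X](lnK (u0 : _ \is Num.pos)).
  set L := ln _; have -> : expR L = expR (L / 2) ^+ 2 by rewrite -expRM_natl; congr expR; field.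
  by rewrite sqrtr_sqr ger0_norm ?expR_ge0// -expRD subrr expR0.
have -> : 2 * pi * n%:R * y = n%:R * (2 * pi * y) by ring.
rewrite sqrtrM ?(ltW nR)//.
move: (ln (n%:R * (2 * pi * y))) (Num.sqrt (2 * pi * y)) => L r; field.
by rewrite k0 gt_eqF// sqrtr_gt0.
Qed.

Section WithData.
Context (lam : nat -> R) (K : R -> R) (k0 : R).
Hypothesis k00 : k0 != 0.
Hypothesis pK : bessel_profile tau K.
Hypothesis coefE : forall n y, (0 < n)%N -> 0 < y ->
  coef phi n y = Num.sqrt (2 * pi * y) * k0 * (lam n * K (ln (2 * pi * n%:R * y))).
Hypothesis lam_le : forall n, (0 < n)%N -> `|lam n| <= n%:R ^+ 2.

(** The bound [2000 <= 45^2] covers the oscillatory range, and beyond [2 t] the decay has rate at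
    least [6]. The sixth power still leaves [n^-4] after [lam n] has been bounded by [n^2]. *)
Lemma profile_norm_le (u : R) : 0 < u -> `|K (ln u)| <= 45 * (2 * t / u) ^+ 6.
Proof.
move=> u0; have [ut|tu] := leP u (2 * t).
  have r1 : 1 <= 2 * t / u by rewrite ler_pdivlMr// mul1r.
  have r6 : 1 <= (2 * t / u) ^+ 6 by rewrite exprn_ege1.
  apply: (@le_trans _ _ 45); last by rewrite ler_peMr.
  have [h|/ltW h] := leP (ln u) (ln t).
    have [_ h2] := profile_oscillatory pK h.
    rewrite -ler_sqr ?nnegrE// real_normK ?num_real//; apply: (le_trans h2).
    by rewrite -natrX ler_nat.
  by have /andP[k1 k2] := profile_gt0 pK h; rewrite gtr0_norm//; lra.
have t20 : 0 < 2 * t by rewrite mulr_gt0.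
have h1 : ln t <= ln (2 * t) by rewrite ler_ln ?posrE//; lra.
have h2 : ln (2 * t) <= ln u by rewrite ler_ln ?posrE// ltW.
have k6 : (6 : R) ^+ 2 <= expR (2 * ln (2 * t)) - t ^+ 2.
  by rewrite expRM_natl lnK ?posrE//; have := t8; nra.
have := profile_decay pK (ltr0n R 6 : 0 < 6) k6 h1 h2.
have /andP[K0 _] := profile_gt0 pK (le_trans h1 h2).
have -> : - (6 * (ln u - ln (2 * t))) = 6 * (ln (2 * t) - ln u) by ring.
rewrite -ln_div ?posrE// expRM_natl lnK ?posrE ?divr_gt0// (gtr0_norm K0) => h.
by apply: (le_trans h); rewrite ler_peMl ?exprn_ge0 ?divr_ge0 ?ltW//; lra.
Qed.

Definition sup_const : R := 4 * (45 * 2 ^+ 6).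

(** A high representative has [z = 2 pi y >= 1], so [sqrt z <= z^6] is absorbed by the sixth power
    in the profile bound, and the coefficients are at most [D / n^2] uniformly in the point. The [4]
    in [sup_const] is [2 D] for the first cosine plus [2 D] for the remainder. *)
Lemma form_sup_le x y : 0 < y -> `|f (x, y)| <= sup_const * t ^+ 6 * `|k0|.
Proof.
move=> y0; have [[x1 y1] /= [x01 yh] ->] := form_high_representative mphi x y0.
have y10 : 0 < y1 by lra.
have z1 : 1 <= 2 * pi * y1 by have := pi_ge2 R; nra.
have z0 : 0 < 2 * pi * y1 by lra.
pose D := 45 * 2 ^+ 6 * t ^+ 6 * `|k0|.
have D0 : 0 <= D.
  rewrite /D; apply: mulr_ge0 (normr_ge0 _); apply: mulr_ge0 (exprn_ge0 _ (ltW t0)).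
  by apply: mulr_ge0 => //; exact: exprn_ge0.
have hD n : (0 < n)%N -> `|coef phi n y1| <= D / n%:R ^+ 2.
  move=> n0; have nR : 0 < n%:R :> R by rewrite ltr0n.
  have nz : 2 * pi * n%:R * y1 = n%:R * (2 * pi * y1) by ring.
  rewrite coefE// !normrM ger0_norm ?sqrtr_ge0// nz.
  move: (2 * pi * y1) z0 z1 => z z0 z1.
  have h1 := lam_le n0; have h2 := profile_norm_le (mulr_gt0 nR z0).
  have sz : Num.sqrt z <= z ^+ 6.
    apply: (@le_trans _ _ z); last by rewrite -[leLHS]expr1 ler_weXn2l.
    rewrite -{2}(sqr_sqrtr (ltW z0)) expr2 ler_peMr ?sqrtr_ge0//.
    by rewrite -sqrtr1 ler_sqrt// ltW.
  apply: (@le_trans _ _ (z ^+ 6 * `|k0| * (n%:R ^+ 2 * (45 * (2 * t / (n%:R * z)) ^+ 6)))).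
    apply: ler_pM; rewrite ?mulr_ge0 ?sqrtr_ge0//; first by rewrite ler_wpM2r.
    by apply: ler_pM.
  have -> : z ^+ 6 * `|k0| * (n%:R ^+ 2 * (45 * (2 * t / (n%:R * z)) ^+ 6)) = D / n%:R ^+ 4.
    by rewrite /D; field; rewrite !gt_eqF.
  apply: ler_wpM2l => //; rewrite lef_pV2 ?posrE ?exprn_gt0//.
  by rewrite ler_weXn2l// ler1n.
have h := form_fourier_all mphi y10 D0 hD 0 x1; rewrite divr1 in h.
have : `|cos_sum (coef phi ^~ y1) 1 x1| <= 2 * D.
  rewrite /cos_sum big_seq1 normrM -[leRHS]mulr1 ler_pM// ?normr_cosn_le1//.
  by rewrite normrM ger0_norm// ler_pM2l//; have := hD 1%N isT; rewrite expr1n divr1.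
have -> : f (x1, y1) = (f (x1, y1) - cos_sum (coef phi ^~ y1) 1 x1) + cos_sum (coef phi ^~ y1) 1 x1 by ring.
move=> h2; apply: (le_trans (ler_normD _ _)).
have -> : sup_const * t ^+ 6 * `|k0| = 2 * D + 2 * D by rewrite /D /sup_const; ring.
exact: lerD.
Qed.

Definition block_const : R := 2 * sup_const ^+ 2.

(** At height [t / (2 pi M)] the indices from [M] to [M (1 + tau^-2 / 10)] all lie in the window
    where [K >= 1/2], so Bessel's inequality for the form bounds their sum; [k0 ^+ 2] occurs on both
    sides and cancels. *)
Lemma block_sum_le (M N : nat) : (0 < M)%N -> N%:R <= M%:R * (1 + tau ^- 2 / 10) ->
  \sum_(n <- iota M (N.+1 - M)) lam n ^+ 2 <= block_const * t ^+ 11 * M%:R.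
Proof.
move=> M0 hN; have MR : 0 < M%:R :> R by rewrite ltr0n.
have p0 : 0 < 2 * pi :> R by rewrite mulr_gt0 ?pi_gt0.
pose y : R := t / (2 * pi * M%:R).
have pM : 0 < 2 * pi * M%:R :> R by rewrite mulr_gt0.
have y0 : 0 < y by rewrite divr_gt0.
have yE : 2 * pi * y = t / M%:R by rewrite /y; move: (2 * pi) p0 => p p0; field; rewrite !gt_eqF.
have tM : 0 < t / M%:R by rewrite divr_gt0.
have k02 : 0 < k0 ^+ 2 by rewrite exprn_even_gt0.
have B := @bessel_inequality R (fun x => f (x, y)) N (sup_const * t ^+ 6 * `|k0|)
  (form_slice_continuous mphi y0) (fun x _ => form_sup_le x y0).
have h1 : \sum_(n <- iota M (N.+1 - M)) (t / M%:R * k0 ^+ 2 / 4) * lam n ^+ 2 <=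
    \sum_(n <- iota M (N.+1 - M)) coef phi n y ^+ 2.
  rewrite big_seq [leRHS]big_seq; apply: ler_sum => n; rewrite mem_iota => /andP[Mn nN].
  have n0 : (0 < n)%N by exact: leq_trans Mn.
  have nR : 0 < n%:R :> R by rewrite ltr0n.
  have nN' : (n <= N)%N.
    have [h|h] := leqP M N.+1; first by rewrite subnKC// in nN.
    move: nN; have -> : (N.+1 - M = 0)%N by apply/eqP; rewrite subn_eq0 ltnW.
    by rewrite addn0 ltnNge Mn.
  have u0 : 0 < n%:R / M%:R :> R by rewrite divr_gt0.
  have u1 : 1 <= n%:R / M%:R :> R by rewrite ler_pdivlMr// mul1r ler_nat.
  have u2 : n%:R / M%:R <= 1 + tau ^- 2 / 10.
    by rewrite ler_pdivrMr// mulrC; apply: le_trans hN; rewrite ler_nat.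
  have -> : coef phi n y ^+ 2 = (t / M%:R * k0 ^+ 2) * (lam n ^+ 2 * K (ln (t * (n%:R / M%:R))) ^+ 2).
    rewrite coefE// yE.
    have -> : 2 * pi * n%:R * y = t * (n%:R / M%:R).
      have -> : 2 * pi * n%:R * y = n%:R * (2 * pi * y) by ring.
      by rewrite yE; field; rewrite gt_eqF.
    by rewrite !exprMn sqr_sqrtr ?(ltW tM)//; ring.
  have K12 : 4^-1 <= K (ln (t * (n%:R / M%:R))) ^+ 2.
    have l1 : 0 <= ln (n%:R / M%:R :> R) by rewrite ln_ge0.
    have l2 : ln (n%:R / M%:R) <= tau ^- 2 / 10.
      apply: (@le_trans _ _ (n%:R / M%:R - 1)); last by lra.
      have := @expR_ge1Dx R (ln (n%:R / M%:R)); rewrite lnK ?posrE//; lra.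
    have := @profile_turning _ _ _ pK (ln (t * (n%:R / M%:R))).
    rewrite lnM ?posrE// => /(_ _) h.
    have {}h : 2^-1 <= K (ln t + ln (n%:R / M%:R)) by apply: h; apply/andP; split; lra.
    by nra.
  have : 0 <= (t / M%:R * k0 ^+ 2) * lam n ^+ 2.
    by apply: mulr_ge0 (sqr_ge0 _); apply: mulr_ge0 (ltW tM) (sqr_ge0 _).
  move: (K _ ^+ 2) K12 => z hz; move: (t / M%:R * k0 ^+ 2) (lam n ^+ 2) => a b ab.
  have -> : a * (b * z) = a * b * z by ring.
  have -> : a / 4 * b = a * b * 4^-1 by ring.
  by rewrite ler_wpM2l.
have h2 : \sum_(n <- iota M (N.+1 - M)) coef phi n y ^+ 2 <= \sum_(n <- iota 1 N) coef phi n y ^+ 2.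
  apply: ler_sum_uniq_sub; [exact: iota_uniq| |by move=> n; exact: sqr_ge0].
  move=> n; rewrite !mem_iota => /andP[Mn nN]; rewrite (leq_trans M0 Mn) add1n.
  have [h|h] := leqP M N.+1; first by rewrite subnKC// in nN.
  move: nN; have -> : (N.+1 - M = 0)%N by apply/eqP; rewrite subn_eq0 ltnW.
  by rewrite addn0 ltnNge Mn.
have := le_trans h1 (le_trans h2 B); rewrite -mulr_sumr => h.
have c0 : 0 < t / M%:R * k0 ^+ 2 / 4 by apply: divr_gt0 => //; exact: mulr_gt0.
rewrite -(ler_pM2l c0); apply: (le_trans h).
have ak : `|k0| ^+ 2 = k0 ^+ 2 by rewrite real_normK ?num_real.
have -> : (sup_const * t ^+ 6 * `|k0|) ^+ 2 = sup_const ^+ 2 * t ^+ 12 * k0 ^+ 2.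
  by rewrite -ak; move: (sup_const) (`|k0|) => c a; ring.
rewrite /block_const le_eqVlt; apply/orP; left; apply/eqP.
by move: (sup_const) => c; field; rewrite gt_eqF.
Qed.

Definition crude_const : R := 11 * block_const.

(** Blocks of ratio [1 + dl] are peeled off from the top by strong induction. [A] solves
    [A / (1 + dl) + D = A]; as [1 / dl = 10 tau^2], it is at most [11 t D]. *)
Lemma crude_sum_le (N : nat) : sum_sqr lam N <= crude_const * t ^+ 12 * N%:R.
Proof.
have d0 : 0 < tau ^- 2 / 10 by rewrite divr_gt0 ?invr_gt0 ?exprn_gt0.
pose dl := tau ^- 2 / 10; pose D := block_const * t ^+ 11.
have D0 : 0 <= D.
  rewrite /D; apply: mulr_ge0 (exprn_ge0 _ (ltW t0)).
  by rewrite /block_const; apply: mulr_ge0 => //; exact: sqr_ge0.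
pose A := D * (1 + 10 * tau ^+ 2).
have A0 : 0 <= A.
  by rewrite /A; apply: mulr_ge0 => //; apply: addr_ge0 => //; apply: mulr_ge0 => //; exact: sqr_ge0.
have AE : A / (1 + dl) + D = A.
  have := exprn_gt0 2 tau0; rewrite /A /dl => h; field.
  by rewrite !gt_eqF//; nra.
suff h : sum_sqr lam N <= A * N%:R.
  apply: (le_trans h); rewrite ler_wpM2r//.
  have -> : crude_const * t ^+ 12 = D * (11 * t) by rewrite /crude_const /D; ring.
  rewrite ler_wpM2l//.
  have tau1 : 1 <= tau by apply: le_trans tau2; rewrite ler1n.
  have : tau ^+ 2 <= t by rewrite ler_weXn2l.
  by have := t8; lra.
elim/ltn_ind: N => -[|N] IH; first by rewrite /sum_sqr big_nil mulr0.
(* [M] is the least integer exceeding [N.+1 / (1 + dl)], so the block from [M] to [N.+1] has an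
   admissible ratio. *)
pose m := Num.truncn (N.+1%:R / (1 + dl)); pose M := m.+1.
have dl1 : 0 < 1 + dl by rewrite addr_gt0.
have q0 : 0 <= N.+1%:R / (1 + dl) by rewrite divr_ge0 ?ltW.
have /andP[m1 m2] := truncn_itv q0; rewrite -/M in m2.
have MN : (M <= N.+1)%N.
  rewrite /M -(ltr_nat R); apply: le_lt_trans m1 _.
  by rewrite ltr_pdivrMr// ltr_pMr ?ltr0n// ltrDl.
have hM : N.+1%:R <= M%:R * (1 + dl) by rewrite -ler_pdivrMr// ltW.
have split_ : sum_sqr lam N.+1 = sum_sqr lam M.-1 + \sum_(n <- iota M (N.+2 - M)) lam n ^+ 2.
  have mN : (m <= N.+1)%N by exact: ltnW.
  by rewrite /sum_sqr -{1}(subnKC mN) iotaD big_cat/= add1n subSS.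
rewrite split_; have IH' := IH M.-1 _.
apply: (@le_trans _ _ (A * (N.+1%:R / (1 + dl)) + D * N.+1%:R)).
  apply: lerD.
    apply: (le_trans (IH' _)); first by rewrite /M/=.
    by rewrite ler_wpM2l.
  apply: (le_trans (block_sum_le (isT : (0 < M)%N) hM)).
  by rewrite ler_wpM2l// ler_nat.
by rewrite mulrCA -{2}AE mulrDl (mulrC (A / _)).
Qed.

End WithData.

End FormData.

(** * Mean square of the Hecke eigenvalues *)

(** The iteration shrinks the crude factor [t^12] to its [2^J]-th root, and [2^J > 24 / e] makes
    this at most [t^(e/2)]. Divisor counts up to [X^(2^J)] then have to be [O(t^(e/4))], hence the
    exponent [e / (4 P)]; they enter squared and use up the other [t^(e/2)]. *)
Lemma hecke_mean_square (R : realType) (e : R) : 0 < e -> exists2 C : R, 0 < C &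
  forall (t : R) (lam : nat -> R), 1 <= t ->
  (forall m n, (0 < m)%N -> (0 < n)%N ->
     lam m * lam n = \sum_(d <- divisors (gcdn m n)) lam (m * n %/ d ^ 2)%N) ->
  (forall N, sum_sqr lam N <= crude_const R * t ^+ 12 * N%:R) ->
  forall N : nat, N%:R <= t -> sum_sqr lam N <= C * t `^ e * N%:R.
Proof.
move=> e0.
pose J := Num.truncn (24 / e).
have J1 : 24 / e < (2 ^ J)%N%:R.
  apply: lt_le_trans (truncnS_gt _) _; rewrite ler_nat; exact: ltn_expl.
pose P : R := (2 ^ J)%N%:R.
have P0 : 0 < P by rewrite ltr0n expn_gt0.
have de0 : 0 < e / (4 * P) by rewrite divr_gt0 ?mulr_gt0.
have [Cd Cd1 hCd] := divisor_bound de0.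
have cc0 : 0 < crude_const R by rewrite /crude_const /block_const /sup_const !mulr_gt0 ?exprn_gt0 ?mulr_gt0.
exists (2 * Cd ^+ 2 * crude_const R `^ P^-1).
  by rewrite !mulr_gt0 ?exprn_gt0 ?powR_gt0// (lt_le_trans _ Cd1).
move=> t lam t1 hecke crude N Nt.
have t0 : 0 < t by lra.
pose X := Num.truncn t.
have /andP[X1 X2] := truncn_itv (ltW t0).
have X0 : (0 < X)%N by rewrite -ltnS -(ltr_nat R); exact: le_lt_trans t1 X2.
have NX : (N <= X)%N by rewrite -ltnS -(ltr_nat R); apply: le_lt_trans Nt X2.
pose T := Cd * t `^ (e / 4).
have T0 : 0 <= T by rewrite mulr_ge0 ?powR_ge0//; lra.
have te : 1 <= t `^ (e / 4) by rewrite -[leLHS](powRr0 t) ler_powR// divr_ge0// ltW.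
have T1 : 1 <= T by rewrite -[leLHS]mulr1 ler_pM.
pose b := (crude_const R * t ^+ 12) `^ P^-1.
have b0 : 0 <= b by exact: powR_ge0.
have bP : b ^+ (2 ^ J) = crude_const R * t ^+ 12.
  by rewrite -powR_mulrn// -powRrM mulVf ?gt_eqF// powRr1// mulr_ge0 ?exprn_ge0 ?ltW.
have hT n : (0 < n <= X ^ (2 ^ J))%N -> (size (divisors n))%:R <= T.
  move=> /andP[n0 nX]; apply: (le_trans (hCd _ n0)); rewrite ler_wpM2l//; first by lra.
  apply: (@le_trans _ _ ((t ^+ (2 ^ J)) `^ (e / (4 * P)))).
    rewrite ge0_ler_powR ?nnegrE ?exprn_ge0 ?(ltW t0) ?(ltW de0)//.
    apply: (@le_trans _ _ (X ^ (2 ^ J))%N%:R); first by rewrite ler_nat.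
    by rewrite natrX lerXn2r ?nnegrE ?(ltW t0).
  rewrite -powR_mulrn ?(ltW t0)// -powRrM -/P.
  by have -> : P * (e / (4 * P)) = e / 4 by field; rewrite gt_eqF.
have hS M : (M <= X ^ (2 ^ J))%N -> sum_sqr lam M <= 2 * T ^+ 2 * b ^+ (2 ^ J) * M%:R.
  move=> _; rewrite bP; apply: (le_trans (crude M)); rewrite ler_wpM2r//.
  rewrite ler_peMl//; first by rewrite mulr_ge0 ?exprn_ge0 ?ltW.
  have : 1 <= T ^+ 2 by rewrite exprn_ege1.
  by lra.
apply: (le_trans (hecke_sum_iter hecke b0 T0 X0 hT hS NX)).
rewrite ler_wpM2r// /T /b powRM ?exprn_ge0 ?(ltW cc0) ?(ltW t0)//.
have -> : 2 * (Cd * t `^ (e / 4)) ^+ 2 * (crude_const R `^ P^-1 * (t ^+ 12) `^ P^-1) =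
   2 * Cd ^+ 2 * crude_const R `^ P^-1 * ((t `^ (e / 4)) ^+ 2 * (t ^+ 12) `^ P^-1).
  by ring.
apply: ler_wpM2l; first by apply: mulr_ge0 (powR_ge0 _ _); apply: mulr_ge0 => //; exact: sqr_ge0.
rewrite -!powR_mulrn ?powR_ge0 ?(ltW t0)// -!powRrM -powRD; last by rewrite (gt_eqF t0) implybT.
rewrite ler_powR//.
have : 12 / P <= e / 2.
  rewrite ler_pdivrMr//; have := J1; rewrite ltr_pdivrMr// -/P; nra.
lra.
Qed.

(** * Zeros of small perturbations of a cosine *)

Lemma cosDnpi (R : realType) (x : R) (n : nat) : cos (x + n%:R * pi) = (-1) ^+ n * cos x.
Proof.
elim: n => [|n IH]; first by rewrite mul0r addr0 expr0 mul1r.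
by rewrite -[n.+1]addn1 natrD mulrDl mul1r addrA cosDpi IH exprD expr1 mulrN1 mulNr.
Qed.

Lemma cosBnpi (R : realType) (x : R) (n : nat) : cos (x - n%:R * pi) = (-1) ^+ n * cos x.
Proof.
by rewrite -[x in RHS](subrK (n%:R * pi)) cosDnpi mulrA -expr2 sqrr_sign mul1r.
Qed.

(** At two zeros [|cos| <= 1/10], so in between [sin >= 9/10]: the cosine would move at rate at
    least [9 pi / 10], the perturbation at most at rate [pi / 10]. *)
Lemma perturbed_cos_root_uniq (R : realType) (G : R -> R) (v1 v2 : R) :
  (forall v, `|G v - cos (pi * v)| <= 10^-1) ->
  (forall u v, `|(G u - cos (pi * u)) - (G v - cos (pi * v))| <= pi / 10 * `|u - v|) ->
  0 <= v1 <= 1 -> 0 <= v2 <= 1 -> G v1 = 0 -> G v2 = 0 -> v1 = v2.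
Proof.
move=> Gc GL.
suff key (u v : R) : 0 <= u -> v <= 1 -> u < v -> G u = 0 -> G v = 0 -> False.
  move=> /andP[a1 a2] /andP[b1 b2] g1 g2; have [h|h|] := ltgtP v1 v2 => //.
    by have := key _ _ a1 b2 h g1 g2.
  by have := key _ _ b1 a2 h g2 g1.
move=> u0 v1' uv gu gv.
have p0 := pi_gt0 R.
have [c] : exists2 c, c \in `]u, v[%R & cos (pi * v) - cos (pi * u) = - (pi * sin (pi * c)) * (v - u).
  apply: (@MVT _ (fun x => cos (pi * x)) (fun x => - (pi * sin (pi * x)))) => //.
    by move=> x _; apply: is_derive_eq; rewrite /GRing.scale/=; ring.
  apply: derivable_within_continuous => x _.
  suff : is_derive x 1 (fun x : R => cos (pi * x)) (- (pi * sin (pi * x))) by case.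
  by apply: is_derive_eq; rewrite /GRing.scale/=; ring.
rewrite in_itv/= => /andP[uc cv] E.
have cu := Gc u; have cvv := Gc v; have L := GL u v.
rewrite gu gv !sub0r !normrN in cu cvv L.
have in01 (x : R) : 0 <= x -> x <= 1 -> pi * x \in `[0, pi]%R.
  by move=> x0 x1; rewrite in_itv/=; apply/andP; split; nra.
have mono (a b : R) : 0 <= a -> b <= 1 -> a < b -> cos (pi * b) < cos (pi * a).
  by move=> a0 b1 ab; rewrite ltr_cos ?ltr_pM2l//; apply: in01; lra.
have c1 : cos (pi * c) < cos (pi * u) by apply: mono => //; lra.
have c2 : cos (pi * v) < cos (pi * c) by apply: mono => //; lra.
have s0 : 0 <= sin (pi * c) by apply: sin_ge0_pi; have := in01 c; rewrite in_itv/=; apply; lra.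
have cc : cos (pi * c) ^+ 2 <= 100^-1.
  move: cu cvv; rewrite !ler_norml => /andP[? ?] /andP[? ?].
  have : 0 <= (10^-1 - cos (pi * c)) * (10^-1 + cos (pi * c)) by apply: mulr_ge0; lra.
  by lra.
have s9 : 9 / 10 <= sin (pi * c).
  have n9 : 0 <= 9 / 10 :> R by lra.
  by rewrite -ler_sqr ?nnegrE// sin2cos2; lra.
have uv0 : 0 < v - u by rewrite subr_gt0.
have eL : - cos (pi * u) - - cos (pi * v) = - (pi * sin (pi * c) * (v - u)) by lra.
rewrite eL normrN ger0_norm ?(distrC u) ?(gtr0_norm uv0) in L; last first.
  by rewrite !mulr_ge0 ?(ltW p0) ?(ltW uv0).
by move: L; rewrite ler_pM2r// ler_pM2l//; lra.
Qed.

Lemma perturbed_cos_root_ex (R : realType) (G : R -> R) : continuous G ->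
  (forall v, `|G v - cos (pi * v)| <= 10^-1) ->
  exists2 v, 0 <= v <= 1 & G v = 0.
Proof.
move=> cG Gc.
have g0 := Gc 0; have g1 := Gc 1.
rewrite mulr0 cos0 ler_norml in g0; rewrite mulr1 cospi ler_norml in g1.
have [v + Gv] : exists2 v, v \in `[0, 1]%R & G v = 0.
  apply: IVT => //; first exact: continuous_subspaceT.
  by rewrite ge_min le_max; apply/andP; split; apply/orP; [right|left]; lra.
by rewrite in_itv/= => v01; exists v.
Qed.

(** The interval is cut into [2 l] pieces of length [1 / (2 l)]. Rescaled to [[0, 1]], the cosine on
    each is [cos (pi v)] up to sign, so each holds exactly one zero, never at an endpoint because
    [|cosn l| = 1] there. *)
Lemma perturbed_cos_zeros (R : realType) (l : nat) (g : R -> R) : (0 < l)%N ->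
  continuous g ->
  (forall x, `|g x - cosn l x| <= 10^-1) ->
  (forall x y, `|(g x - cosn l x) - (g y - cosn l y)| <= 2 * pi * l%:R / 10 * `|x - y|) ->
  exists e : nat -> R, set_bij `I_(2 * l) [set x | - 2^-1 < x <= 2^-1 /\ g x = 0] e.
Proof.
move=> l0 cg gc gL.
have lR : 0 < l%:R :> R by rewrite ltr0n.
have p0 := pi_gt0 R.
pose X (k : nat) (v : R) : R := - 2^-1 + (k%:R + v) / (2 * l%:R).
(* The value of [cosn l] at the left end of piece [k], starting from [(-1)^l] at [- 1/2]. *)
pose sg (k : nat) : R := (-1) ^+ (l + k).
have sg2 k : sg k * sg k = 1 by rewrite /sg -expr2 sqrr_sign.
have sgn k : `|sg k| = 1 by rewrite /sg normrX normrN1 expr1n.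
have cX (k : nat) (v : R) : cosn l (X k v) = sg k * cos (pi * v).
  have -> : cosn l (X k v) = cos (pi * v + k%:R * pi - l%:R * pi).
    by rewrite /cosn /X; congr cos; field; rewrite gt_eqF.
  by rewrite cosBnpi cosDnpi mulrA -exprD.
pose G (k : nat) (v : R) : R := sg k * g (X k v).
have cXv k : continuous (X k).
  move=> v; apply: cvgD; first exact: cvg_cst.
  by apply: cvgM; [apply: cvgD; [exact: cvg_cst|exact: cvg_id]|exact: cvg_cst].
have cG k : continuous (G k).
  move=> v; apply: cvgM; first exact: cvg_cst.
  by apply: (@continuous_comp _ _ _ (X k) g); [exact: cXv|exact: cg].
have GE (k : nat) (v : R) : G k v - cos (pi * v) = sg k * (g (X k v) - cosn l (X k v)).
  by rewrite cX mulrBr mulrA sg2 mul1r.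
have Gc (k : nat) (v : R) : `|G k v - cos (pi * v)| <= 10^-1 by rewrite GE normrM sgn mul1r.
have GL (k : nat) (u v : R) : `|(G k u - cos (pi * u)) - (G k v - cos (pi * v))| <= pi / 10 * `|u - v|.
  rewrite !GE -mulrBr normrM sgn mul1r; apply: (le_trans (gL _ _)).
  have -> : X k u - X k v = (u - v) / (2 * l%:R) by rewrite /X; field; rewrite gt_eqF.
  rewrite normrM [X in _ * (_ * X)]gtr0_norm ?invr_gt0 ?mulr_gt0//.
  by rewrite le_eqVlt; apply/orP; left; apply/eqP; field; rewrite gt_eqF.
have ex (k : nat) : exists v : R, 0 <= v <= 1 /\ G k v = 0.
  by have [v h1 h2] := perturbed_cos_root_ex (cG k) (Gc k); exists v.
have [v hv] := choice ex.
have G0 (k : nat) (u : R) : (G k u == 0) = (g (X k u) == 0).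
  by rewrite /G mulf_eq0 -normr_eq0 sgn oner_eq0.
have strict (k : nat) (u : R) : G k u = 0 -> u != 0 /\ u != 1.
  move=> Gu; have := Gc k u; rewrite Gu sub0r normrN => h.
  split; apply: contraTneq h => ->.
    by rewrite mulr0 cos0 normr1 -ltNge; lra.
  by rewrite mulr1 cospi normrN1 -ltNge; lra.
exists (fun k => X k (v k)); split.
- move=> k /= kl; have [/andP[v0 v1] Gv] := hv k; have [n0 n1] := strict _ _ Gv.
  split; last by apply/eqP; rewrite -G0 Gv.
  have v0' : 0 < v k by rewrite lt_neqAle eq_sym n0.
  have kR : (k%:R + v k) / (2 * l%:R) <= 1.
    rewrite ler_pdivrMr ?mulr_gt0// mul1r.
    have : k%:R + 1 <= 2 * l%:R :> R by rewrite natr1 -natrM ler_nat.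
    by lra.
  have kR0 : 0 < (k%:R + v k) / (2 * l%:R) by rewrite divr_gt0 ?mulr_gt0// ltr_wpDl.
  by rewrite /X; apply/andP; split; lra.
- move=> i j; rewrite !inE /= => il jl /= E.
  have {}E : i%:R + v i = j%:R + v j.
    by move: E => /addrI; apply: mulIf; rewrite invr_neq0// mulf_neq0// gt_eqF.
  have [/andP[vi0 vi1] Gi] := hv i; have [_ n1i] := strict _ _ Gi.
  have [/andP[vj0 vj1] Gj] := hv j; have [_ n1j] := strict _ _ Gj.
  have vi1' : v i < 1 by rewrite lt_neqAle n1i.
  have vj1' : v j < 1 by rewrite lt_neqAle n1j.
  apply: anti_leq; apply/andP; split.
    by rewrite -ltnS -(ltr_nat R) -natr1; lra.
  by rewrite -ltnS -(ltr_nat R) -natr1; lra.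
- move=> x /= [/andP[x0 x1] gx].
  pose w := 2 * l%:R * (x + 2^-1).
  have w0 : 0 <= w by rewrite mulr_ge0 ?mulr_ge0//; lra.
  pose k := Num.truncn w.
  have /andP[k1 k2] := truncn_itv w0; rewrite -/k -natr1 in k1 k2.
  have xE : x = X k (w - k%:R) by rewrite /X /w; field; rewrite gt_eqF.
  have Gk : G k (w - k%:R) = 0 by apply/eqP; rewrite G0 -xE gx.
  exists k; last first.
    rewrite [RHS]xE; congr (X k _).
    have [vv Gv] := hv k.
    apply: (perturbed_cos_root_uniq (Gc k) (GL k)) => //.
    by apply/andP; split; lra.
  have wl : w <= 2 * l%:R.
    have -> : 2 * l%:R = 2 * l%:R * 1 :> R by rewrite mulr1.
    by rewrite ler_pM2l ?mulr_gt0//; lra.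
  (* [k = 2 l] would force [w = k], a zero at the endpoint [x = 1/2]. *)
  have [n0 _] := strict _ _ Gk; rewrite subr_eq0 in n0.
  rewrite /= -(ltr_nat R) natrM lt_neqAle (le_trans k1 wl) andbT.
  apply: contra n0 => /eqP kE; rewrite eq_le k1 andbT.
  by rewrite kE.
Qed.

(** * The expansion on the horocycle at height [t / (2 pi l)] *)

Lemma le_of_le_add_div (R : realType) (x E C : R) :
  (forall N : nat, x <= E + C / N.+1%:R) -> x <= E.
Proof.
move=> h; rewrite leNgt; apply/negP => Ex.
have C0 : 0 < C by have := h 0%N; rewrite divr1; lra.
have d0 : 0 < x - E by rewrite subr_gt0.
pose N := Num.truncn (C / (x - E)).
have := h N; rewrite leNgt => /negP; apply.
rewrite -ltrBrDl ltr_pdivrMr ?ltr0n// [ltRHS]mulrC -ltr_pdivrMr//.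
by rewrite /N truncnS_gt.
Qed.

(** Telescoping: [1 / b <= 2 (b - a)] whenever [b^2 = a^2 + 1]. *)
Lemma sum_inv_sqrt_le (R : realType) (l : nat) :
  \sum_(j <- iota 1 l) (Num.sqrt j%:R)^-1 <= 2 * Num.sqrt l%:R :> R.
Proof.
elim: l => [|l IH]; first by rewrite big_nil sqrtr0 mulr0.
rewrite -[l.+1]addn1 iotaD big_cat/= big_seq1 add1n addn1.
apply: (le_trans (lerD IH (lexx _))).
have a0 : 0 <= Num.sqrt l%:R :> R := sqrtr_ge0 _.
have b0 : 0 < Num.sqrt l.+1%:R :> R by rewrite sqrtr_gt0 ltr0n.
have ab : Num.sqrt l.+1%:R ^+ 2 = Num.sqrt l%:R ^+ 2 + 1 :> R.
  by rewrite !sqr_sqrtr// natr1.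
move: (Num.sqrt l%:R) (Num.sqrt l.+1%:R) a0 b0 ab => a b a0 b0 ab.
rewrite -(ler_pM2r b0) mulrDl mulVf ?gt_eqF//.
by have := sqr_ge0 (a - b); nra.
Qed.

Lemma cauchy_schwarz_seq (R : realFieldType) (T : Type) (s : seq T) (F G : T -> R) :
  (\sum_(x <- s) F x * G x) ^+ 2 <= (\sum_(x <- s) F x ^+ 2) * (\sum_(x <- s) G x ^+ 2).
Proof.
set A := \sum_(x <- s) F x ^+ 2; set B := \sum_(x <- s) G x ^+ 2; set C := \sum_(x <- s) _ * _.
have A0 : 0 <= A by apply: sumr_ge0 => x _; exact: sqr_ge0.
have B0 : 0 <= B by apply: sumr_ge0 => x _; exact: sqr_ge0.
have q (u v : R) : 0 <= u ^+ 2 * A + 2 * u * v * C + v ^+ 2 * B.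
  rewrite /A /B /C !mulr_sumr -!big_split/=; apply: sumr_ge0 => x _.
  by have := sqr_ge0 (u * F x + v * G x); nra.
have [A00|A00] := eqVneq A 0.
  have := q (- (B + 1)) C; have := q (B + 1) (- C); rewrite A00 mulr0 mul0r add0r.
  by have := sqr_ge0 C; nra.
have Ap : 0 < A by rewrite lt_neqAle eq_sym A00.
have h := q C (- A).
have e : C ^+ 2 * A + 2 * C * - A * C + (- A) ^+ 2 * B = A * (A * B - C ^+ 2) by ring.
by rewrite e pmulr_rge0// subr_ge0 in h.
Qed.

Section MainEstimate.
Context (R : realType) (tau : R) (phi : R[i] -> R).
Local Notation t := (tau ^+ 3).
Hypothesis mphi : even_hecke_maass_cusp_form t phi.
Hypothesis tau2 : 2 <= tau.
Context (lam : nat -> R) (K : R -> R) (k0 : R).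
Hypothesis k00 : k0 != 0.
Hypothesis pK : bessel_profile tau K.
Hypothesis coefE : forall n y, (0 < n)%N -> 0 < y ->
  coef phi n y = Num.sqrt (2 * pi * y) * k0 * (lam n * K (ln (2 * pi * n%:R * y))).
Hypothesis lam_le : forall n, (0 < n)%N -> `|lam n| <= n%:R ^+ 2.

Variable l : nat.
Hypothesis l0 : (0 < l)%N.

Let tau0 : 0 < tau. Proof. by apply: lt_le_trans tau2. Qed.
Let t0 : 0 < t. Proof. exact: exprn_gt0. Qed.
Let lR : 0 < l%:R :> R. Proof. by rewrite ltr0n. Qed.

Definition ratio_profile (n : nat) : R := K (ln (t * n%:R / l%:R)).
Local Notation Kn := ratio_profile.

(** The oscillatory bound at argument [t n / l], with [1 - (n / l)^2 >= (l - n) / l] and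
    [tau^2 / t = 1 / tau]. *)
Lemma ratio_profile_low (n : nat) : (0 < n < l)%N ->
  Kn n ^+ 2 <= 2000 / tau * (Num.sqrt l%:R / Num.sqrt (l - n)%:R).
Proof.
have := profile_oscillatory pK; move: (2000 : R) (ler0n R 2000) => c c0 osc.
move=> /andP[n0 nl]; have nR : 0 < n%:R :> R by rewrite ltr0n.
have u0 : 0 < t * n%:R / l%:R by rewrite divr_gt0 ?mulr_gt0.
have nlR : n%:R < l%:R :> R by rewrite ltr_nat.
have ut : t * n%:R / l%:R <= t by rewrite ler_pdivrMr// ler_pM2l// ltW.
have lnut : ln (t * n%:R / l%:R) <= ln t by rewrite ler_ln ?posrE.
have [h _] := osc _ lnut.
rewrite expRM_natl lnK ?posrE// -/(Kn n) in h.
have d0 : 0 < (l - n)%:R :> R by rewrite ltr0n subn_gt0.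
have dE : (l - n)%:R = l%:R - n%:R :> R by rewrite natrB// ltnW.
have sl := sqr_sqrtr (ltW lR); have sd := sqr_sqrtr (ltW d0).
have sl0 : 0 < Num.sqrt l%:R :> R by rewrite sqrtr_gt0.
have sd0 : 0 < Num.sqrt (l - n)%:R :> R by rewrite sqrtr_gt0.
have rhs0 : 0 <= c / tau * (Num.sqrt l%:R / Num.sqrt (l - n)%:R).
  by apply: mulr_ge0; apply: divr_ge0 => //; exact: ltW.
rewrite -ler_sqr ?nnegrE ?sqr_ge0//.
have -> : (c / tau * (Num.sqrt l%:R / Num.sqrt (l - n)%:R)) ^+ 2 =
   (c * tau ^+ 2) ^+ 2 / (t ^+ 2 * ((l - n)%:R / l%:R)).
  rewrite -[in RHS]sl -[in RHS]sd.
  by field; rewrite !gt_eqF.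
have q0 : 0 < t ^+ 2 * ((l - n)%:R / l%:R) by rewrite mulr_gt0 ?exprn_gt0// divr_gt0.
rewrite ler_pdivlMr//; apply: le_trans h; rewrite -(exprM _ 2 2).
have K4 : 0 <= Kn n ^+ 4 by rewrite (exprM _ 2 2) sqr_ge0.
apply: ler_wpM2l => //.
have -> : t ^+ 2 - (t * n%:R / l%:R) ^+ 2 = t ^+ 2 * (1 - (n%:R / l%:R) ^+ 2) by field; rewrite gt_eqF.
rewrite ler_pM2l ?exprn_gt0// dE mulrBl divff ?gt_eqF//.
have r0 : 0 <= n%:R / l%:R :> R by rewrite divr_ge0.
have r1 : n%:R / l%:R <= 1 :> R by rewrite ler_pdivrMr// mul1r ltW.
by nra.
Qed.

(** Cauchy-Schwarz. The profile side is a sum of [1 / sqrt (l - n)], at most [2 sqrt l] when read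
    backwards, so the singularity at [n = l] does no harm. *)
Lemma low_sum_le (C : R) : 0 <= C -> sum_sqr lam l.-1 <= C * l%:R ->
  (\sum_(n <- iota 1 l.-1) `|lam n * Kn n|) ^+ 2 <= C * (2 * 2000 / tau) * l%:R ^+ 2.
Proof.
have lowb := ratio_profile_low; move: (2000 : R) (ler0n R 2000) lowb => c c0 lowb.
move=> C0 hS; under eq_bigr do rewrite normrM.
apply: (le_trans (cauchy_schwarz_seq _ _ _)).
have e1 : \sum_(n <- iota 1 l.-1) `|lam n| ^+ 2 = sum_sqr lam l.-1.
  by apply: eq_bigr => n _; rewrite real_normK ?num_real.
have h2 : \sum_(n <- iota 1 l.-1) `|Kn n| ^+ 2 <= 2 * c / tau * l%:R.
  apply: (@le_trans _ _ (\sum_(n <- iota 1 l.-1) c / tau * (Num.sqrt l%:R / Num.sqrt (l - n)%:R))).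
    rewrite big_seq [leRHS]big_seq; apply: ler_sum => n; rewrite mem_iota add1n prednK// => nl.
    by rewrite real_normK ?num_real// lowb.
  rewrite -mulr_sumr -mulr_sumr.
  have -> : \sum_(n <- iota 1 l.-1) (Num.sqrt (l - n)%:R)^-1 =
     \sum_(j <- iota 1 l.-1) (Num.sqrt j%:R)^-1 :> R.
    rewrite -(big_map (fun n => (l - n)%N) predT (fun j => (Num.sqrt j%:R)^-1)).
    apply: perm_big; apply: uniq_perm; last 1 first.
    - move=> j; apply/mapP/idP => [[n]|].
        rewrite !mem_iota add1n prednK// => /andP[n0 nl] ->.
        by rewrite subn_gt0 nl/= ltn_subrL n0 l0.
      rewrite mem_iota add1n prednK// => /andP[j0 jl]; exists (l - j)%N.
        by rewrite mem_iota add1n prednK// subn_gt0 jl/= ltn_subrL j0 l0.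
      by rewrite subKn// ltnW.
    - rewrite map_inj_in_uniq ?iota_uniq// => a b; rewrite !mem_iota add1n prednK//.
      move=> /andP[_ al] /andP[_ bl] E.
      by rewrite -(subKn (ltnW al)) E subKn// ltnW.
    - exact: iota_uniq.
  have sl := sqr_sqrtr (ltW lR).
  have : \sum_(j <- iota 1 l.-1) (Num.sqrt j%:R)^-1 <= 2 * Num.sqrt l%:R :> R.
    apply: (le_trans (sum_inv_sqrt_le _ _)); rewrite ler_pM2l// ler_sqrt// ler_nat.
    exact: leq_pred.
  move=> h; have ct0 : 0 <= c / tau by apply: divr_ge0 => //; exact: ltW.
  have -> : 2 * c / tau * l%:R = c / tau * (Num.sqrt l%:R * (2 * Num.sqrt l%:R)).
    have -> : Num.sqrt l%:R * (2 * Num.sqrt l%:R) = 2 * l%:R :> R by rewrite -[in RHS]sl; ring.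
    by ring.
  by rewrite ler_wpM2l// ler_wpM2l// sqrtr_ge0.
rewrite e1; apply: (@le_trans _ _ (C * l%:R * (2 * c / tau * l%:R))); last first.
  by rewrite le_eqVlt; apply/orP; left; apply/eqP; ring.
apply: ler_pM => //; first exact: sum_sqr_ge0.
by apply: sumr_ge0 => n _; exact: sqr_ge0.
Qed.

Hypothesis l6 : l%:R ^+ 6 <= t.
(** The threshold for [2^5 * 6 * 8^3 / t <= 1 / 80], the last comparison in [ratio_profile_high]. *)
Definition tail_const : R := 2 ^+ 6 * 6 * 8 ^+ 3 * 40.
Hypothesis tbig : tail_const <= t.

(** Decay is started at [m = l + 1/2], where [(t m / l)^2 - t^2 = (t / l)^2 (l + 1/4)] allows the
    rate [kap = t / l]. From [kap ln (n / m)] a share [5 ln (n / m)] is kept as [(m / n)^5], which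
    beats [n^2] from [lam_le] and the extra [n] and leaves [n^-2]; the rest is at least
    [t / (8 l^2)], a positive power of [t] because [l^6 <= t]. *)
Lemma ratio_profile_high (n : nat) : (l < n)%N ->
  `|lam n * Kn n| * n%:R <= 80^-1 * n%:R ^- 2.
Proof.
move=> ln_; have n0 : (0 < n)%N by exact: leq_ltn_trans ln_.
have nR : 0 < n%:R :> R by rewrite ltr0n.
have l1 : 1 <= l%:R :> R by rewrite ler1n.
have nl1 : l%:R + 1 <= n%:R :> R by rewrite natr1 ler_nat.
pose m : R := l%:R + 2^-1.
have m0 : 0 < m by rewrite /m; lra.
pose a := ln (t * m / l%:R).
have tm0 : 0 < t * m / l%:R by rewrite divr_gt0 ?mulr_gt0.
have tn0 : 0 < t * n%:R / l%:R by rewrite divr_gt0 ?mulr_gt0.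
have a1 : ln t <= a.
  by rewrite ler_ln ?posrE// ler_pdivlMr// ler_pM2l// /m; lra.
have a2 : a <= ln (t * n%:R / l%:R).
  by rewrite ler_ln ?posrE// ler_pM2r ?invr_gt0// ler_pM2l// /m; lra.
pose kap := t / l%:R.
have kap0 : 0 < kap by rewrite divr_gt0.
have kq : kap ^+ 2 <= expR (2 * a) - t ^+ 2.
  rewrite expRM_natl lnK ?posrE// /kap.
  have -> : (t * m / l%:R) ^+ 2 - t ^+ 2 = (t / l%:R) ^+ 2 * (l%:R + 4^-1).
    by rewrite /m; field; rewrite gt_eqF.
  by rewrite ler_peMr ?sqr_ge0//; lra.
have kd := profile_decay pK kap0 kq a1 a2.
have /andP[Kp _] := profile_gt0 pK (le_trans a1 a2).
have xE : ln (t * n%:R / l%:R) - a = ln (n%:R / m).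
  rewrite -ln_div ?posrE//; congr ln; field.
  by rewrite !gt_eqF.
rewrite xE in kd.
have nm1 : 1 < n%:R / m by rewrite ltr_pdivlMr// mul1r /m; lra.
have nm0 : 0 < n%:R / m by lra.
(* From [ln x >= 1 - 1 / x] and [n >= l + 1]. *)
have x1 : (4 * l%:R)^-1 <= ln (n%:R / m).
  have := @expR_ge1Dx R (- ln (n%:R / m)); rewrite expRN lnK ?posrE// => h.
  have e1 : (n%:R / m)^-1 <= 1 - (4 * l%:R)^-1.
    rewrite invf_div ler_pdivrMr//.
    have : (4 * l%:R)^-1 * n%:R <= n%:R - m.
      have i1 : (4 * l%:R)^-1 <= 4^-1 :> R by rewrite invfM ler_piMr ?invr_ge0// invf_le1.
      have i2 : (4 * l%:R)^-1 * l%:R = 4^-1 :> R by field; rewrite gt_eqF.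
      have i0 : 0 < (4 * l%:R)^-1 :> R by rewrite invr_gt0 mulr_gt0.
      rewrite /m; nra.
    by rewrite mulrBl mul1r; lra.
  by lra.
have t100 : 100 <= t by apply: le_trans tbig; rewrite /tail_const; lra.
have k10 : 10 <= kap.
  rewrite /kap ler_pdivlMr//.
  have l2 : l%:R ^+ 2 <= t by apply: le_trans l6; rewrite ler_weXn2l.
  have c1 : 0 <= 10 * l%:R :> R by rewrite mulr_ge0.
  rewrite -ler_sqr ?nnegrE ?(ltW t0)// exprMn.
  by move: (t) t100 l2 => T; nra.
(* Half the rate times the lower bound [1 / (4 l)] for [ln (n / m)]; half suffices because
   [kap >= 10] gives [kap - 5 >= kap / 2]. *)
pose z := t / (8 * l%:R ^+ 2).
have z0 : 0 < z by rewrite divr_gt0// mulr_gt0// exprn_gt0.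
have kd2 : K (ln (t * n%:R / l%:R)) <= (m / n%:R) ^+ 5 * (6 * (8 * l%:R ^+ 2 / t) ^+ 3).
  apply: (le_trans kd).
  have -> : (m / n%:R) ^+ 5 = expR (- (5 * ln (n%:R / m))).
    by rewrite expRN expRM_natl lnK ?posrE// -exprVn invf_div.
  have -> : 6 * (8 * l%:R ^+ 2 / t) ^+ 3 = 3`!%:R / z ^+ 3.
    have -> : 3`! = 6%N by [].
    by rewrite /z; field; rewrite !gt_eqF.
  apply: (@le_trans _ _ (expR (- (5 * ln (n%:R / m))) * expR (- z))).
    rewrite -expRD ler_expR.
    have zE : z = kap / 2 * (4 * l%:R)^-1 by rewrite /z /kap; field; rewrite gt_eqF.
    have : kap / 2 * (4 * l%:R)^-1 <= (kap - 5) * ln (n%:R / m).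
      by apply: ler_pM; solve [exact: x1 | lra | rewrite invr_ge0; lra].
    by rewrite -zE; lra.
  by rewrite ler_wpM2l ?expR_ge0//; exact: expRN_le_pow.
have Kp' : 0 < Kn n := Kp.
rewrite normrM (gtr0_norm Kp').
apply: (@le_trans _ _ (n%:R ^+ 2 * ((m / n%:R) ^+ 5 * (6 * (8 * l%:R ^+ 2 / t) ^+ 3)) * n%:R)).
  rewrite ler_pM2r//; apply: ler_pM; [exact: normr_ge0|exact: ltW|exact: lam_le|exact: kd2].
have -> : n%:R ^+ 2 * ((m / n%:R) ^+ 5 * (6 * (8 * l%:R ^+ 2 / t) ^+ 3)) * n%:R =
   (m ^+ 5 * (6 * 8 ^+ 3 * l%:R ^+ 6 / t ^+ 3)) * n%:R ^- 2.
  by field; rewrite !gt_eqF.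
rewrite ler_pM2r ?invr_gt0 ?exprn_gt0//.
apply: (@le_trans _ _ ((2 * l%:R) ^+ 5 * (6 * 8 ^+ 3 * l%:R ^+ 6 / t ^+ 3))).
  apply: ler_wpM2r.
    by apply: divr_ge0; [apply: mulr_ge0; rewrite ?exprn_ge0//; lra|exact/exprn_ge0/ltW].
  by rewrite lerXn2r ?nnegrE ?(ltW m0) ?mulr_ge0 ?(ltW lR)// /m; lra.
have -> : (2 * l%:R) ^+ 5 * (6 * 8 ^+ 3 * l%:R ^+ 6 / t ^+ 3) =
  (2 ^+ 5 * 6 * 8 ^+ 3) * (l%:R ^+ 11 / t ^+ 2 / t) by field; rewrite gt_eqF.
have l11 : l%:R ^+ 11 / t ^+ 2 <= 1.
  rewrite ler_pdivrMr ?exprn_gt0// mul1r.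
  apply: (@le_trans _ _ (l%:R ^+ 12)); first by rewrite ler_weXn2l.
  have -> : l%:R ^+ 12 = (l%:R ^+ 6) ^+ 2 :> R by rewrite -exprM.
  by apply: lerXn2r; solve [exact: l6 | rewrite nnegrE; exact/exprn_ge0/ltW].
apply: (@le_trans _ _ ((2 ^+ 5 * 6 * 8 ^+ 3) * (1 / t))).
  by apply: ler_wpM2l; [lra|rewrite ler_pM2r ?invr_gt0].
rewrite div1r ler_pdivrMr//.
by have := tbig; rewrite /tail_const; move: (t) => T; lra.
Qed.

Lemma cosn_lipschitz (n : nat) (x y : R) : `|cosn n x - cosn n y| <= 2 * pi * n%:R * `|x - y|.
Proof.
apply: (@mean_value_norm_le _ (cosn n) (fun x => - (2 * pi * n%:R * sin (2 * pi * n%:R * x)))).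
  move=> u _; rewrite /cosn; move: (2 * pi * n%:R) => a.
  by apply: is_derive_eq; rewrite /GRing.scale/=; ring.
move=> u _; rewrite normrN normrM ger0_norm; last by rewrite !mulr_ge0 ?pi_ge0.
by rewrite ler_piMr ?sin_max// !mulr_ge0 ?pi_ge0.
Qed.

Hypothesis laml : 2^-1 <= `|lam l|.
Hypothesis lowsum : \sum_(n <- iota 1 l.-1) `|lam n * Kn n| <= 80^-1.

(** Divided by its [l]-th term, the expansion is [cosn l] plus a remainder. Dividing by [V], of size
    at least [1/4], costs a factor [4], and the low and high sums are at most [1/80] each, so the
    remainder is at most [4 * 2 / 80 = 1/10]; its Lipschitz constant is at most a tenth of
    [2 pi l]. *)
Lemma horocycle_zeros : has_zeros_on phi (closed_horocycle (t / (2 * pi * l%:R))) (2 * l)%N.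
Proof.
pose Y : R := t / (2 * pi * l%:R).
have p0 : 0 < 2 * pi :> R by rewrite mulr_gt0 ?pi_gt0.
have pl0 : 0 < 2 * pi * l%:R :> R by rewrite mulr_gt0.
have Y0 : 0 < Y by rewrite divr_gt0.
have YE : 2 * pi * Y = t / l%:R.
  by rewrite /Y; move: (2 * pi) p0 => p p0'; field; rewrite !gt_eqF.
have uE n : 2 * pi * n%:R * Y = t * n%:R / l%:R.
  by have -> : 2 * pi * n%:R * Y = n%:R * (2 * pi * Y); [ring|rewrite YE; field; rewrite gt_eqF].
pose c := Num.sqrt (2 * pi * Y) * k0.
have c0 : c != 0 by rewrite mulf_neq0// gt_eqF// sqrtr_gt0 YE divr_gt0.
have cE n : (0 < n)%N -> coef phi n Y = c * (lam n * Kn n).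
  by move=> n0; rewrite coefE// uE.
have Kl : 2^-1 <= Kn l.
  rewrite /ratio_profile mulfK ?gt_eqF//; apply: (profile_turning pK).
  by rewrite lexx/= lerDl divr_ge0// invr_ge0 exprn_ge0// ltW.
pose V := lam l * Kn l.
have V4 : 4^-1 <= `|V|.
  rewrite normrM (_ : 4^-1 = 2^-1 * 2^-1); last by field.
  by apply: ler_pM => //; apply: le_trans Kl _; exact: ler_norm.
have V0 : V != 0 by rewrite -normr_gt0; apply: lt_le_trans V4; lra.
have Vp : 0 < `|V| by rewrite normr_gt0.
have [D D0 hD] := coef_summable mphi Y0.
pose g x : R := in_coordinates phi (x, Y) / (2 * c * V).
pose D' := 2 * D / `|2 * c * V|.
have cV0 : 2 * c * V != 0 by apply: mulf_neq0 => //; apply: mulf_neq0 => //; rewrite pnatr_eq0.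
have cVp : 0 < `|2 * c * V| by rewrite normr_gt0.
have D'0 : 0 <= D' by rewrite divr_ge0// mulr_ge0.
pose w n : R := lam n * Kn n / V.
(* The indices up to [l + N], with [l] left out. *)
pose s N := iota 1 l.-1 ++ iota l.+1 N.
have iE N : iota 1 (l + N) = iota 1 l.-1 ++ l :: iota l.+1 N.
  by rewrite -{1}(prednK l0) addSnnS iotaD/= add1n prednK.
have h1 N x : `|(g x - cosn l x) - \sum_(n <- s N) w n * cosn n x| <= D' / N.+1%:R.
  have := form_fourier_all mphi Y0 D0 hD (l + N).-1 x.
  have lN0 : (0 < l + N)%N by rewrite addn_gt0 l0.
  rewrite prednK// => h.
  have -> : (g x - cosn l x) - \sum_(n <- s N) w n * cosn n x =
     (in_coordinates phi (x, Y) - cos_sum (coef phi ^~ Y) (l + N) x) / (2 * c * V).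
    have -> : cos_sum (coef phi ^~ Y) (l + N) x = (2 * c * V) * (cosn l x + \sum_(n <- s N) w n * cosn n x).
      rewrite /cos_sum iE /s !big_cat/= big_cons addrCA mulrDr; congr (_ + _).
        by rewrite cE// -/V; ring.
      rewrite mulrDr !mulr_sumr; congr (_ + _); apply: eq_big_seq => n; rewrite mem_iota => /andP[n0 _].
        by rewrite cE// /w; field.
      by rewrite cE ?(leq_trans _ n0)// /w; field.
    by rewrite /g mulrBl [_ * (cosn l x + _)]mulrC mulfK// opprD addrA.
  rewrite normrM normfV ler_pdivrMr//; apply: (le_trans h).
  have -> : D' / N.+1%:R * `|2 * c * V| = 2 * D / N.+1%:R by rewrite /D'; field; rewrite !gt_eqF.
  rewrite ler_wpM2l ?mulr_ge0// lef_pV2 ?posrE ?ltr0n// ler_nat.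
  by rewrite -{1}add1n leq_add2r.
have wn n : `|w n| = `|lam n * Kn n| / `|V| by rewrite /w normrM normfV.
have iV : `|V|^-1 <= 4 by rewrite -[leRHS]invrK lef_pV2 ?posrE.
have high N : \sum_(n <- iota l.+1 N) `|lam n * Kn n| * n%:R <= 80^-1.
  apply: (@le_trans _ _ (\sum_(n <- iota l.+1 N) 80^-1 * n%:R ^- 2)).
    rewrite big_seq [leRHS]big_seq; apply: ler_sum => n; rewrite mem_iota => /andP[ln_ _].
    exact: ratio_profile_high.
  rewrite -mulr_sumr -[leRHS]mulr1 ler_pM2l ?invr_gt0//.
  rewrite -(prednK l0); apply: (le_trans (sum_inv_sqr_le R _ _)).
  apply: (@le_trans _ _ l.-1.+1%:R^-1); first by rewrite gerBl invr_ge0.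
  by rewrite invf_le1 ?ltr0n// ler1n.
have l1 : 1 <= l%:R :> R by rewrite ler1n.
(* The weight [n] serves the Lipschitz bound: below [l] it is at most [l], above [l] it is already
   included in [ratio_profile_high]. *)
have h3 N : \sum_(n <- s N) `|w n| * n%:R <= l%:R / 10.
  under eq_bigr do rewrite wn mulrAC.
  rewrite -mulr_suml /s big_cat/=.
  have lo : \sum_(n <- iota 1 l.-1) `|lam n * Kn n| * n%:R <= 80^-1 * l%:R.
    apply: (@le_trans _ _ (\sum_(n <- iota 1 l.-1) `|lam n * Kn n| * l%:R)).
      rewrite big_seq [leRHS]big_seq; apply: ler_sum => n; rewrite mem_iota add1n prednK// => /andP[_ nl].
      by rewrite ler_wpM2l// ler_nat ltnW.
    by rewrite -mulr_suml ler_pM2r.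
  have hi := high N.
  have hs0 : 0 <= \sum_(n <- iota 1 l.-1) `|lam n * Kn n| * n%:R + \sum_(n <- iota l.+1 N) `|lam n * Kn n| * n%:R.
    by apply: addr_ge0; apply: sumr_ge0 => n _; apply: mulr_ge0.
  apply: (@le_trans _ _ ((\sum_(n <- iota 1 l.-1) `|lam n * Kn n| * n%:R + \sum_(n <- iota l.+1 N) `|lam n * Kn n| * n%:R) * 4)).
    by rewrite ler_wpM2l.
  by move: lo hi; move: (\sum_(n <- iota 1 _) _) (\sum_(n <- iota l.+1 _) _) => A B; lra.
have h2 N : \sum_(n <- s N) `|w n| <= 10^-1.
  under eq_bigr do rewrite wn.
  rewrite -mulr_suml /s big_cat/=.
  have hi : \sum_(n <- iota l.+1 N) `|lam n * Kn n| <= 80^-1.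
    apply: le_trans (high N); rewrite big_seq [leRHS]big_seq; apply: ler_sum => n.
    rewrite mem_iota => /andP[ln_ _]; rewrite ler_peMr// ler1n.
    exact: leq_trans ln_.
  have hs0 : 0 <= \sum_(n <- iota 1 l.-1) `|lam n * Kn n| + \sum_(n <- iota l.+1 N) `|lam n * Kn n|.
    by apply: addr_ge0; apply: sumr_ge0.
  apply: (@le_trans _ _ ((\sum_(n <- iota 1 l.-1) `|lam n * Kn n| + \sum_(n <- iota l.+1 N) `|lam n * Kn n|) * 4)).
    by rewrite ler_wpM2l.
  by move: lowsum hi; move: (\sum_(n <- iota 1 _) _) (\sum_(n <- iota l.+1 _) _) => A B; lra.
have cg : continuous g.
  move=> x; apply: cvgM; last exact: cvg_cst.
  exact: (form_slice_continuous mphi Y0).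
have gc x : `|g x - cosn l x| <= 10^-1.
  apply: (@le_of_le_add_div _ _ _ D') => N.
  have -> : g x - cosn l x = \sum_(n <- s N) w n * cosn n x +
     ((g x - cosn l x) - \sum_(n <- s N) w n * cosn n x) by ring.
  apply: (le_trans (ler_normD _ _)); apply: lerD => //.
  apply: le_trans (h2 N); apply: (le_trans (ler_norm_sum _ _ _)); apply: ler_sum => n _.
  by rewrite normrM ler_piMr// normr_cosn_le1.
have gL x y : `|(g x - cosn l x) - (g y - cosn l y)| <= 2 * pi * l%:R / 10 * `|x - y|.
  (* The Lipschitz bound is proved for finite sums and passes to the limit, so the series is never
     differentiated term by term. *)
  apply: (@le_of_le_add_div _ _ _ (2 * D')) => N.
  set A := g x - cosn l x; set B := g y - cosn l y.
  pose Sx := \sum_(n <- s N) w n * cosn n x; pose Sy := \sum_(n <- s N) w n * cosn n y.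
  have -> : A - B = (Sx - Sy) + ((A - Sx) - (B - Sy)) by ring.
  apply: (le_trans (ler_normD _ _)); apply: lerD; last first.
    apply: (le_trans (ler_normB _ _)); apply: (le_trans (lerD (h1 N x) (h1 N y))).
    by rewrite -mulrDl; have -> : D' + D' = 2 * D' by ring.
  rewrite /Sx /Sy -sumrB; apply: (le_trans (ler_norm_sum _ _ _)).
  apply: (@le_trans _ _ (\sum_(n <- s N) (`|w n| * n%:R) * (2 * pi * `|x - y|))).
    apply: ler_sum => n _; rewrite -mulrBr normrM -mulrA ler_wpM2l//.
    by apply: (le_trans (cosn_lipschitz _ _ _)); rewrite le_eqVlt; apply/orP; left; apply/eqP; ring.
  rewrite -mulr_suml; apply: (@le_trans _ _ (l%:R / 10 * (2 * pi * `|x - y|))).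
    by apply: ler_wpM2r (h3 N); apply: mulr_ge0 => //; exact: ltW.
  by rewrite le_eqVlt; apply/orP; left; apply/eqP; ring.
have [e [e1 e2 e3]] := perturbed_cos_zeros l0 cg gc gL.
have g0 x : (g x == 0) = (phi (x +i* Y) == 0).
  by rewrite /g mulf_eq0 invr_eq0 (negbTE cV0) orbF.
have zE : closed_horocycle Y `&` [set z | phi z = 0] = (fun k => e k +i* Y) @` `I_(2 * l).
  apply/seteqP; split.
  - move=> [x y] [[/= xh yY] /= pz]; subst y.
    have gx : g x = 0 by apply/eqP; rewrite g0; apply/eqP.
    have [k kl kx] := e3 x (conj xh gx).
    by exists k => //; rewrite kx.
  - move=> _ [k kl <-]; have [h gk] := e1 k kl; split; first by split.
    by apply/eqP; rewrite -g0 gk.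
rewrite /has_zeros_on -/Y zE; apply: inj_card_eq => i j il jl [E]; exact: e2.
Qed.

End MainEstimate.

(** * Choice of [l] among primes and their squares *)

Lemma hecke_prime_square (R : realType) (lam : nat -> R) (p : nat) : prime p ->
  (forall m n, (0 < m)%N -> (0 < n)%N ->
    lam m * lam n = \sum_(d <- divisors (gcdn m n)) lam (m * n %/ d ^ 2)%N) ->
  lam 1%N = 1 -> lam p ^+ 2 = lam (p ^ 2)%N + 1.
Proof.
move=> pp hecke lam1; have p0 := prime_gt0 pp; have p1 := prime_gt1 pp.
rewrite expr2 hecke// gcdnn.
have /(perm_big _) -> : perm_eq (divisors p) [:: 1%N; p].
  apply: uniq_perm; first exact: divisors_uniq.
    by rewrite /= inE andbT neq_ltn p1.
  move=> d; rewrite -dvdn_divisors// !inE.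
  apply/idP/idP => [dp|/orP[/eqP ->|/eqP ->]]; [|exact: dvd1n|exact: dvdnn].
  by have /primeP[_ /(_ d dp)] := pp.
by rewrite big_cons big_seq1 exp1n divn1 mulnn divnn expn_gt0 p0 lam1.
Qed.

Lemma prime_square_false (p q : nat) : prime p -> prime q -> p = (q ^ 2)%N -> False.
Proof.
move=> pp pq E; have q1 := prime_gt1 pq; have q0 := prime_gt0 pq.
have : (q %| p)%N by rewrite E expnS dvdn_mulr.
rewrite dvdn_prime2// => /eqP qE; move: E; rewrite -qE expnS expn1 => E.
have : (q * 1 == q * q)%N by rewrite muln1 -E.
by rewrite eqn_pmul2l// ltn_eqF.
Qed.

(** Chebyshev's bound divides by a logarithm, here at most [ln t]; trading it for [(4 / e) t^(e/4)]
    keeps pure powers. *)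
Lemma prime_count_lower (R : realType) (t e X : R) : 0 < e -> 1 <= t -> 4 <= X -> X <= t ->
  e * ln 2 / 16 * (X / t `^ (e / 4)) <=
    (size [seq p <- iota 0 (Num.truncn (X / 2)).*2.+1 | prime p])%:R.
Proof.
move=> e0 t1 X4 Xt; set n := Num.truncn _; set P := size _.
have ln20 : 0 < ln 2 :> R by rewrite ln_gt0// ltr1n.
have X20 : 0 <= X / 2 by lra.
have /andP[n1 n2] := truncn_itv X20; rewrite -/n in n1 n2.
have n3 : X / 2 < n%:R + 1 by rewrite natr1.
have nX : X / 4 <= n%:R by lra.
have n0 : (0 < n)%N by rewrite -(ltr_nat R); lra.
have t0 : 0 < t by lra.
have h := chebyshev_lower n0; rewrite -/P in h.
have d2 : n.*2%:R = 2 * n%:R :> R by rewrite -mul2n natrM.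
have h2 : n%:R * ln 2 <= P%:R * ln t.
  have : (2 ^ n)%N%:R <= (n.*2 ^ P)%N%:R :> R by rewrite ler_nat.
  rewrite !natrX -ler_ln ?posrE ?exprn_gt0 ?ltr0n ?double_gt0// !lnXn ?ltr0n ?double_gt0//.
  rewrite -[ln 2 *+ n]mulr_natl -[_ *+ P]mulr_natl => /le_trans; apply.
  rewrite ler_wpM2l// ler_ln ?posrE ?ltr0n ?double_gt0// d2; lra.
have te0 : 0 < t `^ (e / 4) by rewrite powR_gt0.
have lt : ln t <= 4 / e * t `^ (e / 4).
  have : e / 4 * ln t <= t `^ (e / 4).
    rewrite -ln_powR; have := @expR_ge1Dx R (ln (t `^ (e / 4))).
    by rewrite lnK ?posrE//; lra.
  have e40 : 0 < e / 4 by lra.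
  move=> h3; rewrite -(ler_pM2l e40); apply: (le_trans h3).
  by rewrite le_eqVlt; apply/orP; left; apply/eqP; field; rewrite gt_eqF.
have h3 : X / 4 * ln 2 <= P%:R * (4 / e * t `^ (e / 4)).
  apply: (@le_trans _ _ (n%:R * ln 2)); first by rewrite ler_pM2r.
  by apply: (le_trans h2); rewrite ler_wpM2l.
have c0 : 0 < 4 / e * t `^ (e / 4) by rewrite mulr_gt0// divr_gt0.
rewrite -(ler_pM2r c0); apply: le_trans h3.
by rewrite le_eqVlt; apply/orP; left; apply/eqP; field; rewrite !gt_eqF.
Qed.

Theorem many_horocycles (R : realType) :
  exists2 eps0 : R, 0 < eps0 & forall eps : R, 0 < eps < eps0 ->
     exists A B c T : R, [/\ 0 < A, 0 < B, 0 < c &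
       forall (t : R) (phi : R[i] -> R),
         even_hecke_maass_cusp_form t phi -> T <= t ->
         exists2 L : {fset nat},
           c * t `^ (12^-1 - eps) <= (#|` L|)%:R &
           forall l : nat, l \in L ->
             A <= l%:R <= B * t `^ (6^-1 - eps) /\
             has_zeros_on phi (closed_horocycle (t / (2 * pi * l%:R)))
               (2 * l)%N].
Proof.
exists 12^-1; first by rewrite invr_gt0.
have losum := @low_sum_le R; move: (2000 : R) (ler0n R 2000) losum => c2 c20 losum.
move=> eps /andP[e0 e12].
have [C3 C30 hC3] := hecke_mean_square e0.
(* Primes are taken up to [X = t^e1]. The loss of [3/4 eps] leaves [eps / 4] for the logarithm in
   the prime count, and [X^2 = t^(1/6 - 3/2 eps)] gives [t^eps l^2 <= t^(1/3 - 2 eps)], with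
   [t^(2 eps)] to spare for the constant [c4]. *)
pose e1 : R := 12^-1 - 3 / 4 * eps.
have e10 : 0 < e1 by rewrite /e1; lra.
pose c4 : R := C3 * (2 * c2) * 80 ^+ 2.
have ln20 : 0 < ln 2 :> R by rewrite ln_gt0// ltr1n.
(* The four thresholds secure in turn [tau >= 2], the tail bound, [c4 <= t^(2 eps)] and [X >= 4]. *)
exists 1, 1, (eps * ln 2 / 16),
  (Num.max 8 (Num.max (tail_const R) (Num.max (c4 `^ (2 * eps)^-1) (4 `^ e1^-1)))).
split => //; first by rewrite divr_gt0 ?mulr_gt0.
move=> t phi mphi; rewrite !ge_max => /and4P[t8 ttail tc4 t4].
have t1 : 1 <= t by lra.
have t0 : 0 < t by lra.
pose tau := t `^ 3^-1.
have tau0 : 0 <= tau by exact: powR_ge0.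
have tauE : tau ^+ 3 = t.
  by rewrite -powR_mulrn// -powRrM mulVf// powRr1// ltW.
have tau2 : 2 <= tau.
  rewrite leNgt; apply/negP => tau2.
  have : tau ^+ 3 < 2 ^+ 3 by rewrite ltrXn2r.
  by rewrite tauE; lra.
have mphi' := mphi; rewrite -tauE in mphi'.
have [lam [K [k0 [k00 pK coefE hecke [lam1 lam_le]]]]] := form_data mphi' tau2.
have crude N : sum_sqr lam N <= crude_const R * t ^+ 12 * N%:R.
  by have := crude_sum_le mphi' tau2 k00 pK coefE lam_le N; rewrite tauE.
have hS := hC3 t lam t1 hecke crude.
pose X := t `^ e1.
have X4 : 4 <= X.
  have -> : 4 = (4 `^ e1^-1) `^ e1 :> R by rewrite -powRrM mulVf ?gt_eqF// powRr1.
  by rewrite ge0_ler_powR ?nnegrE ?powR_ge0 ?(ltW e10) ?(ltW t0).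
have Xt : X <= t by rewrite -[leRHS](powRr1 (ltW t0)) ler_powR// /e1; lra.
pose n := Num.truncn (X / 2).
pose Ps := [seq p <- iota 0 n.*2.+1 | prime p].
pose idx p := if 2^-1 <= `|lam p| then p else (p ^ 2)%N.
have Pprime p : p \in Ps -> prime p by rewrite mem_filter => /andP[].
have PX p : p \in Ps -> p%:R <= X.
  rewrite mem_filter mem_iota add0n ltnS => /andP[_ /andP[_ pn]].
  have X20 : 0 <= X / 2 by lra.
  have /andP[n1 _] := truncn_itv X20.
  apply: (@le_trans _ _ n.*2%:R); first by rewrite ler_nat.
  by rewrite -mul2n natrM; rewrite -/n in n1; lra.
have idx_le p : p \in Ps -> (idx p)%:R <= X ^+ 2.
  move=> pPs; have pX := PX _ pPs; have pp := Pprime _ pPs.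
  have p1 : 1 <= p%:R :> R by rewrite ler1n prime_gt0.
  apply: (@le_trans _ _ (p%:R ^+ 2)); last by rewrite lerXn2r ?nnegrE// (le_trans _ pX).
  rewrite /idx; case: ifP => _; last by rewrite natrX.
  by rewrite expr2 ler_peMr.
have X2E : X ^+ 2 = t `^ (6^-1 - 3 / 2 * eps).
  rewrite -powR_mulrn ?powR_ge0// -powRrM; congr (_ `^ _).
  by rewrite /e1; field.
have idx_lam p : p \in Ps -> 2^-1 <= `|lam (idx p)|.
  (* If [|lam p| < 1/2] then [lam (p^2) = lam p ^ 2 - 1 < - 3/4]. *)
  move=> pPs; rewrite /idx; case: ifPn => //; rewrite -ltNge => h.
  have := hecke_prime_square (Pprime _ pPs) hecke lam1.
  rewrite -(real_normK (num_real (lam p))) => E.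
  have := ler_norm (- lam (p ^ 2)%N); rewrite normrN.
  have := normr_ge0 (lam p); move: (`|lam p|) h E => a h E a0.
  by nra.
have idx_gt0 p : p \in Ps -> (0 < idx p)%N.
  move=> /Pprime/prime_gt0 p0; rewrite /idx; case: ifP => // _.
  by rewrite expn_gt0 p0.
(* A prime is never the square of a prime, so no [l] is counted twice. *)
have idx_inj : {in Ps &, injective idx}.
  move=> p q /Pprime pp /Pprime pq; rewrite /idx; case: ifP => _; case: ifP => _ //.
  - by move=> E; case: (prime_square_false pp pq E).
  - by move=> E; case: (prime_square_false pq pp (esym E)).
  - by move=> /eqP; rewrite eqn_exp2r// => /eqP.
exists [fset x in [seq idx p | p <- Ps]]%fset.
  rewrite card_fseq undup_id; last by rewrite map_inj_in_uniq// filter_uniq// iota_uniq.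
  rewrite size_map; apply: le_trans (prime_count_lower e0 t1 X4 Xt).
  rewrite ler_wpM2l; [by []|by rewrite divr_ge0// mulr_ge0// ltW|].
  rewrite /X -powRN -powRD; last by rewrite (gt_eqF t0) implybT.
  by rewrite ler_powR// /e1; lra.
move=> l; rewrite !inE => /mapP[p pPs ->]; move: (idx p) (idx_le _ pPs) (idx_lam _ pPs) (idx_gt0 _ pPs).
move=> {}l lX llam l0.
have lR : 0 < l%:R :> R by rewrite ltr0n.
have l1 : 1 <= l%:R :> R by rewrite ler1n.
rewrite X2E in lX.
split.
  rewrite l1 mul1r; apply: (le_trans lX); rewrite ler_powR//; lra.
have l6 : l%:R ^+ 6 <= t.
  have -> : t = (t `^ 6^-1) ^+ 6 by rewrite -powR_mulrn ?powR_ge0// -powRrM mulVf// powRr1// ltW.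
  rewrite lerXn2r ?nnegrE ?powR_ge0//; apply: (le_trans lX).
  by rewrite ler_powR//; lra.
have lt : l%:R <= t by apply: le_trans l6; rewrite -[leLHS]expr1 ler_weXn2l.
have hl : sum_sqr lam l.-1 <= C3 * t `^ eps * l%:R.
  have ll : l.-1%:R <= l%:R :> R by rewrite ler_nat leq_pred.
  apply: (le_trans (hS _ (le_trans ll lt))); rewrite ler_wpM2l//.
  by rewrite mulr_ge0 ?powR_ge0// ltW.
have Ce0 : 0 <= C3 * t `^ eps by rewrite mulr_ge0 ?powR_ge0// ltW.
rewrite -[in closed_horocycle _]tauE.
apply: (@horocycle_zeros R tau phi mphi' tau2 lam K k0 k00 pK coefE lam_le l l0).
- by rewrite tauE.
- by rewrite tauE.
- exact: llam.
have := losum _ tau2 _ _ pK _ l0 _ Ce0 hl.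
set Sg := \sum_(_ <- _) _ => hSg.
have Sg0 : 0 <= Sg by apply: sumr_ge0.
have i80 : 0 <= 80^-1 :> R by rewrite invr_ge0.
rewrite -ler_sqr ?nnegrE//; apply: (le_trans hSg).
have taup : 0 < tau by lra.
have -> : C3 * t `^ eps * (2 * c2 / tau) * l%:R ^+ 2 = (C3 * (2 * c2)) * (t `^ eps * l%:R ^+ 2) / tau by ring.
rewrite ler_pdivrMr// exprVn [leRHS]mulrC ler_pdivlMr ?exprn_gt0//.
have -> : C3 * (2 * c2) * (t `^ eps * l%:R ^+ 2) * 80 ^+ 2 = c4 * (t `^ eps * l%:R ^+ 2).
  by rewrite /c4; move: (80 ^+ 2 : R) => v; ring.
have l2 : l%:R ^+ 2 <= t `^ (3^-1 - 3 * eps).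
  have -> : t `^ (3^-1 - 3 * eps) = (t `^ (6^-1 - 3 / 2 * eps)) ^+ 2.
    by rewrite -powR_mulrn ?powR_ge0// -powRrM; congr (_ `^ _); field.
  by rewrite lerXn2r ?nnegrE ?powR_ge0.
have c40 : 0 <= c4 by rewrite /c4 !mulr_ge0 ?exprn_ge0// ltW.
have c4t : c4 <= t `^ (2 * eps).
  have -> : c4 = (c4 `^ (2 * eps)^-1) `^ (2 * eps).
    by rewrite -powRrM mulVf ?powRr1// gt_eqF// mulr_gt0.
  by rewrite ge0_ler_powR ?nnegrE ?powR_ge0 ?mulr_ge0 ?(ltW e0) ?(ltW t0).
apply: (@le_trans _ _ (t `^ (2 * eps) * (t `^ eps * t `^ (3^-1 - 3 * eps)))).
  apply: ler_pM => //; first by rewrite mulr_ge0 ?powR_ge0 ?exprn_ge0.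
  by rewrite ler_wpM2l ?powR_ge0.
have tN : t != 0 by rewrite gt_eqF.
rewrite -!powRD ?tN ?implybT// /tau.
by rewrite le_eqVlt; apply/orP; left; apply/eqP; congr (_ `^ _); field.
Qed.

Theorem theorem5p3 (R : realType) :
  (exists2 eps0 : R, 0 < eps0 & forall eps : R, 0 < eps < eps0 ->
     exists A B c T : R, [/\ 0 < A, 0 < B, 0 < c &
       forall (t : R) (phi : R[i] -> R),
         even_hecke_maass_cusp_form t phi -> T <= t ->
         exists2 L : {fset nat},
           c * t `^ (12^-1 - eps) <= (#|` L|)%:R &
           forall l : nat, l \in L ->
             A <= l%:R <= B * t `^ (6^-1 - eps) /\
             has_zeros_on phi (closed_horocycle (t / (2 * pi * l%:R)))
               (2 * l)%N])
  /\
  (forall N : nat, exists T : R,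
     forall (t : R) (phi : R[i] -> R),
       even_hecke_maass_cusp_form t phi -> T <= t ->
       exists2 S : {fset R},
         (N <= #|` S|)%N &
         forall Y : R, Y \in S ->
           0 < Y /\
           exists2 n : nat, n%:R = pi^-1 * (t / Y) &
             has_zeros_on phi (closed_horocycle Y) n).
Proof.
split; first exact: many_horocycles.
move=> N; have [eps0 eps00 h] := many_horocycles R.
(* [eps <= 1/24] keeps the exponent [1/12 - eps] positive, so the number of [l] eventually passes
   any [N]. The heights [Y = t / (2 pi l)] are distinct, and [2 l = t / (pi Y)]. *)
pose eps := Num.min (eps0 / 2) 24^-1.
have e0 : 0 < eps by rewrite /eps lt_min; apply/andP; split; [rewrite divr_gt0|rewrite invr_gt0].
have e1 : eps < eps0 by rewrite /eps gt_min; apply/orP; left; lra.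
have e24 : eps <= 24^-1 by rewrite /eps ge_min lexx orbT.
have [A [B [c [T [A0 B0 c0 hT]]]]] := h eps (introT andP (conj e0 e1)).
pose r : R := 12^-1 - eps.
have r0 : 0 < r by rewrite /r; lra.
exists (Num.max T ((N%:R / c) `^ r^-1)) => t phi mphi; rewrite ge_max => /andP[Tt Nt].
have t0 := maass_spectral_gt0 mphi.
have [L hL hz] := hT t phi mphi Tt.
have p0 : 0 < 2 * pi :> R by rewrite mulr_gt0 ?pi_gt0.
pose g (l : nat) : R := t / (2 * pi * l%:R).
have ginj : injective g.
  move=> i j /(mulfI (lt0r_neq0 t0))/invr_inj/(mulfI (lt0r_neq0 p0)) /eqP.
  by rewrite eqr_nat => /eqP.
exists [fset x in [seq g l | l <- enum_fset L]]%fset.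
  rewrite card_fseq undup_id; last by rewrite map_inj_uniq// fset_uniq.
  rewrite size_map -(ler_nat R); apply: le_trans hL.
  rewrite -ler_pdivrMl// mulrC.
  have -> : N%:R / c = ((N%:R / c) `^ r^-1) `^ r.
    by rewrite -powRrM mulVf ?gt_eqF// powRr1// divr_ge0// ltW.
  by rewrite ge0_ler_powR ?nnegrE ?powR_ge0 ?(ltW r0) ?(ltW t0).
move=> Y; rewrite !inE => /mapP[l lL ->].
have [/andP[Al _] zl] := hz l lL.
have l0 : 0 < l%:R :> R by apply: lt_le_trans Al.
have pl : 0 < 2 * pi * l%:R :> R by rewrite mulr_gt0.
split; first by rewrite divr_gt0.
exists (2 * l)%N => //.
have pp := pi_gt0 R.
rewrite /g natrM; move: (pi) pp => q q0; field.
by rewrite !gt_eqF.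
Qed.
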